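(* Let $M>0$, and consider the one-dimensional regression model, the wavelet basis $(\psi_{j,k})$, the class of distributions $\mathcal M(\Theta_s)$ and the wavelet thresholding estimator $\hat f$ with threshold $\lambda_n=\kappa\sqrt{\log n/n}$ and highest level $J$ described in the context. For every $s>\frac12$, with $$\eta_n=\Big[\frac{n}{\log n}\Big]^{-\frac{s}{1+2s}},$$ there exist positive constants $\gamma,T,D$ such that $$\sup_{\rho\in\mathcal M(\Theta_s)}\rho^{\otimes n}\Big\{\|f_\rho-\hat f\|_{\rho_X}>\eta\Big\}\;\le\; T\cdot\begin{cases} e^{-\gamma\,[\,n2^{-J}J^{-1}\eta^2\,\vee\,\log n\,]}, & \eta\ge D\eta_n,\\ 1, & \eta\le D\eta_n,\end{cases}$$ as long as $$\Big[\frac{n}{\log n}\Big]^{\frac{1}{1+2s}}\le 2^J\le\Big[\frac{n}{\log n}\Big]^{\frac12}.$$ Here $a\vee b=\max(a,b)$.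
   Context: Model: $\mathbb X\subset\mathbb R$ is a compact domain. One observes an i.i.d. sample $(X_i,Y_i)$, $i=1,\dots,n$, from a probability distribution $\rho$ on $\mathbb X\times[-M/2,M/2]$, with law $\rho^{\otimes n}$; $\rho_X$ is the marginal law of $X$ and $f_\rho(x)=\mathbb E_\rho[Y\mid X=x]$. The distribution function $G(t)=\rho(X\le t)$ is assumed differentiable, and $G^{-1}(x)=\inf\{t\in\mathbb R:\ G(t)\ge x\}$ for $x\in[0,1]$. The loss is $\|g\|_{\rho_X}=\big[\int g(x)^2\,d\rho_X(x)\big]^{1/2}$. Wavelets: $\{\psi_{j,k}:\ j\ge\underline j,\ 0\le k<2^j\}$ is a standard compactly supported orthonormal wavelet basis of $L_2([0,1])$ (wavelets on the interval, with the usual scaling $\psi_{j,k}(x)=2^{j/2}\psi(2^jx-k)$ up to boundary modifications), where for the fixed coarsest level $\underline j$ the functions $\psi_{\underline j,k}=\phi_{\underline j,k}$ are the scaling functions. The basis functions are at least continuously differentiable, satisfy enough moment conditions (so that the description of the Besov space $B^s_\infty(L_\infty([0,1]))$ by the size of wavelet coefficients is valid), and the support of $\psi_{j,k}$ has length at most $N2^{-j}$ for a fixed constant $N$. Class $\mathcal M(\Theta_s)$: the set of probability distributions $\rho$ on $\mathbb X\times[-M/2,M/2]$ whose distribution function $G(t)=\rho(X\le t)$ is differentiable and for which $f_\rho\circ G^{-1}$ belongs to the ball of radius $M$ of the Besov space $B^s_\infty(L_\infty([0,1]))$, with norm defined by wavelet coefficients: if $f_\rho\circ G^{-1}=\sum_{j\ge\underline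 j}\sum_{0\le k<2^j}\beta_{j,k}\psi_{j,k}$, the norm is $\sup_{j\ge\underline j}2^{j(s+\frac12)}\sup_{0\le k<2^j}|\beta_{j,k}|$. Estimator: let $\hat G_n(x)=\frac1n\sum_{i=1}^n\mathbf 1\{X_i\le x\}$, let $X_{(1)}\le\dots\le X_{(n)}$ be the ordered sample, and let $Y_{(i)}$ be the observation paired with $X_{(i)}$. Put $$\hat\beta_{j,k}=\frac1n\sum_{i=1}^nY_i\,\psi_{j,k}(\hat G_n(X_i))=\frac1n\sum_{i=1}^nY_{(i)}\,\psi_{j,k}\Big(\frac in\Big),\qquad \tilde\beta_{j,k}=\hat\beta_{j,k}\,\mathbf 1\{|\hat\beta_{j,k}|\ge\lambda_n\},$$ with $\lambda_n=\kappa\sqrt{\log n/n}$, where $\kappa$ is the threshold constant, and $$\hat f(x)=\sum_{j=\underline j}^{J}\sum_{0\le k<2^j}\tilde\beta_{j,k}\,\psi_{j,k}(\hat G_n(x)).$$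
   Formalization: The threshold constant κ is required to be large enough (κ ≥ κ0, with κ0 depending only on M, the domain and the basis, not on s), since for small κ the claim fails (e.g. f_ρ = 0, Y = ±M/2, 2^J near [n/log n]^{1/2}); n ≥ 2 is assumed. *)

(* Defs.v *)
From HB Require Import structures.
From mathcomp Require Import all_boot all_order all_algebra.
From mathcomp Require Import all_classical all_reals all_analysis.

Set Implicit Arguments.
Unset Strict Implicit.
Unset Printing Implicit Defensive.

Import Order.TTheory GRing.Theory Num.Theory.
Import numFieldNormedType.Exports.

Local Open Scope classical_set_scope.
Local Open Scope ring_scope.

Section product_power.
Context d (T : measurableType d) (R : realType).

Definition cons_pair n (z : T * n.-tuple T) : n.+1.-tuple T :=
  [the n.+1.-tuple T of z.1 :: z.2].

Lemma measurable_cons_pair n : measurable_fun setT (@cons_pair n).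
Proof. exact: measurable_cons. Qed.

HB.instance Definition _ n :=
  isMeasurableFun.Build _ _ _ _ (@cons_pair n) (@measurable_cons_pair n).

Variable P : probability T R.

(* The product measure of n copies of P, carried from T * (T * (T * ...)) to
   n-tuples; [iid_law_box] below characterizes it. *)
Fixpoint iid_law n : probability (n.-tuple T) R :=
  match n with
  | 0 => \d_([tuple] : 0.-tuple T)
  | m.+1 => distribution (P \x iid_law m)%E (@cons_pair m)
  end.

Lemma iid_law_box n (A : 'I_n -> set T) : (forall i, measurable (A i)) ->
  iid_law n [set z | forall i, A i (tnth z i)] = (\prod_(i < n) P (A i))%E.
Proof.
elim: n A => [A _|n IHn A mA] /=.
  rewrite big_ord0 (_ : [set _ | _] = setT) ?diracT//.
  by apply/seteqP; split => // z _ /=; case.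
rewrite big_ord_recl /distribution /pushforward.
rewrite (_ : _ @^-1` _ =
    A ord0 `*` [set z | forall i, A (lift ord0 i) (tnth z i)]); last first.
  apply/seteqP; split => [[x z] /= Axz|[x z] /= [Ax Az] i].
    split; first by have := Axz ord0; rewrite tnth0.
    by move=> i; have := Axz (lift ord0 i); rewrite tnthS.
  by have [j ->|->] := unliftP ord0 i; rewrite ?tnthS// tnth0.
have mB : measurable [set z : n.-tuple T | forall i, A (lift ord0 i) (tnth z i)].
  rewrite (_ : [set _ | _] =
      \bigcap_(i in [set: 'I_n]) ((@tnth n T ^~ i) @^-1` A (lift ord0 i))).
    apply: fin_bigcap_measurable => [|i _]; first exact: finite_finset.
    by rewrite -[_ @^-1` _]setTI; exact: measurable_tnth.
  by apply/seteqP; split => [z Az i _|z Az i]; exact: Az.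
rewrite -(IHn (fun i => A (lift ord0 i))) => [|i]; last exact: mA.
exact: (product_measure1E P (iid_law n) (mA ord0) mB).
Qed.

End product_power.

Section wavelets.
Context (R : realType).
Implicit Types (g h : R -> R) (j k : nat) (s : R).

Notation leb := (@lebesgue_measure R).

Definition C1_compact g : Prop :=
  [/\ forall x, derivable g x 1, continuous (derive1 g) &
      exists B : R, forall x, g x != 0 -> `|x| <= B].

(* Generators of a wavelet system on [0, 1] and of its first level: [psi] (resp.
   [phi]) generates the interior functions of a level, while [psiL k] and
   [psiR k] (resp. [phiL k], [phiR k]), k < margin, generate the k-th one from
   the left, resp. right, endpoint.  Only values on [0, 1] of the resulting
   functions are ever used, so boundary generators are taken to be extended to
   the whole line. *)
Record wavelet_system := WaveletSystem {
  coarsest : nat ;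
  margin : nat ;
  phi : R -> R ; phiL : nat -> R -> R ; phiR : nat -> R -> R ;
  psi : R -> R ; psiL : nat -> R -> R ; psiR : nat -> R -> R }.

Definition dilate (K : nat) (mid : R -> R) (lft rgt : nat -> R -> R)
    j k (x : R) : R :=
  2 `^ (j%:R / 2) *
  (if (k < K)%N then lft k (2 ^+ j * x)
   else if (2 ^ j - K <= k)%N then rgt (2 ^ j - k.+1)%N (2 ^+ j * (1 - x))
   else mid (2 ^+ j * x - k%:R)).

(* The functions psi_{j,k}, k < 2 ^ j, of the coarsest level are the scaling
   functions. *)
Definition wav (W : wavelet_system) j k : R -> R :=
  if j == coarsest W then dilate (margin W) (phi W) (phiL W) (phiR W) j k
  else dilate (margin W) (psi W) (psiL W) (psiR W) j k.

Definition wcoef W h j k : R := \int[leb]_(x in `[0, 1]) (h x * wav W j k x).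

Definition wexpansion W h (J : nat) (x : R) : R :=
  \sum_(coarsest W <= j < J) \sum_(0 <= k < 2 ^ j) wcoef W h j k * wav W j k x.

Record is_wavelet_basis (W : wavelet_system) (N : R) : Prop := {
  wb_margin : (2 * margin W <= 2 ^ coarsest W)%N ;
  wb_phi : C1_compact (phi W) ;
  wb_psi : C1_compact (psi W) ;
  wb_boundary : forall k, (k < margin W)%N ->
    [/\ C1_compact (phiL W k), C1_compact (phiR W k),
        C1_compact (psiL W k) & C1_compact (psiR W k)] ;
  wb_two_scale : exists (L : nat) (a b : nat -> R), forall x,
    phi W x = \sum_(0 <= m < L.*2.+1) a m * phi W (2 * x - (m%:R - L%:R)) /\
    psi W x = \sum_(0 <= m < L.*2.+1) b m * phi W (2 * x - (m%:R - L%:R)) ;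
  wb_support : forall j k, (coarsest W <= j)%N -> (k < 2 ^ j)%N ->
    exists c : R, forall x : R, 0 <= x <= 1 -> wav W j k x != 0 ->
      c <= x <= c + N * 2 ^- j ;
  wb_orthonormal : forall j k j' k',
    (coarsest W <= j)%N -> (k < 2 ^ j)%N ->
    (coarsest W <= j')%N -> (k' < 2 ^ j')%N ->
    wcoef W (wav W j k) j' k' = ((j == j') && (k == k'))%:R ;
  wb_complete : forall h, measurable_fun (`[0%R, 1%R]%classic : set R) h ->
    (\int[leb]_(x in `[0%R, 1%R]) ((h x) ^+ 2)%:E < +oo)%E ->
    (\int[leb]_(x in `[0%R, 1%R]) ((h x - wexpansion W h J x) ^+ 2)%:E)%E
      @[J --> \oo] --> 0%E }.

(* Vanishing moments required by the coefficient description of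
   B^s_oo(L_oo([0, 1])). *)
Definition vanishing_moments W s : Prop :=
  forall j k m, (coarsest W < j)%N -> (k < 2 ^ j)%N -> m%:R <= s ->
    wcoef W (fun x => x ^+ m) j k = 0.

Definition besov_norm W s h : \bar R :=
  ereal_sup [set y | exists j k, [/\ (coarsest W <= j)%N, (k < 2 ^ j)%N &
    y = (2 `^ (j%:R * (s + 2^-1)) * `|wcoef W h j k|)%:E]].

End wavelets.

Section regression.
Context (R : realType).

Notation mR := (measurableTypeR R).
Notation obs := (mR * mR)%type.

Implicit Types (rho : probability obs R) (f : R -> R) (n : nat).

HB.instance Definition _ :=
  isMeasurableFun.Build _ _ _ _ (@fst mR mR) measurable_fst.

Definition marginalX rho : probability mR R :=
  distribution rho (fst : {mfun obs >-> mR}).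

(* f is a version of x |-> E_rho[Y | X = x]. *)
Definition is_regression_function rho f : Prop :=
  (marginalX rho).-integrable setT (EFin \o f) /\
  forall A : set mR, measurable A ->
    (\int[marginalX rho]_(x in A) (f x)%:E =
     \int[rho]_(z in A `*` setT) (z.2)%:E)%E.

Definition distr_fun rho (t : R) : R := fine (marginalX rho `]-oo, t]%classic).

(* The value at x = 0, where the set is all of R, plays no role. *)
Definition quantile rho (x : R) : R := inf [set t | x <= distr_fun rho t].

Definition model (X : set R) (M : R) rho : Prop :=
  rho (X `*` `[- (M / 2), M / 2]%classic) = 1%E /\
  forall t, derivable (distr_fun rho) t 1.

(* Whether f \o quantile rho is in the ball does not depend on the version f of
   the regression function, since only wavelet coefficients are involved. *)
Definition Mclass (X : set R) (M : R) (W : wavelet_system R) (s : R) :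
    set (probability obs R) :=
  [set rho | model X M rho /\
    exists2 f, is_regression_function rho f &
      (besov_norm W s (f \o quantile rho) <= M%:E)%E].

Definition ecdf n (z : n.-tuple obs) (x : R) : R :=
  n%:R^-1 * \sum_(i < n) \1_`]-oo, x] (tnth z i).1.

Definition threshold (kappa : R) n : R := kappa * Num.sqrt (ln n%:R / n%:R).

Definition beta_hat (W : wavelet_system R) n (z : n.-tuple obs) (j k : nat) : R :=
  n%:R^-1 * \sum_(i < n) (tnth z i).2 * wav W j k (ecdf z (tnth z i).1).

Definition beta_tilde W (kappa : R) n (z : n.-tuple obs) j k : R :=
  if threshold kappa n <= `|beta_hat W z j k| then beta_hat W z j k else 0.

Definition f_hat W (kappa : R) (J : nat) n (z : n.-tuple obs) (x : R) : R :=
  \sum_(coarsest W <= j < J.+1) \sum_(0 <= k < 2 ^ j)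
    beta_tilde W kappa z j k * wav W j k (ecdf z x).

Definition loss rho (g : R -> R) : \bar R :=
  'N[marginalX rho]_2%:E [EFin \o g]%E.

Definition rate (s : R) n : R := (n%:R / ln n%:R) `^ (- (s / (1 + 2 * s))).

End regression.

(* Main.v *)
Require Import Defs.
From HB Require Import structures.
From mathcomp Require Import all_boot all_order all_algebra.
From mathcomp Require Import all_classical all_reals all_analysis.
From mathcomp Require Import measurable_realfun zify ring lra.

Set Implicit Arguments.
Unset Strict Implicit.
Unset Printing Implicit Defensive.

Import Order.TTheory GRing.Theory Num.Theory.
Import numFieldNormedType.Exports.

Local Open Scope classical_set_scope.
Local Open Scope ring_scope.

(* Everything is done in sup norm. Put q = (ln n / n)^(1/2). The composition of
   f_rho with the quantile function agrees a.e. with the uniform limit h of its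
   wavelet series, whose modulus of continuity at scale q is of order q^sigma for
   every sigma < min(s, 1), and f_rho = h o G a.e. for the law of X.

   Since G is continuous, the X_i are a.s. distinct, so the points Ghat(X_i) are a
   permutation of the grid i/n. Conditionally on the X_i, the centred part of
   beta_hat is a weighted sum of independent bounded variables whose squared weights
   add up to O(n), hence is sub-Gaussian (from e^x <= x + e^(2x^2)).
   The rest is a bias O(2^(-j/2) q^sigma (1 + delta / q)) with
   delta = sup |Ghat - G|, which is controlled at the n quantiles G^-1(l/n).

   With r = max(q, c (2^-J / J)^(1/2) eta), a union bound makes all these
   deviations at most of order r outside an event of probability 6 e^(-n r^2).
   There, if r = q, the empirical coefficients of the levels
   2^j > (n / ln n)^(1/(1+2s)) fall below the threshold and are set to 0, and if
   r > q, the crude bound 2^(J/2) r on the noise is at most a small multiple of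
   eta. *)

(** The exponent sigma also has a lower constraint. The bias is summed over all levels up to [J], up
    to order [ln n] of them, and only [sigma > 2s / (1 + 2s)] makes [q^sigma] smaller than the rate
    [q^(2s / (1 + 2s))] by a power of [q], which absorbs their number. Such a sigma below
    [min(s, 1)] exists exactly when [s > 1/2]. The main obstacle is that the weight of each response
    in [beta_hat] depends on the whole sample of the [X_i], so the terms are not independent. With
    the [X_i] frozen only their ranks matter, and the sum of squared weights is a sum over the grid,
    the same for all samples without ties. No conditional law is built: conditioning means
    integrating against bounded functions of the [X_i], and exponential moments are bounded by
    peeling off one observation at a time. The cutoff level is where [2^(j/2) q] and [2^(-js)] both
    equal the rate. The threshold constant is at least [M + a + 1] because, above the cutoff, [M q]
    bounds the coefficient, [a q] the noise and [q] the bias. *)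

Local Notation mR R := (measurableTypeR R).
Local Notation obs R := (mR R * mR R)%type.

(** * Conditionally sub-Gaussian sums *)

(** The linear term stays outside the exponential because it integrates to 0 for a conditionally
    centred variable, which leaves a bound in [x ^+ 2] alone. For [x <= 1/2],
    [e^x <= 1 / (1 - x) <= 1 + x + 2 x^2]; for larger [x], [x <= 2 x^2]. *)
Lemma expR_le_subgaussian (R : realType) (x : R) :
  expR x <= x + expR (2 * x ^+ 2).
Proof.
have [x1|x1] := leP x 2^-1.
  have x1' : 0 < 1 - x by lra.
  have : expR x <= (1 - x)^-1.
    rewrite -[x in expR x]opprK expRN lef_pV2 ?posrE ?expR_gt0//.
    exact: expR_ge1Dx.
  move=> /le_trans; apply.
  have : (1 - x)^-1 <= x + (1 + 2 * x ^+ 2).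
    rewrite -[leLHS]mul1r ler_pdivrMr//.
    have := mulr_ge0 (sqr_ge0 x) (_ : 0 <= 1 - 2 * x); nra.
  by move=> /le_trans; apply; rewrite lerD2l expR_ge1Dx.
apply: (@le_trans _ _ (expR (2 * x ^+ 2))); last by rewrite lerDr; lra.
by rewrite ler_expR; nra.
Qed.

Section ae_bounded.
Context d (T : measurableType d) (R : realType) (P : probability T R).
Local Open Scope ereal_scope.

Lemma ae_bounded_integrable (f : T -> R) (K : R) : measurable_fun setT f ->
  {ae P, forall z, (`|f z| <= K)%R} -> P.-integrable setT (EFin \o f).
Proof.
move=> mf fK; apply/integrableP; split; first exact/measurable_EFinP.
apply: (@le_lt_trans _ _ (\int[P]_x (`|K|%:E))); last first.
  by rewrite integral_cst//= probability_setT mule1 ltry.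
apply: ae_ge0_le_integral => //.
- by apply: measurableT_comp => //; exact/measurable_EFinP.
- by move: fK; apply: filterS => z /= zK _; rewrite lee_fin (le_trans zK)// ler_norm.
Qed.

Lemma ae_bounded_integral_le (f : T -> R) (K : R) :
  (0 <= K)%R -> measurable_fun setT f -> (forall z, (0 <= f z)%R) ->
  {ae P, forall z, (f z <= K)%R} -> \int[P]_z (f z)%:E <= K%:E.
Proof.
move=> K0 mf f0 fK.
apply: (@le_trans _ _ (\int[P]_x (K%:E))); last first.
  by rewrite integral_cst//= probability_setT mule1.
apply: ae_ge0_le_integral => //.
- by move=> x _; rewrite lee_fin.
- exact/measurable_EFinP.
- by move: fK; apply: filterS => z /= zK _; rewrite lee_fin.
Qed.
End ae_bounded.

Section conditional_mgf.
Context d (T : measurableType d) d' (T' : measurableType d') (R : realType).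
Variables (P : probability T R) (p : T -> T') (V : T -> R) (F : T' -> R) (b : R).
Hypotheses (mp : measurable_fun setT p) (mV : measurable_fun setT V)
  (mF : measurable_fun setT F) (Vb : {ae P, forall z, `|V z| <= b})
  (Fb : {ae P, forall z, `|F (p z)| <= b}).
(* [F \o p] is the conditional expectation of [V] given [p]. *)
Hypothesis VF : forall u : T' -> R, measurable_fun setT u ->
  (exists K : R, forall x, `|u x| <= K) ->
  (\int[P]_z (V z * u (p z))%:E = \int[P]_z (F (p z) * u (p z))%:E)%E.

(** Apply [expR_le_subgaussian] to [w (p z) * (V z - F (p z))]: the linear part, weighted by [v],
    integrates to 0 by [VF] with [u = w v], and [|V - F| <= 2 b] turns the quadratic part into
    [8 b^2 w^2]. The factor [v] is a spectator that carries the contribution of the other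
    observations. *)
Lemma conditional_mgf_one (w v : T' -> R) (K : R) :
  measurable_fun setT w -> measurable_fun setT v ->
  (forall x, `|w x| <= K) -> (forall x, 0 <= v x <= K) ->
  (\int[P]_z (expR (w (p z) * (V z - F (p z))) * v (p z))%:E <=
   \int[P]_z (expR (8 * b ^+ 2 * w (p z) ^+ 2) * v (p z))%:E)%E.
Proof.
move=> mw mv wK vK.
have mFp : measurable_fun setT (F \o p) by exact: measurableT_comp.
have mwp : measurable_fun setT (w \o p) by exact: measurableT_comp.
have mvp : measurable_fun setT (v \o p) by exact: measurableT_comp.
have mX : measurable_fun setT (fun z => w (p z) * (V z - F (p z))).
  by apply: measurable_funM => //; exact: measurable_funB.
have v0 x : 0 <= v x by have /andP[] := vK x.
have vleK x : v x <= K by have /andP[] := vK x.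
have K0 (z : T') : 0 <= K by rewrite (le_trans (normr_ge0 (w z))).
pose A z := V z * (w (p z) * v (p z)).
pose B z := F (p z) * (w (p z) * v (p z)).
pose E2 z := expR (2 * (w (p z) * (V z - F (p z))) ^+ 2) * v (p z).
have mA : measurable_fun setT A.
  by apply: measurable_funM => //; exact: measurable_funM.
have mB : measurable_fun setT B.
  by apply: measurable_funM => //; exact: measurable_funM.
have mE2 : measurable_fun setT E2.
  apply: measurable_funM => //; apply: measurableT_comp => //.
  by apply: measurable_funM => //; exact: measurable_funX.
have wvK z : `|w z * v z| <= K * K.
  by rewrite normrM (ger0_norm (v0 _)) ler_pM.
have iA : P.-integrable setT (EFin \o A).
  apply: (@ae_bounded_integrable _ _ _ _ _ (b * (K * K))) => //.
  by move: Vb; apply: filterS => z zb; rewrite normrM ler_pM.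
have iB : P.-integrable setT (EFin \o B).
  apply: (@ae_bounded_integrable _ _ _ _ _ (b * (K * K))) => //.
  by move: Fb; apply: filterS => z zb; rewrite normrM ler_pM.
have AB : (\int[P]_z (A z)%:E = \int[P]_z (B z)%:E)%E.
  apply: (VF (u := fun x => w x * v x)); first exact: measurable_funM.
  by exists (K * K).
have E2le : {ae P, forall z, E2 z <= expR (8 * b ^+ 2 * w (p z) ^+ 2) * v (p z)}.
  move: Vb Fb; apply: filterS2 => z Vz Fz; rewrite ler_wpM2r// ler_expR.
  have : (V z - F (p z)) ^+ 2 <= 4 * b ^+ 2.
    have -> : 4 * b ^+ 2 = (b + b) ^+ 2 by ring.
    rewrite -real_normK ?num_real// ler_pXn2r ?nnegrE//.
      by rewrite (le_trans (ler_normB _ _))// lerD.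
    by rewrite addr_ge0// (le_trans _ Vz).
  move=> h; rewrite exprMn.
  have -> : 8 * b ^+ 2 * w (p z) ^+ 2 = 2 * (w (p z) ^+ 2 * (4 * b ^+ 2)) by ring.
  by rewrite ler_pM2l// ler_wpM2l// sqr_ge0.
have iE2 : P.-integrable setT (EFin \o E2).
  apply: (@ae_bounded_integrable _ _ _ _ _ (expR (8 * b ^+ 2 * K ^+ 2) * K)) => //.
  move: E2le; apply: filterS => z; rewrite ger0_norm; last first.
    by rewrite mulr_ge0// expR_ge0.
  move=> /le_trans; apply; rewrite ler_pM// ?expR_ge0// ler_expR.
  rewrite ler_wpM2l//; first by apply: mulr_ge0 => //; exact: sqr_ge0.
  by rewrite -real_normK ?num_real// ler_pXn2r ?nnegrE// ?(K0 (p z)).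
have step : (\int[P]_z (expR (w (p z) * (V z - F (p z))) * v (p z))%:E <=
   \int[P]_z (((A z)%:E - (B z)%:E) + (E2 z)%:E))%E.
  apply: ge0_le_integral => //.
  - by move=> z _; rewrite lee_fin mulr_ge0 ?expR_ge0.
  - by apply/measurable_EFinP; apply: measurable_funM => //; exact: measurableT_comp.
  - apply/measurable_EFinP; apply: measurable_funD => //.
    exact: measurable_funB.
  - move=> z _; rewrite -EFinB -EFinD lee_fin /A /B /E2.
    rewrite -mulrBl mulrA [(_ - _) * _]mulrC -mulrDl.
    by rewrite ler_wpM2r// expR_le_subgaussian.
rewrite (le_trans step)//.
rewrite integralD//; last by apply: (integrableB _ iA iB).
rewrite integralB// AB subee ?add0e; last exact: integrable_fin_num.
apply: ae_ge0_le_integral => //.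
- by move=> z _; rewrite lee_fin mulr_ge0 ?expR_ge0.
- exact/measurable_EFinP.
- by move=> z _; rewrite lee_fin mulr_ge0 ?expR_ge0.
- apply/measurable_EFinP; apply: measurable_funM => //; apply: measurableT_comp => //.
  by apply: measurable_funM => //; exact: measurable_funX.
- by move: E2le; apply: filterS => z /= h _; rewrite lee_fin.
Qed.

Definition tmap n (z : n.-tuple T) : n.-tuple T' := [tuple of map p z].

Lemma measurable_tmap n : measurable_fun setT (@tmap n).
Proof.
apply/measurable_fun_tnthP => i.
rewrite (_ : _ \o _ = p \o (@tnth n T ^~ i)); last first.
  by apply/funext => z; rewrite /= tnth_map.
by apply: measurableT_comp => //; exact: measurable_tnth.
Qed.

Lemma tmap_cons n x (z : n.-tuple T) :
  tmap (cons_pair (x, z)) = cons_pair (p x, tmap z).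
Proof. exact: val_inj. Qed.

Lemma iid_integral_cons1 n (g : n.+1.-tuple T -> \bar R) :
  measurable_fun setT g -> (forall z, 0 <= g z)%E ->
  (\int[iid_law P n.+1]_z g z =
   \int[P]_x \int[iid_law P n]_z g (cons_pair (x, z)))%E.
Proof.
move=> mg g0; rewrite [LHS](@ge0_integral_distribution _ _ _ _ _ (P \x iid_law P n)%E)//.
rewrite fubini_tonelli1; [by []| |by move=> z; exact: g0].
by apply: measurableT_comp => //; exact: measurable_cons_pair.
Qed.

Lemma iid_integral_cons2 n (g : n.+1.-tuple T -> \bar R) :
  measurable_fun setT g -> (forall z, 0 <= g z)%E ->
  (\int[iid_law P n.+1]_z g z =
   \int[iid_law P n]_z \int[P]_x g (cons_pair (x, z)))%E.
Proof.
move=> mg g0; rewrite [LHS](@ge0_integral_distribution _ _ _ _ _ (P \x iid_law P n)%E)//.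
rewrite fubini_tonelli2; [by []| |by move=> z; exact: g0].
by apply: measurableT_comp => //; exact: measurable_cons_pair.
Qed.

Lemma iid_integral_le1 n (g h : n.+1.-tuple T -> \bar R) :
  measurable_fun setT g -> (forall z, 0 <= g z)%E ->
  measurable_fun setT h -> (forall z, 0 <= h z)%E ->
  (forall x, \int[iid_law P n]_z g (cons_pair (x, z)) <=
             \int[iid_law P n]_z h (cons_pair (x, z)))%E ->
  (\int[iid_law P n.+1]_z g z <= \int[iid_law P n.+1]_z h z)%E.
Proof.
move=> mg g0 mh h0 gh; rewrite !iid_integral_cons1//.
apply: ge0_le_integral => //.
- by move=> x _; exact: integral_ge0.
- apply: (@measurable_fun_fubini_tonelli_F _ _ _ _ _ (iid_law P n) (g \o @cons_pair _ _ n)); last by move=> z; exact: g0.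
  by apply: measurableT_comp => //; exact: measurable_cons_pair.
- apply: (@measurable_fun_fubini_tonelli_F _ _ _ _ _ (iid_law P n) (h \o @cons_pair _ _ n)); last by move=> z; exact: h0.
  by apply: measurableT_comp => //; exact: measurable_cons_pair.
Qed.

Lemma iid_integral_le2 n (g h : n.+1.-tuple T -> \bar R) :
  measurable_fun setT g -> (forall z, 0 <= g z)%E ->
  measurable_fun setT h -> (forall z, 0 <= h z)%E ->
  (forall z, \int[P]_x g (cons_pair (x, z)) <= \int[P]_x h (cons_pair (x, z)))%E ->
  (\int[iid_law P n.+1]_z g z <= \int[iid_law P n.+1]_z h z)%E.
Proof.
move=> mg g0 mh h0 gh; rewrite !iid_integral_cons2//.
apply: ge0_le_integral => //.
- by move=> x _; exact: integral_ge0.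
- apply: (@measurable_fun_fubini_tonelli_G _ _ _ _ _ P (g \o @cons_pair _ _ n)); last by move=> z; exact: g0.
  by apply: measurableT_comp => //; exact: measurable_cons_pair.
- apply: (@measurable_fun_fubini_tonelli_G _ _ _ _ _ P (h \o @cons_pair _ _ n)); last by move=> z; exact: h0.
  by apply: measurableT_comp => //; exact: measurable_cons_pair.
Qed.

Lemma measurable_noise (m : nat) (i : 'I_m) :
  measurable_fun setT (fun z : m.-tuple T => V (tnth z i) - F (p (tnth z i))).
Proof.
apply: measurable_funB.
  by apply: measurableT_comp => //; exact: measurable_tnth.
apply: measurableT_comp => //; apply: measurableT_comp => //; exact: measurable_tnth.
Qed.

(** Each weight may depend on the images under [p] of all observations, so the integral does not
    factor. By induction, the head is frozen while the noise of the tail is integrated out, then the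
    tail is frozen while the noise of the head is; [v] makes room for the factor that is waiting. *)
Lemma conditional_mgf n (w : 'I_n -> n.-tuple T' -> R) (v : n.-tuple T' -> R) (K : R) :
  (forall i, measurable_fun setT (w i)) -> measurable_fun setT v ->
  (forall i t, `|w i t| <= K) -> (forall t, 0 <= v t <= K) ->
  (\int[iid_law P n]_z (expR (\sum_(i < n) w i (tmap z) *
      (V (tnth z i) - F (p (tnth z i)))) * v (tmap z))%:E <=
   \int[iid_law P n]_z (expR (8 * b ^+ 2 * \sum_(i < n) w i (tmap z) ^+ 2) *
      v (tmap z))%:E)%E.
Proof.
elim: n w v K => [|n IH] w v K mw mv wK vK.
  rewrite le_eqVlt; apply/orP; left; apply/eqP; apply: eq_integral => z _.
  by rewrite !big_ord0 mulr0.
have v0 t : 0 <= v t by have /andP[] := vK t.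
have vleK t : v t <= K by have /andP[] := vK t.
have mtm m := @measurable_tmap m.
have mwt i : measurable_fun setT (w i \o @tmap n.+1) := measurableT_comp (mw i) (mtm _).
have mvt : measurable_fun setT (v \o @tmap n.+1) := measurableT_comp mv (mtm _).
pose D (z : T) := V z - F (p z).
have mD i : measurable_fun setT (fun z : n.+1.-tuple T => D (tnth z i)).
  exact: measurable_noise.
have mcp (x : T') : measurable_fun setT (fun t : n.-tuple T' => cons_pair (x, t)).
  exact: (measurable_fun_pair2 _ (@measurable_cons_pair _ T' n)).
have mcp' (t : n.-tuple T') : measurable_fun setT (fun x : T' => cons_pair (x, t)).
  exact: (measurable_fun_pair1 _ (@measurable_cons_pair _ T' n)).
pose G1 (z : n.+1.-tuple T) :=
  expR (\sum_(i < n.+1) w i (tmap z) * D (tnth z i)) * v (tmap z).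
(* The intermediate stage: the noise of the tail is already replaced by its bound in squared
   weights, that of the head is still there. *)
pose G2 (z : n.+1.-tuple T) :=
  expR (8 * b ^+ 2 * \sum_(i < n) w (lift ord0 i) (tmap z) ^+ 2) *
  (expR (w ord0 (tmap z) * D (tnth z ord0)) * v (tmap z)).
pose G3 (z : n.+1.-tuple T) :=
  expR (8 * b ^+ 2 * \sum_(i < n.+1) w i (tmap z) ^+ 2) * v (tmap z).
have mG1 : measurable_fun setT G1.
  apply: measurable_funM => //; apply: measurableT_comp => //.
  by apply: measurable_sum => i; exact: (measurable_funM (mwt i) (mD i)).
have mG2 : measurable_fun setT G2.
  apply: measurable_funM.
    apply: measurableT_comp => //; apply: measurable_funM => //.
    by apply: measurable_sum => i; exact: (measurable_funX _ (mwt _)).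
  apply: measurable_funM => //; apply: measurableT_comp => //.
  exact: (measurable_funM (mwt _) (mD _)).
have mG3 : measurable_fun setT G3.
  apply: measurable_funM => //; apply: measurableT_comp => //.
  apply: measurable_funM => //.
  by apply: measurable_sum => i; exact: (measurable_funX _ (mwt _)).
have G10 z : 0 <= G1 z by rewrite mulr_ge0 ?expR_ge0.
have G20 z : 0 <= G2 z by rewrite !mulr_ge0 ?expR_ge0.
have G30 z : 0 <= G3 z by rewrite mulr_ge0 ?expR_ge0.
apply: (@le_trans _ _ (\int[iid_law P n.+1]_z (G2 z)%:E)%E).
  apply: iid_integral_le1 => //; [exact/measurable_EFinP|exact/measurable_EFinP|].
  move=> x.
  (* With [x] frozen, [D x] is a constant, so the factor of the head is a function of the images and
     can be moved into [v]. The new bound depends on [x], which is harmless because the conclusion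
     does not mention it. *)
  have := IH (fun i t => w (lift ord0 i) (cons_pair (p x, t)))
    (fun t => expR (w ord0 (cons_pair (p x, t)) * D x) * v (cons_pair (p x, t)))
    (Num.max K (expR (K * `|D x|) * K)).
  have -> : (\int[iid_law P n]_z (G1 (cons_pair (x, z)))%:E = \int[iid_law P n]_z
     (expR (\sum_(i < n) w (lift ord0 i) (cons_pair (p x, tmap z)) *
         (V (tnth z i) - F (p (tnth z i)))) *
     (expR (w ord0 (cons_pair (p x, tmap z)) * D x) * v (cons_pair (p x, tmap z))))%:E)%E.
    apply: eq_integral => z _; congr EFin.
    rewrite /G1 big_ord_recl expRD tmap_cons tnth0 -mulrA mulrCA; congr (expR _ * _).
    by apply: eq_bigr => i _; rewrite tnthS.
  have -> : (\int[iid_law P n]_z (G2 (cons_pair (x, z)))%:E = \int[iid_law P n]_z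
     (expR (8 * b ^+ 2 * \sum_(i < n) w (lift ord0 i) (cons_pair (p x, tmap z)) ^+ 2) *
     (expR (w ord0 (cons_pair (p x, tmap z)) * D x) * v (cons_pair (p x, tmap z))))%:E)%E.
    by apply: eq_integral => z _; congr EFin; rewrite /G2 tmap_cons tnth0.
  apply.
  - by move=> i; exact: measurableT_comp.
  - apply: measurable_funM; last exact: measurableT_comp.
    apply: measurableT_comp => //; apply: measurable_funM => //.
    exact: measurableT_comp.
  - by move=> i t; rewrite le_max wK.
  - move=> t; rewrite mulr_ge0 ?expR_ge0//= le_max; apply/orP; right.
    rewrite ler_pM ?expR_ge0// ler_expR (le_trans (ler_norm _))// normrM.
    by rewrite ler_wpM2r.
apply: iid_integral_le2 => //; [exact/measurable_EFinP|exact/measurable_EFinP|].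
move=> z.
have K0 : 0 <= K by rewrite (le_trans (v0 (cons_pair (p (point : T), tmap z)))).
have := @conditional_mgf_one (fun x => w ord0 (cons_pair (x, tmap z)))
  (fun x => expR (8 * b ^+ 2 * \sum_(i < n) w (lift ord0 i) (cons_pair (x, tmap z)) ^+ 2)
       * v (cons_pair (x, tmap z)))
  (Num.max K (expR (8 * b ^+ 2 * \sum_(i < n) K ^+ 2) * K)).
have -> : (\int[P]_x (G2 (cons_pair (x, z)))%:E = \int[P]_x (expR (w ord0 (cons_pair (p x, tmap z)) * (V x - F (p x))) *
   (expR (8 * b ^+ 2 * \sum_(i < n) w (lift ord0 i) (cons_pair (p x, tmap z)) ^+ 2) *
       v (cons_pair (p x, tmap z))))%:E)%E.
  apply: eq_integral => x _; congr EFin.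
  by rewrite /G2 tmap_cons tnth0 mulrCA.
have -> : (\int[P]_x (G3 (cons_pair (x, z)))%:E = \int[P]_x (expR (8 * b ^+ 2 * w ord0 (cons_pair (p x, tmap z)) ^+ 2) *
   (expR (8 * b ^+ 2 * \sum_(i < n) w (lift ord0 i) (cons_pair (p x, tmap z)) ^+ 2) *
       v (cons_pair (p x, tmap z))))%:E)%E.
  apply: eq_integral => x _; congr EFin.
  by rewrite /G3 tmap_cons big_ord_recl mulrDr expRD -mulrA.
apply.
- exact: measurableT_comp.
- apply: measurable_funM; last exact: measurableT_comp.
  apply: measurableT_comp => //; apply: measurable_funM => //.
  apply: measurable_sum => i; apply: measurable_funX; exact: measurableT_comp.
- by move=> t; rewrite le_max wK.
- move=> t; rewrite mulr_ge0 ?expR_ge0//= le_max; apply/orP; right.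
  rewrite ler_pM ?expR_ge0// ler_expR ler_wpM2l//.
    by apply: mulr_ge0 => //; exact: sqr_ge0.
  apply: ler_sum => i _.
  by rewrite -real_normK ?num_real// ler_pXn2r ?nnegrE.
Qed.

(** Chernoff's bound. The squared weights are controlled only on [B], an event about the
    conditioning variables; taking its indicator as [v] restricts the exponential moment to it. *)
Lemma conditional_tail n (w : 'I_n -> n.-tuple T' -> R) (B : set (n.-tuple T'))
    (K S y : R) :
  (forall i, measurable_fun setT (w i)) -> measurable B ->
  (forall i t, `|w i t| <= K) -> 0 < b -> 0 < S -> 0 <= y ->
  (forall t, B t -> \sum_(i < n) w i t ^+ 2 <= S) ->
  (iid_law P n [set z | B (tmap z) /\
     (y < \sum_(i < n) w i (tmap z) * (V (tnth z i) - F (p (tnth z i))))%R] <=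
   (expR (- (y ^+ 2 / (32 * b ^+ 2 * S))))%:E)%E.
Proof.
move=> mw mB wK b0 S0 y0 wS.
(* The minimiser of [- th y + 8 b^2 th^2 S], with minimum [- y^2 / (32 b^2 S)]. *)
pose th := y / (16 * b ^+ 2 * S).
have th0 : 0 <= th by rewrite divr_ge0// ?mulr_ge0// ?sqr_ge0// ltW.
set E := (X in iid_law P n X).
pose Z (z : n.-tuple T) := \sum_(i < n) w i (tmap z) * (V (tnth z i) - F (p (tnth z i))).
have mtm := @measurable_tmap n.
have mZ : measurable_fun setT Z.
  apply: measurable_sum => i; apply: measurable_funM; last exact: measurable_noise.
  exact: measurableT_comp.
have mE : measurable E.
  rewrite (_ : E = (@tmap n) @^-1` B `&` Z @^-1` `]y, +oo[%classic); last first.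
    by apply/seteqP; split => z /=; rewrite in_itv/= andbT.
  by apply: measurableI; rewrite -[X in measurable X]setTI; [exact: mtm|exact: mZ].
have mv : measurable_fun setT (\1_B : n.-tuple T' -> R) by exact: measurable_indic.
have v01 t : 0 <= (\1_B t : R) <= 1 by rewrite indicE; case: (_ \in _); rewrite ?lexx ?ler01.
have := @conditional_mgf n (fun i t => th * w i t) \1_B (Num.max 1 (th * K)).
move=> /(_ _ mv) H.
have {}H : (\int[iid_law P n]_z (expR (th * Z z) * \1_B (tmap z))%:E <=
  (expR (8 * b ^+ 2 * (th ^+ 2 * S)))%:E)%E.
  rewrite (_ : (\int[_]_z _)%E = (\int[iid_law P n]_z (expR (\sum_(i < n) (th * w i (tmap z)) *
      (V (tnth z i) - F (p (tnth z i)))) * \1_B (tmap z))%:E)%E); last first.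
    apply: eq_integral => z _; rewrite /Z mulr_sumr; congr ((expR _ * _)%:E).
    by apply: eq_bigr => i _; rewrite mulrA.
  apply: (le_trans (H _ _ _)).
  - by move=> i; exact: measurable_funM.
  - move=> i t; rewrite le_max; apply/orP; right.
    by rewrite normrM ger0_norm// ler_wpM2l.
  - by move=> t; have /andP[-> /le_trans ->] := v01 t => //; rewrite le_max lexx.
  apply: ae_bounded_integral_le.
  - exact: expR_ge0.
  - apply: measurable_funM; last exact: measurableT_comp.
    apply: measurableT_comp => //; apply: measurable_funM => //.
    apply: measurable_sum => i; apply: measurable_funX; apply: measurable_funM => //.
    exact: measurableT_comp.
  - by move=> z; rewrite mulr_ge0 ?expR_ge0//; have /andP[] := v01 (tmap z).
  - apply: aeW => z /=; rewrite indicE; case: (boolP (tmap z \in B)) => /=; last by rewrite mulr0 expR_ge0.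
    rewrite inE => Bz; rewrite mulr1 ler_expR ler_wpM2l ?(mulr_ge0 _ (sqr_ge0 _))//.
    rewrite (eq_bigr (fun i => th ^+ 2 * w i (tmap z) ^+ 2)); last first.
      by move=> i _; rewrite exprMn.
    by rewrite -mulr_sumr ler_wpM2l ?sqr_ge0// wS.
rewrite -[iid_law P n E]mul1e -integral_cst//.
have -> : (\int[iid_law P n]_(x in E) cst 1 x = \int[iid_law P n]_(x in E) (1%:E))%E by [].
apply: (@le_trans _ _ (\int[iid_law P n]_(z in E) (expR (- (th * y)) * (expR (th * Z z) * \1_B (tmap z)))%:E)%E).
  apply: ge0_le_integral => //.
  - apply/measurable_EFinP; apply: measurable_funM => //.
    apply: measurable_funM => //; last by apply: measurable_funTS; exact: measurableT_comp.
    apply: measurable_funTS; apply: measurableT_comp => //; exact: measurable_funM.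
  - move=> z [Bz yz]; rewrite lee_fin indicE mem_set// mulr1 -expRD -expR0 ler_expR.
    by rewrite addrC subr_ge0 ler_wpM2l// ltW.
have mint : measurable_fun setT (fun z : n.-tuple T => expR (th * Z z) * \1_B (tmap z)).
  apply: measurable_funM => //; last by exact: measurableT_comp.
  apply: measurableT_comp => //; exact: measurable_funM.
have int0 z : 0 <= expR (th * Z z) * \1_B (tmap z).
  by rewrite mulr_ge0 ?expR_ge0//; have /andP[] := v01 (tmap z).
apply: (@le_trans _ _ (\int[iid_law P n]_z (expR (- (th * y)) * (expR (th * Z z) * \1_B (tmap z)))%:E)%E).
  apply: ge0_subset_integral => //.
  - by apply/measurable_EFinP; exact: measurable_funM.
under eq_integral do rewrite EFinM.
rewrite ge0_integralZl_EFin ?expR_ge0//; last exact/measurable_EFinP.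
apply: (le_trans (lee_wpmul2l _ H)); first by rewrite lee_fin expR_ge0.
rewrite -EFinM lee_fin -expRD ler_expR le_eqVlt; apply/orP; left; apply/eqP.
rewrite /th; field.
by rewrite (gt_eqF b0) (gt_eqF S0).
Qed.

Lemma conditional_tail_abs n (w : 'I_n -> n.-tuple T' -> R) (B : set (n.-tuple T'))
    (K S y : R) :
  (forall i, measurable_fun setT (w i)) -> measurable B ->
  (forall i t, `|w i t| <= K) -> 0 < b -> 0 < S -> 0 <= y ->
  (forall t, B t -> \sum_(i < n) w i t ^+ 2 <= S) ->
  let E := [set z | B (tmap z) /\
     y < `|\sum_(i < n) w i (tmap z) * (V (tnth z i) - F (p (tnth z i)))|] in
  measurable E /\
  (iid_law P n E <= (2 * expR (- (y ^+ 2 / (32 * b ^+ 2 * S))))%:E)%E.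
Proof.
move=> mw mB wK b0 S0 y0 wS E.
pose Z (z : n.-tuple T) := \sum_(i < n) w i (tmap z) * (V (tnth z i) - F (p (tnth z i))).
have mtm := @measurable_tmap n.
have mZ : measurable_fun setT Z.
  apply: measurable_sum => i; apply: measurable_funM; last exact: measurable_noise.
  exact: measurableT_comp.
pose E1 := [set z | B (tmap z) /\ y < Z z].
pose E2 := [set z | B (tmap z) /\ y < - Z z].
have EE : E = E1 `|` E2.
  apply/seteqP; split => z /=.
    by move=> [Bz]; rewrite -[X in `|X|]/(Z z) ltr_normr => /orP[h|h]; [left|right].
  by rewrite /E /= -[X in `|X|]/(Z z) ltr_normr => -[[Bz ->]|[Bz ->]]; rewrite ?orbT.
have mBt : measurable ((@tmap n) @^-1` B) by rewrite -[X in measurable X]setTI; exact: mtm.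
have mE1 : measurable E1.
  rewrite (_ : E1 = (@tmap n) @^-1` B `&` Z @^-1` `]y, +oo[%classic); last first.
    by apply/seteqP; split => z /=; rewrite in_itv/= andbT.
  by apply: measurableI => //; rewrite -[X in measurable X]setTI; exact: mZ.
have mE2 : measurable E2.
  rewrite (_ : E2 = (@tmap n) @^-1` B `&` (\- Z) @^-1` `]y, +oo[%classic); last first.
    by apply/seteqP; split => z /=; rewrite in_itv/= andbT.
  apply: measurableI => //; rewrite -[X in measurable X]setTI.
  exact: (measurable_funN mZ).
have mE : measurable E by rewrite EE; exact: measurableU.
split => //; rewrite EE (le_trans (measureU2 _ _ _))//.
rewrite mulr_natl mulr2n EFinD; apply: leeD.
  exact: (@conditional_tail n w B K S y).
have := @conditional_tail n (fun i t => - w i t) B K S y.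
rewrite (_ : [set z | _] = E2).
  apply=> //.
  - by move=> i; exact: measurableT_comp.
  - by move=> i t; rewrite normrN.
  - by move=> t /wS h; under eq_bigr => i _ do rewrite sqrrN.
rewrite /E2; apply/seteqP; split => z /=.
  by under eq_bigr do rewrite mulNr; rewrite sumrN.
by under [in X in _ -> X]eq_bigr do rewrite mulNr; rewrite sumrN.
Qed.

End conditional_mgf.

(** * Wavelet bounds *)

Section wavelet_bounds.
Context (R : realType).
Implicit Types (g : R -> R) (x y : R).

(** A single constant plays three roles, so that finitely many generators can be given a common one
    by adding up. *)
Definition lipschitz_compact (B : R) g : Prop :=
  [/\ forall x, g x != 0 -> `|x| <= B, forall x, `|g x| <= B &
      forall x y : R, `|g x - g y| <= B * `|x - y|].

Lemma lipschitz_compact_le (B B' : R) g : B <= B' ->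
  lipschitz_compact B g -> lipschitz_compact B' g.
Proof.
move=> BB' [gs gb gl]; split=> [x /gs|x|x y].
- by move/le_trans; apply.
- exact: le_trans (gb x) BB'.
- by rewrite (le_trans (gl x y))// ler_wpM2r.
Qed.

Lemma lipschitz_segment g (a b L : R) : a <= b ->
  (forall x, derivable g x 1) -> (forall x, x \in `[a, b] -> `|derive1 g x| <= L) ->
  `|g b - g a| <= L * (b - a).
Proof.
move=> ab dg gL.
have cg : {within `[a, b], continuous g}.
  apply: continuous_subspaceT => x.
  by apply: differentiable_continuous; exact/derivable1_diffP.
have [|c cab ->] := @MVT_segment R g (derive1 g) a b ab _ cg.
  by move=> x _; rewrite derive1E; exact: derivableP.
by rewrite normrM (ger0_norm (_ : 0 <= b - a)) ?subr_ge0// ler_wpM2r ?subr_ge0// gL.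
Qed.

(** The derivative is bounded on a compact interval by the extreme value theorem, and [g] is
    unchanged by clamping its argument to that interval. As clamping is 1-Lipschitz, the mean value
    theorem inside the interval suffices. *)
Lemma C1_compact_lipschitz g : C1_compact g ->
  exists2 B : R, 0 <= B & lipschitz_compact B g.
Proof.
move=> [dg cg [B0 gB0]].
(* The extra 1 makes [g] vanish at the endpoints too; [g B1 = 0] then bounds [g] through its
   Lipschitz constant. *)
pose B1 : R := `|B0| + 1.
have B10 : 0 <= B1 by rewrite addr_ge0.
have gout x : B1 <= `|x| -> g x = 0.
  move=> Bx; apply/eqP; apply: contraT => /gB0 xB; exfalso.
  by have := le_trans Bx xB; have := ler_norm B0; rewrite /B1; lra.
have NB1 : - B1 <= B1 by lra.
have [|c _ cmax] := @EVT_max R (fun x => `|derive1 g x|) (- B1) B1 NB1.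
  apply: continuous_subspaceT => x.
  by apply: continuous_comp; [exact: cg|exact: norm_continuous].
pose L := `|derive1 g c|.
have L0 : 0 <= L := normr_ge0 _.
pose cl x := Num.max (- B1) (Num.min x B1).
have clin x : cl x \in `[- B1, B1].
  by rewrite in_itv/= /cl le_max lexx/= ge_max NB1/= ge_min lexx orbT.
have gcl x : g (cl x) = g x.
  have [h|h] := leP B1 `|x|.
    rewrite (gout x h) gout// /cl.
    have := h; rewrite ler_normr => /orP[h1|h1].
      by rewrite (min_idPr h1) (max_idPr NB1) ger0_norm.
    have h2 : x <= - B1 by lra.
    rewrite (min_idPl _); last by lra.
    by rewrite (max_idPl h2) normrN ger0_norm.
  congr g; move: h; rewrite ltr_norml /cl => /andP[h1 h2].
  by rewrite (min_idPl (ltW h2)) (max_idPr (ltW h1)).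
have cl_lip x y : x <= y -> 0 <= cl y - cl x <= y - x.
  move=> xy; rewrite /cl.
  case: (leP x B1) => h1; case: (leP y B1) => h2.
  - by case: (leP (- B1) x) => h3; case: (leP (- B1) y) => h4; apply/andP; split; lra.
  - by case: (leP (- B1) x) => h3; rewrite (max_idPr NB1); apply/andP; split; lra.
  - by case: (leP (- B1) y) => h3; rewrite (max_idPr NB1); apply/andP; split; lra.
  - by rewrite subrr lexx subr_ge0.
have glip0 x y : x <= y -> `|g y - g x| <= L * (y - x).
  move=> xy; have /andP[c0 c1] := cl_lip x y xy.
  rewrite -(gcl x) -(gcl y); apply: (@le_trans _ _ (L * (cl y - cl x))).
    apply: lipschitz_segment; [by rewrite -subr_ge0|exact: dg|].
    move=> t tin; apply: cmax.
    have := clin x; have := clin y; move: tin; rewrite !in_itv/=.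
    by move=> /andP[t1 t2] /andP[_ y2] /andP[x1 _]; rewrite (le_trans x1 t1) (le_trans t2 y2).
  by rewrite ler_wpM2l.
have glip x y : `|g x - g y| <= L * `|x - y|.
  have [xy|/ltW xy] := leP x y.
    by rewrite distrC [X in _ * X]distrC (ger0_norm (_ : 0 <= y - x)) ?subr_ge0// glip0.
  by rewrite (ger0_norm (_ : 0 <= x - y)) ?subr_ge0// glip0.
have gbd x : `|g x| <= L * (2 * B1).
  have gB1 : g B1 = 0 by rewrite gout// ger0_norm.
  rewrite -(gcl x) -[g (cl x)]subr0 -gB1 (le_trans (glip _ _))// ler_wpM2l//.
  have := clin x; rewrite in_itv/= => /andP[c1 c2].
  by rewrite ler_norml; apply/andP; split; lra.
exists (B1 + L * (2 * B1) + L).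
  by rewrite !addr_ge0// !mulr_ge0.
have LB : 0 <= L * (2 * B1) by rewrite !mulr_ge0.
split=> [x gx|x|x y].
- have [h|h] := leP B1 `|x|; first by rewrite gout ?eqxx in gx.
  by rewrite (le_trans (ltW h))// -addrA lerDl addr_ge0.
- by rewrite (le_trans (gbd x))//; lra.
- by rewrite (le_trans (glip x y))// ler_wpM2r//; lra.
Qed.

Lemma C1_compact_lipschitz_family (f : nat -> R -> R) (m : nat) :
  (forall k, (k < m)%N -> C1_compact (f k)) ->
  exists2 B : R, 0 <= B & forall k, (k < m)%N -> lipschitz_compact B (f k).
Proof.
elim: m => [|m IH] fm; first by exists 0.
have [B B0 fB] := IH (fun k km => fm k (ltnW km)).
have [B' B'0 fB'] := C1_compact_lipschitz (fm m (ltnSn m)).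
exists (B + B'); first by rewrite addr_ge0.
move=> k; rewrite ltnS leq_eqVlt => /orP[/eqP ->|km].
  by apply: lipschitz_compact_le fB'; rewrite lerDr.
by apply: lipschitz_compact_le (fB k km); rewrite lerDl.
Qed.

(** The induction also carries the bound [max 0 (n - x)]: when [n] itself falls in the window, the
    count so far is at most [n - x <= L]. *)
Lemma card_window (x L : R) (n : nat) : 0 <= L ->
  \sum_(0 <= i < n) (x <= i%:R <= x + L)%R%:R <= L + 1.
Proof.
move=> L0.
suff [] : \sum_(0 <= i < n) (x <= i%:R <= x + L)%R%:R <= L + 1 /\
     \sum_(0 <= i < n) (x <= i%:R <= x + L)%R%:R <= Num.max 0 (n%:R - x) by [].
elim: n => [|n [IH1 IH2]]; first by rewrite big_geq// le_max lexx addr_ge0.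
rewrite big_nat_recr//= -natr1; case: (boolP (_ && _)) => [/andP[h1 h2]|_] /=.
  rewrite (max_idPr _) in IH2; last by rewrite subr_ge0.
  by split; [lra|rewrite le_max; apply/orP; right; lra].
rewrite addr0; split => //; apply: (le_trans IH2).
by rewrite ge_max !le_max lexx/=; apply/orP; right; lra.
Qed.

Lemma dilate_expE (j : nat) : 2 `^ (j%:R / 2) = (Num.sqrt 2 : R) ^+ j.
Proof. by rewrite mulrC powRrM powR_mulrn ?powR_ge0// powR12_sqrt. Qed.

Lemma sqrt2X_sqr (j : nat) : ((Num.sqrt 2 : R) ^+ j) ^+ 2 = 2 ^+ j.
Proof. by rewrite exprAC sqr_sqrtr. Qed.

Section dilate_bounds.
Variables (K : nat) (mid : R -> R) (lft rgt : nat -> R -> R) (B : R).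
Hypotheses (B0 : 0 <= B) (mB : lipschitz_compact B mid)
  (lB : forall k, (k < K)%N -> lipschitz_compact B (lft k))
  (rB : forall k, (k < K)%N -> lipschitz_compact B (rgt k)).

Lemma dilate_bounds j k : (k < 2 ^ j)%N ->
  (forall x, `|dilate K mid lft rgt j k x| <= B * Num.sqrt 2 ^+ j) /\
  (forall x y : R, `|dilate K mid lft rgt j k x - dilate K mid lft rgt j k y| <=
     B * Num.sqrt 2 ^+ j * 2 ^+ j * `|x - y|).
Proof.
move=> kj; rewrite /dilate dilate_expE.
have s0 : 0 <= (Num.sqrt 2 : R) ^+ j by rewrite exprn_ge0// sqrtr_ge0.
have key g (u : R -> R) : lipschitz_compact B g ->
    (forall x y : R, `|u x - u y| = 2 ^+ j * `|x - y|) ->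
  (forall x, `|Num.sqrt 2 ^+ j * g (u x)| <= B * Num.sqrt 2 ^+ j) /\
  (forall x y : R, `|Num.sqrt 2 ^+ j * g (u x) - Num.sqrt 2 ^+ j * g (u y)| <=
     B * Num.sqrt 2 ^+ j * 2 ^+ j * `|x - y|).
  move=> [_ gb gl] uu; split=> [x|x y].
    by rewrite normrM ger0_norm// mulrC ler_wpM2r.
  rewrite -mulrBr normrM ger0_norm// -!mulrA -uu.
  by rewrite [leRHS]mulrCA ler_wpM2l.
have p0 : 0 <= (2 : R) ^+ j by rewrite exprn_ge0.
case: (boolP (k < K)%N) => [kK|kK].
  by apply: key => [|x y]; [exact: lB|rewrite -mulrBr normrM ger0_norm].
case: (boolP (2 ^ j - K <= k)%N) => [kK'|kK'].
  apply: (key _ (fun x => 2 ^+ j * (1 - x))) => [|x y]; first by apply: rB; lia.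
  by rewrite -mulrBr normrM ger0_norm// distrC; congr (_ * `|_|); ring.
apply: (key _ (fun x => 2 ^+ j * x - k%:R)) => // x y.
rewrite (_ : _ - _ - _ = 2 ^+ j * (x - y)); last by ring.
by rewrite normrM ger0_norm.
Qed.

(** A nonzero term has its index among the [K] leftmost, among the [K] rightmost, or within [B] of
    [2^j x]. Each of these windows, of lengths [K], [K] and [2 B], contains at most its length plus
    1 integers. *)
Lemma dilate_count j x :
  \sum_(0 <= k < 2 ^ j) ((dilate K mid lft rgt j k x != 0) : bool)%:R <=
  2 * K%:R + 2 * B + 3.
Proof.
pose w1 k := (0 <= (k%:R : R) <= 0 + K%:R) : bool.
pose w2 k := ((2 ^ j - K)%N%:R <= (k%:R : R) <= (2 ^ j - K)%N%:R + K%:R) : bool.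
pose w3 k := (2 ^+ j * x - B <= (k%:R : R) <= (2 ^+ j * x - B) + 2 * B) : bool.
apply: (@le_trans _ _ (\sum_(0 <= k < 2 ^ j) ((w1 k)%:R + (w2 k)%:R + (w3 k)%:R))).
  rewrite !big_nat; apply: ler_sum => k /andP[_ kj].
  case: (boolP (_ != 0)) => [h|_]; last by rewrite !addr_ge0.
  rewrite /dilate in h.
  have {h} : [|| w1 k, w2 k | w3 k].
    move: h; rewrite mulf_eq0 negb_or => /andP[_].
    case: ifPn => [kK _|kK].
      by apply/or3P; apply: Or31; rewrite /w1 add0r ler0n ler_nat ltnW.
    case: ifPn => [kK' _|kK' h].
      apply/or3P; apply: Or32; rewrite /w2 -natrD !ler_nat kK'/=; lia.
    apply/or3P; apply: Or33; rewrite /w3.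
    case: mB => /(_ _ h) h' _ _; move: h'; rewrite ler_norml => /andP[h1 h2].
    by apply/andP; split; lra.
  by case: (w1 k); case: (w2 k); case: (w3 k) => //= _; rewrite ?addr0 ?add0r ?lerDl ?lerDr ?addr_ge0 ?ler01 ?ler0n // -?addrA ?lerDl ?addr_ge0.
rewrite !big_split/=.
have h1 := @card_window 0 K%:R (2 ^ j) (ler0n _ _).
have h2 := @card_window (2 ^ j - K)%N%:R K%:R (2 ^ j) (ler0n _ _).
have h3 := @card_window (2 ^+ j * x - B) (2 * B) (2 ^ j) (mulr_ge0 (ler0n _ _) B0).
rewrite -/w1 -/w2 -/w3 in h1 h2 h3 *.
apply: (le_trans (lerD (lerD h1 h2) h3)); lra.
Qed.
End dilate_bounds.

Definition wav_bounds (W : wavelet_system R) (B : R) : Prop :=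
  [/\ forall j k x, (k < 2 ^ j)%N -> `|wav W j k x| <= B * Num.sqrt 2 ^+ j,
      forall j k x y, (k < 2 ^ j)%N ->
        `|wav W j k x - wav W j k y| <= B * Num.sqrt 2 ^+ j * 2 ^+ j * `|x - y| &
      forall j x, \sum_(0 <= k < 2 ^ j) ((wav W j k x != 0) : bool)%:R <= B].

Lemma wav_boundsP W N : is_wavelet_basis W N -> exists2 B : R, 1 <= B & wav_bounds W B.
Proof.
case=> _ hphi hpsi hbd _ _ _ _.
have [B1 B10 h1] := C1_compact_lipschitz hphi.
have [B2 B20 h2] := C1_compact_lipschitz hpsi.
have [B3 B30 h3] : exists2 B : R, 0 <= B & forall k, (k < margin W)%N -> lipschitz_compact B (phiL W k).
  by apply: C1_compact_lipschitz_family => k /hbd[].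
have [B4 B40 h4] : exists2 B : R, 0 <= B & forall k, (k < margin W)%N -> lipschitz_compact B (phiR W k).
  by apply: C1_compact_lipschitz_family => k /hbd[].
have [B5 B50 h5] : exists2 B : R, 0 <= B & forall k, (k < margin W)%N -> lipschitz_compact B (psiL W k).
  by apply: C1_compact_lipschitz_family => k /hbd[].
have [B6 B60 h6] : exists2 B : R, 0 <= B & forall k, (k < margin W)%N -> lipschitz_compact B (psiR W k).
  by apply: C1_compact_lipschitz_family => k /hbd[].
pose B := B1 + B2 + B3 + B4 + B5 + B6.
have B0 : 0 <= B by rewrite /B; lra.
pose C := 2 * (margin W)%:R + 2 * B + 3.
have K0 : 0 <= (margin W)%:R :> R by [].
have BC : B <= C by rewrite /C; lra.
have g1 : lipschitz_compact B (phi W) by apply: lipschitz_compact_le h1; rewrite /B; lra.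
have g2 : lipschitz_compact B (psi W) by apply: lipschitz_compact_le h2; rewrite /B; lra.
have g3 k : (k < margin W)%N -> lipschitz_compact B (phiL W k).
  by move=> /h3; apply: lipschitz_compact_le; rewrite /B; lra.
have g4 k : (k < margin W)%N -> lipschitz_compact B (phiR W k).
  by move=> /h4; apply: lipschitz_compact_le; rewrite /B; lra.
have g5 k : (k < margin W)%N -> lipschitz_compact B (psiL W k).
  by move=> /h5; apply: lipschitz_compact_le; rewrite /B; lra.
have g6 k : (k < margin W)%N -> lipschitz_compact B (psiR W k).
  by move=> /h6; apply: lipschitz_compact_le; rewrite /B; lra.
have s0 j : 0 <= (Num.sqrt 2 : R) ^+ j by rewrite exprn_ge0// sqrtr_ge0.
have p0 j : 0 <= (2 : R) ^+ j by rewrite exprn_ge0.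
exists C; first by rewrite /C; lra.
split=> [j k x kj|j k x y kj|j x].
apply: (@le_trans _ _ (B * Num.sqrt 2 ^+ j)); last by rewrite ler_wpM2r.
  by rewrite /wav; case: ifPn => _; [apply: (dilate_bounds B0 g1 g3 g4 kj).1|apply: (dilate_bounds B0 g2 g5 g6 kj).1].
- apply: (@le_trans _ _ (B * Num.sqrt 2 ^+ j * 2 ^+ j * `|x - y|)).
    by rewrite /wav; case: ifPn => _; [apply: (dilate_bounds B0 g1 g3 g4 kj).2|apply: (dilate_bounds B0 g2 g5 g6 kj).2].
  by rewrite ler_wpM2r// ler_wpM2r// ler_wpM2r.
- by rewrite /wav; case: (j == coarsest W); exact: dilate_count.
Qed.

Section wav_sums.
Variables (W : wavelet_system R) (B : R).
Hypotheses (B1 : 1 <= B) (WB : wav_bounds W B).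

Let B0 : 0 <= B := le_trans ler01 B1.

(** By finite overlap at most [B] terms are nonzero at [x]: the sup norm of a level is governed by
    its largest coefficient, however many there are. *)
Lemma wav_sum_le j (c : nat -> R) (m : R) x : (forall k, (k < 2 ^ j)%N -> `|c k| <= m) ->
  `|\sum_(0 <= k < 2 ^ j) c k * wav W j k x| <= B ^+ 2 * m * Num.sqrt 2 ^+ j.
Proof.
move=> cm; case: WB => wb _ wc.
have s0 : 0 <= (Num.sqrt 2 : R) ^+ j by rewrite exprn_ge0// sqrtr_ge0.
have m0 : 0 <= m by rewrite (le_trans _ (cm 0%N _)) ?expn_gt0.
rewrite (le_trans (ler_norm_sum _ _ _))//.
apply: (@le_trans _ _ (\sum_(0 <= k < 2 ^ j) m * (B * Num.sqrt 2 ^+ j) * ((wav W j k x != 0) : bool)%:R)).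
  rewrite !big_nat; apply: ler_sum => k /andP[_ kj].
  case: (eqVneq (wav W j k x) 0) => [->|_] /=; first by rewrite !mulr0 normr0.
  by rewrite mulr1 normrM ler_pM// ?cm// wb.
rewrite -mulr_sumr.
have := ler_wpM2l (_ : 0 <= m * (B * Num.sqrt 2 ^+ j)) (wc j x).
move=> /(_ _)/le_trans; apply; first by rewrite !mulr_ge0.
by rewrite le_eqVlt; apply/orP; left; apply/eqP; ring.
Qed.

(** A term contributes only if its function is nonzero at [x] or at [y], which leaves at most [2 B]
    terms. *)
Lemma wav_sum_lipschitz j (c : nat -> R) (m : R) x y : (forall k, (k < 2 ^ j)%N -> `|c k| <= m) ->
  `|\sum_(0 <= k < 2 ^ j) c k * wav W j k x - \sum_(0 <= k < 2 ^ j) c k * wav W j k y| <=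
  2 * B ^+ 2 * m * Num.sqrt 2 ^+ j * 2 ^+ j * `|x - y|.
Proof.
move=> cm; case: WB => _ wl wc.
have s0 : 0 <= (Num.sqrt 2 : R) ^+ j by rewrite exprn_ge0// sqrtr_ge0.
have p0 : 0 <= (2 : R) ^+ j by rewrite exprn_ge0.
have m0 : 0 <= m by rewrite (le_trans _ (cm 0%N _)) ?expn_gt0.
rewrite -sumrB (le_trans (ler_norm_sum _ _ _))//.
pose A := m * (B * Num.sqrt 2 ^+ j * 2 ^+ j * `|x - y|).
have A0 : 0 <= A by rewrite /A !mulr_ge0.
apply: (@le_trans _ _ (\sum_(0 <= k < 2 ^ j) (A * ((wav W j k x != 0) : bool)%:R + A * ((wav W j k y != 0) : bool)%:R))).
  rewrite !big_nat; apply: ler_sum => k /andP[_ kj].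
  rewrite -mulrBr normrM.
  have [x0|x0] := eqVneq (wav W j k x) 0; have [y0|y0] := eqVneq (wav W j k y) 0 => /=.
  - by rewrite x0 y0 subrr normr0 !mulr0 addr0.
  - by rewrite mulr0 mulr1 add0r ler_pM// ?cm// wl.
  - by rewrite mulr0 mulr1 addr0 ler_pM// ?cm// wl.
  - by rewrite mulr1 -[leLHS]addr0 lerD// ler_pM// ?cm// wl.
rewrite big_split/= -!mulr_sumr.
apply: (le_trans (lerD (ler_wpM2l A0 (wc j x)) (ler_wpM2l A0 (wc j y)))).
by rewrite le_eqVlt; apply/orP; left; apply/eqP; rewrite /A; ring.
Qed.

Lemma wav_continuous j k : (k < 2 ^ j)%N -> continuous (wav W j k).
Proof.
move=> kj; case: WB => _ wl _ x.
pose L := B * Num.sqrt 2 ^+ j * 2 ^+ j + 1.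
have s0 : 0 <= (Num.sqrt 2 : R) ^+ j by rewrite exprn_ge0// sqrtr_ge0.
have p0 : 0 <= (2 : R) ^+ j by rewrite exprn_ge0.
have L0 : 0 < L by rewrite ltr_wpDl// !mulr_ge0.
apply/cvgrPdist_le => e e0; near=> y.
apply: (le_trans (wl j k x y kj)); apply: (@le_trans _ _ (L * `|x - y|)).
  by rewrite ler_wpM2r// lerDl.
rewrite mulrC -ler_pdivlMr//.
near: y; apply: cvgr_dist_le => //; exact: divr_gt0.
Unshelve. all: by end_near. Qed.

Lemma measurable_wav j k : (k < 2 ^ j)%N -> measurable_fun setT (wav W j k).
Proof. by move=> kj; apply: continuous_measurable_fun; exact: wav_continuous. Qed.

End wav_sums.

End wavelet_bounds.

(** * Sums over the grid [i / n], Riemann sums and ranks *)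

Section grid.
Context (R : realType).
Notation leb := (@lebesgue_measure R).

Lemma grid_window (c l : R) (n : nat) : 0 <= l -> (0 < n)%N ->
  \sum_(0 <= m < n) (c <= m.+1%:R / n%:R <= c + l)%R%:R <= n%:R * l + 1.
Proof.
move=> l0 n0; have n0' : 0 < n%:R :> R by rewrite ltr0n.
apply: le_trans (@card_window R (n%:R * c - 1) (n%:R * l) n (mulr_ge0 (ler0n _ _) l0)).
rewrite le_eqVlt; apply/orP; left; apply/eqP; apply: eq_bigr => m _; congr (nat_of_bool _)%:R.
rewrite ler_pdivlMr// ler_pdivrMr// -natr1; apply/andP/andP => -[h1 h2]; split; lra.
Qed.

Section wav_grid.
Variables (W : wavelet_system R) (N B : R).
Hypotheses (WN : is_wavelet_basis W N) (B1 : 1 <= B) (WB : wav_bounds W B).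

Lemma wav_support j k : (coarsest W <= j)%N -> (k < 2 ^ j)%N ->
  exists c : R, forall x : R, 0 <= x <= 1 -> wav W j k x != 0 ->
    c <= x <= c + `|N| / 2 ^+ j.
Proof.
move=> jW kj; have [c hc] := wb_support WN jW kj; exists c => x x01 wx.
have /andP[-> h] := hc x x01 wx; rewrite (le_trans h)// lerD2l ler_wpM2r ?ler_norm//.
Qed.

Lemma grid_point_in (m n : nat) : (m < n)%N -> 0 <= (m.+1%:R / n%:R : R) <= 1.
Proof.
move=> mn; have n0' : 0 < n%:R :> R by rewrite ltr0n (leq_ltn_trans _ mn).
by rewrite divr_ge0//= ler_pdivrMr// mul1r ler_nat.
Qed.

(** A support of length [|N| / 2^j] contains at most [n |N| / 2^j + 1] grid points, and the 1 is
    absorbed by [n / 2^j]. *)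
Lemma wav_grid_count j k n : (coarsest W <= j)%N -> (k < 2 ^ j)%N ->
  (0 < n)%N -> 2 ^+ j <= n%:R :> R ->
  \sum_(0 <= m < n) (wav W j k (m.+1%:R / n%:R) != 0)%:R <=
  (`|N| + 1) * n%:R / 2 ^+ j.
Proof.
move=> jW kj n0 jn; have [c hc] := wav_support jW kj.
have p0 : 0 < (2 : R) ^+ j by rewrite exprn_gt0.
apply: (@le_trans _ _ (n%:R * (`|N| / 2 ^+ j) + 1)).
  apply: le_trans (grid_window c _ n0); last by rewrite divr_ge0// ltW.
  rewrite !big_nat; apply: ler_sum => m /andP[_ mn].
  case: (eqVneq (wav _ _ _ _) 0) => //= wx.
  by rewrite (hc _ (grid_point_in mn) wx).
rewrite mulrDl mulrDl mul1r mulrCA mulrA lerD2l ler_pdivlMr// mul1r//.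
Qed.

Lemma wav_grid_abs j k n : (coarsest W <= j)%N -> (k < 2 ^ j)%N ->
  (0 < n)%N -> 2 ^+ j <= n%:R :> R ->
  \sum_(0 <= m < n) `|wav W j k (m.+1%:R / n%:R)| <=
  B * (`|N| + 1) * n%:R / Num.sqrt 2 ^+ j.
Proof.
move=> jW kj n0 jn; have [wb _ _] := WB.
have s0 : 0 < (Num.sqrt 2 : R) ^+ j by rewrite exprn_gt0// sqrtr_gt0.
have B0 : 0 <= B := le_trans ler01 B1.
apply: (@le_trans _ _ (\sum_(0 <= m < n) B * Num.sqrt 2 ^+ j * (wav W j k (m.+1%:R / n%:R) != 0)%:R)).
  apply: ler_sum => m _; case: (eqVneq (wav _ _ _ _) 0) => [->|_] /=.
    by rewrite normr0 mulr0.
  by rewrite mulr1 wb.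
rewrite -mulr_sumr (le_trans (ler_wpM2l _ (wav_grid_count jW kj n0 jn)))//.
  by rewrite mulr_ge0// ltW.
rewrite -sqrt2X_sqr le_eqVlt; apply/orP; left; apply/eqP; field.
by rewrite gt_eqF.
Qed.

(** The squared height, of order [2^j], cancels the proportion of grid points in the support, of
    order [2^-j]: the noise level is the same at all scales. *)
Lemma wav_grid_sqr j k n : (coarsest W <= j)%N -> (k < 2 ^ j)%N ->
  (0 < n)%N -> 2 ^+ j <= n%:R :> R ->
  \sum_(0 <= m < n) wav W j k (m.+1%:R / n%:R) ^+ 2 <=
  B ^+ 2 * (`|N| + 1) * n%:R.
Proof.
move=> jW kj n0 jn; have [wb _ _] := WB.
have p0 : 0 < (2 : R) ^+ j by rewrite exprn_gt0.
have s0 : 0 < (Num.sqrt 2 : R) ^+ j by rewrite exprn_gt0// sqrtr_gt0.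
have B0 : 0 <= B := le_trans ler01 B1.
apply: (@le_trans _ _ (\sum_(0 <= m < n) B ^+ 2 * 2 ^+ j * (wav W j k (m.+1%:R / n%:R) != 0)%:R)).
  apply: ler_sum => m _; case: (eqVneq (wav _ _ _ _) 0) => [->|_] /=.
    by rewrite expr0n mulr0.
  rewrite mulr1 -sqrt2X_sqr -exprMn -real_normK ?num_real// ler_pXn2r ?nnegrE ?wb//.
  by rewrite mulr_ge0// ltW.
rewrite -mulr_sumr (le_trans (ler_wpM2l _ (wav_grid_count jW kj n0 jn)))//.
  by rewrite mulr_ge0 ?sqr_ge0// ltW.
rewrite le_eqVlt; apply/orP; left; apply/eqP; field.
by rewrite gt_eqF.
Qed.

End wav_grid.

Lemma bounded_integrable_itv (g : R -> R) (Bd a b : R) (ba bb : bool) :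
  measurable_fun setT g -> (forall x, `|g x| <= Bd) ->
  leb.-integrable [set` Interval (BSide ba a) (BSide bb b)] (EFin \o g).
Proof.
move=> mg gB; apply: measurable_bounded_integrable => //.
- by rewrite /= lebesgue_measure_itv/=; case: ifPn => _; rewrite ?ltry// -EFinB ltry.
- exact: measurable_funTS.
- by exists Bd; split; [exact: num_real|move=> y By x _; rewrite /= (le_trans (gB x))// ltW].
Qed.

(** A cell of the grid contributes an error at most [E / n], and nothing when it misses
    [[c, c + l]]; at most [n l + 2] cells do not. *)
Lemma riemann_sum_le (g : R -> R) (n : nat) (c l E Bd : R) :
  (0 < n)%N -> measurable_fun setT g -> (forall x, `|g x| <= Bd) ->
  (forall x, 0 <= x <= 1 -> g x != 0 -> c <= x <= c + l) -> 0 <= l -> 0 <= E ->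
  (forall x y, 0 <= x <= 1 -> 0 <= y <= 1 -> `|x - y| <= n%:R^-1 -> `|g x - g y| <= E) ->
  `|\int[leb]_(x in `[0, 1]) g x - n%:R^-1 * \sum_(0 <= m < n) g (m.+1%:R / n%:R)|
  <= E * (l + 2 / n%:R).
Proof.
move=> n0 mg gB gs l0 E0 gE.
have n0' : 0 < n%:R :> R by rewrite ltr0n.
have nV0 : 0 <= (n%:R)^-1 :> R by rewrite invr_ge0 ltW.
have gint a b ba bb := @bounded_integrable_itv g Bd a b ba bb mg gB.
pose x_ m : R := m%:R / n%:R.
(* Necessary for the cell []m / n, (m + 1) / n]] to meet [[c, c + l]]: there [m < n y <= m + 1],
   which lengthens the window by 1 on the left. *)
pose touch m := (n%:R * c - 1 <= m%:R <= n%:R * c - 1 + (n%:R * l + 1))%R.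
have step m : (m < n)%N ->
    `|\int[leb]_(x in `]x_ m, x_ m.+1]) g x - n%:R^-1 * g (x_ m.+1)| <=
    E * n%:R^-1 * (touch m)%:R.
  move=> mn.
  have xx : x_ m.+1 - x_ m = n%:R^-1 by rewrite /x_ -mulrBl -natr1 addrAC subrr add0r mul1r.
  have lenI : fine (leb `]x_ m, x_ m.+1]%classic) = n%:R^-1.
    rewrite lebesgue_measure_itv/= lte_fin -subr_gt0 xx invr_gt0 n0'/=.
    by rewrite xx.
  have x0 : 0 <= x_ m by rewrite divr_ge0.
  have x1 : x_ m.+1 <= 1 by have /andP[] := grid_point_in mn.
  have -> : n%:R^-1 * g (x_ m.+1) = \int[leb]_(x in `]x_ m, x_ m.+1]) g (x_ m.+1).
    by rewrite Rintegral_cst// lenI mulrC.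
  have cint r : leb.-integrable `]x_ m, x_ m.+1] (EFin \o cst r).
    by apply: (@bounded_integrable_itv _ `|r|).
  rewrite -RintegralB//; last exact: cint.
  apply: (le_trans (le_normr_Rintegral _ _)) => //.
    by apply: (integrableB _ (gint _ _ _ _) (cint _)).
  rewrite -mulrA -lenI (mulrC (fine _)) mulrA -Rintegral_cst//.
  apply: le_Rintegral => //.
  - by apply: (integrable_norm (integrableB _ (gint _ _ _ _) (cint _))).
  - exact: cint.
  move=> x /=; rewrite in_itv/= => /andP[mx xm].
  have x01 : 0 <= x <= 1 by rewrite (le_trans x0 (ltW mx)) (le_trans xm x1).
  have y01 : 0 <= x_ m.+1 <= 1 by exact: grid_point_in.
  have xy : `|x - x_ m.+1| <= n%:R^-1.
    by rewrite distrC ger0_norm ?subr_ge0// -xx lerD2l lerN2 ltW.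
  case: (boolP (touch m)) => [_|ht]; first by rewrite mulr1 gE.
  have mx' : m%:R < x * n%:R by rewrite -ltr_pdivrMr.
  have xm' : x * n%:R <= m%:R + 1 by rewrite natr1 -ler_pdivlMr.
  have xmE : x_ m.+1 * n%:R = m%:R + 1 by rewrite natr1 /x_ mulfVK// gt_eqF.
  suff H y : 0 <= y <= 1 -> m%:R < y * n%:R -> y * n%:R <= m%:R + 1 -> g y = 0.
    by rewrite (H x)// (H (x_ m.+1))// ?subrr ?normr0 ?mulr0// xmE// ltrDl.
  move=> yy h1 h2; apply/eqP; apply: contraNT ht => gy.
  have /andP[h3 h4] := gs y yy gy.
  have h3' := ler_wpM2r (ltW n0') h3; have h4' := ler_wpM2r (ltW n0') h4.
  by rewrite /touch; apply/andP; split; lra.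
have claim m : (m <= n)%N ->
    `|\int[leb]_(x in `]0, x_ m]) g x - n%:R^-1 * \sum_(0 <= i < m) g (x_ i.+1)| <=
    E * n%:R^-1 * \sum_(0 <= i < m) (touch i)%:R.
  elim: m => [_|m IH mn].
    rewrite !big_geq// !mulr0 subr0 /x_ mul0r set_itv_ge ?bnd_simp ?ltxx//.
    by rewrite Rintegral_set0 normr0.
  rewrite !big_nat_recr//= !mulrDr.
  have <- : \int[leb]_(x in `]0, x_ m]) g x + \int[leb]_(x in `]x_ m, x_ m.+1]) g x =
      \int[leb]_(x in `]0, x_ m.+1]) g x.
    rewrite -(@Rintegral_itvB _ g (BRight 0) (BRight (x_ m.+1)) (x_ m)) ?gint//.
    - by rewrite addrC subrK.
    - by rewrite bnd_simp divr_ge0.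
    - by rewrite bnd_simp /x_ ler_wpM2r// ler_nat.
  apply: le_trans (lerD (IH (ltnW mn)) (step m mn)).
  rewrite (_ : forall a b c d : R, a + b - (c + d) = (a - c) + (b - d)) ?ler_normD//.
  by move=> *; ring.
have := claim n (leqnn n); rewrite /x_ divff ?gt_eqF// Rintegral_itv_obnd_cbnd ?gint//.
move=> /le_trans; apply.
have := @card_window R (n%:R * c - 1) (n%:R * l + 1) n.
move=> /(_ (addr_ge0 (mulr_ge0 (ler0n _ _) l0) ler01)) h.
rewrite -mulrA ler_wpM2l// mulrC ler_pdivrMr// (le_trans h)//.
by rewrite mulrDl mulfVK ?gt_eqF//; lra.
Qed.

(** Without ties, distinct observations have distinct ranks, so the rank is a permutation of the
    indices. Sums over the sample become sums over the grid, which no longer depend on the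
    sample. *)
Lemma rank_sum (n : nat) (x : 'I_n -> R) (phi : R -> R) : injective x ->
  \sum_(i < n) phi (n%:R^-1 * \sum_(i' < n) (x i' <= x i)%R%:R) =
  \sum_(0 <= m < n) phi (m.+1%:R / n%:R).
Proof.
move=> xinj; pose cnt i := #|[pred i' : 'I_n | x i' <= x i]|.
have cnt0 i : (0 < cnt i)%N by apply/card_gt0P; exists i; rewrite inE.
have cntn i : ((cnt i).-1 < n)%N.
  by rewrite prednK// (leq_trans (max_card _))// card_ord.
have cnt_lt i i' : x i < x i' -> (cnt i < cnt i')%N.
  move=> ii'; apply: proper_card; apply/properP; split.
    apply/fintype.subsetP => k; rewrite !inE => /le_trans; apply; exact: ltW.
  by exists i'; rewrite !inE// -ltNge.
pose f i := Ordinal (cntn i).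
have finj : injective f.
  move=> i i' /(congr1 val)/= h; apply: xinj; apply/eqP; rewrite eq_le !leNgt.
  have {}h : cnt i = cnt i' by rewrite -[cnt i]prednK// h prednK.
  by apply/andP; split; apply/negP => /cnt_lt; rewrite h ltnn.
rewrite [RHS]big_mkord [RHS](reindex_inj finj); apply: eq_bigr => i _.
have -> : (f i).+1 = cnt i by exact: prednK.
rewrite mulrC; congr (phi (_ / _)).
by rewrite -natr_sum /cnt -sum1_card [in RHS]big_mkcond/=; congr _%:R; apply: eq_bigr => i' _; case: (_ <= _).
Qed.

End grid.

Section indicator_approx.
Context (R : realType).

(** The sum is the integer part of [t]. With [t = n u(x)], it approximates a bounded function [u]
    within [1 / n] by a combination of indicators. *)
Lemma indicator_sum_approx (t : R) (m : nat) : 0 <= t <= m%:R ->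
  t - 1 <= \sum_(0 <= k < m) (k.+1%:R <= t)%R%:R <= t.
Proof.
move=> /andP[t0 tm].
suff [h1 h2] : \sum_(0 <= k < m) (k.+1%:R <= t)%R%:R <= t /\
    (t - 1 <= \sum_(0 <= k < m) (k.+1%:R <= t)%R%:R \/
     \sum_(0 <= k < m) (k.+1%:R <= t)%R%:R = m%:R :> R).
  by rewrite h1 andbT; case: h2 => [//|->]; lra.
(* The two states of the induction: [t] has been passed and the sum is final, or all indicators so
   far are 1. *)
suff : \sum_(0 <= k < m) (k.+1%:R <= t)%R%:R <= t /\
    ((t - 1 <= \sum_(0 <= k < m) (k.+1%:R <= t)%R%:R /\ t <= m%:R) \/
     (\sum_(0 <= k < m) (k.+1%:R <= t)%R%:R = m%:R :> R)).
  by move=> [? [[? _]|?]]; split => //; [left|right].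
elim: m {tm} => [|m [IH1 IH2]]; first by rewrite big_geq//; split => //; right.
rewrite big_nat_recr//=; case: (boolP (m.+1%:R <= t)) => mt /=.
  case: IH2 => [[h1 h2]|h]; last by rewrite h natr1; split => //; right.
  by move: mt; rewrite -natr1; lra.
rewrite addr0; split => //; left; move: mt; rewrite -ltNge => mt; split; last exact: ltW.
by case: IH2 => [[]//|->]; move: mt; rewrite -natr1; lra.
Qed.
End indicator_approx.

(** * Ties have probability zero *)

Section ties.
Context d (T : measurableType d) (R : realType) (P : probability T R).
Variable p : T -> mR R.
Hypothesis mp : measurable_fun setT p.
Hypothesis p0 : forall c, P [set z | p z = c] = 0%E.

Lemma measurable_injective_tuple n :
  measurable [set t : n.-tuple (mR R) | injective (tnth t)].
Proof.
rewrite (_ : mkset _ = \bigcap_(i in [set: 'I_n]) \bigcap_(k in [set k : 'I_n | i != k])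
    [set t : n.-tuple (mR R) | (tnth t i == tnth t k) = false]).
  apply: fin_bigcap_measurable => [|i _]; first exact: finite_finset.
  apply: fin_bigcap_measurable => [|k _]; first exact: finite_finset.
  have := @measurable_fun_eqr _ _ R setT _ _ (@measurable_tnth _ (mR R) n i) (measurable_tnth k).
  by move=> /(_ measurableT [set false] I); rewrite setTI.
apply/seteqP; split => t /=.
  by move=> ti i _ k /= ik; apply/negP => /eqP/ti/eqP; rewrite (negbTE ik).
move=> h i k tik; apply/eqP; apply: contraT => ik.
by have := h i I k ik; rewrite /= tik eqxx.
Qed.

Definition tied n : set (n.-tuple T) := [set z | ~ injective (tnth (tmap p z))].
Arguments tied : clear implicits.

Lemma measurable_tied n : measurable (tied n).
Proof.
rewrite (_ : tied n = ~` ((@tmap _ T _ (mR R) p n) @^-1` [set t | injective (tnth t)])) //.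
apply: measurableC; rewrite -[X in measurable X]setTI.
apply: measurable_tmap => //; exact: measurable_injective_tuple.
Qed.

Lemma tied_cons n x (z : n.-tuple T) :
  ~ tied n z -> tied n.+1 (cons_pair (x, z)) -> exists i, p x = p (tnth z i).
Proof.
move=> /contrapT zi; apply: contra_notP => /forallNP h i k.
rewrite tmap_cons.
have [i' ->|->] := unliftP ord0 i; have [k' ->|->//] := unliftP ord0 k;
  rewrite ?tnthS ?tnth0 ?tnth_map => hh.
- by congr (lift _ _); apply: zi; rewrite !tnth_map.
- by case: (h i').
- by case: (h k').
Qed.

(** If the tail has no tie, a tie appears only when the head takes one of the [n] values of the
    tail, an event of probability zero because the law of [p] has no atom. Integrating over the head
    first thus gives at most the indicator of a tie in the tail. *)
Lemma tied_null n : iid_law P n (tied n) = 0%E.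
Proof.
elim: n => [|n IH].
  by rewrite (_ : tied 0 = set0) ?measure0//; apply/seteqP; split => // z; apply; case.
have mt m : measurable_fun setT (fun z => (\1_(tied m) z)%:E : \bar R).
  by apply/measurable_EFinP; apply: measurable_indic; exact: measurable_tied.
have iE m : iid_law P m (tied m) = (\int[iid_law P m]_z (\1_(tied m) z)%:E)%E.
  by rewrite integral_indic ?setIT//; exact: measurable_tied.
have mcp (z : n.-tuple T) : measurable_fun setT (fun x : T => cons_pair (x, z)).
  exact: (measurable_fun_pair1 _ (@measurable_cons_pair _ T n)).
apply/eqP; rewrite eq_le measure_ge0 andbT iE iid_integral_cons2//.
rewrite -IH iE; apply: ge0_le_integral => //.
- by move=> z _; apply: integral_ge0 => x _; rewrite lee_fin.
- apply: (@measurable_fun_fubini_tonelli_G _ _ _ _ _ P ((fun z => (\1_(tied n.+1) z)%:E) \o @cons_pair _ _ n)); last by move=> z; rewrite lee_fin.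
  exact: (measurableT_comp (mt n.+1) (@measurable_cons_pair _ _ n)).
- exact: mt.
move=> z _; have mz : measurable_fun setT (fun x => \1_(tied n.+1) (cons_pair (x, z)) : R).
  apply/measurable_EFinP; exact: (measurableT_comp (mt n.+1) (mcp z)).
have [zt|zt] := pselect (tied n z).
  rewrite indicE mem_set//; apply: ae_bounded_integral_le => //.
  by apply: aeW => x; rewrite indicE; case: (_ \in _).
rewrite indicE memNset//; apply: ae_bounded_integral_le => //.
exists (\bigcup_(i in [set: 'I_n]) [set x | p x = p (tnth z i)]).
have mpi c : measurable [set x | p x = c].
  rewrite (_ : mkset _ = p @^-1` [set c])//.
  by rewrite -[X in measurable X]setTI; apply: mp => //; exact: measurable_set1.
split.
- by apply: fin_bigcup_measurable => [|i _]; first exact: finite_finset.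
- apply/eqP; rewrite eq_le measure_ge0 andbT.
  have := @content_sub_fsum _ _ _ P 'I_n [set: 'I_n] (\bigcup_(i in [set: 'I_n]) [set x | p x = p (tnth z i)]) (fun i => [set x | p x = p (tnth z i)]).
  move=> /(_ (finite_finset)) h; apply: (le_trans (h _ _ _)) => //.
    by apply: fin_bigcup_measurable => [|i _]; first exact: finite_finset.
  by rewrite fsbig1// => i _; exact: p0.
- move=> x /= hx; apply: contrapT => hh; apply: hx.
  rewrite indicE memNset// => xt.
  by have [i hi] := tied_cons zt xt; apply: hh; exists i.
Qed.

End ties.

(** * Quantiles and regression functions *)

Section quantile.
Context (R : realType) (X : set R) (M : R) (rho : probability (obs R) R).
Hypotheses (cX : compact X) (rhoM : model X M rho).
Let mu := marginalX rho.
Let G := distr_fun rho.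
Let Q := quantile rho.
Notation leb := (@lebesgue_measure R).

Lemma distr_funE t : mu `]-oo, t]%classic = (G t)%:E.
Proof. by rewrite /G /distr_fun fineK// fin_num_measure. Qed.

Lemma distr_fun_ge0 t : 0 <= G t.
Proof. by rewrite -lee_fin -distr_funE. Qed.

Lemma distr_fun_le1 t : G t <= 1.
Proof. by rewrite -lee_fin -distr_funE probability_le1. Qed.

Lemma distr_fun_nondecreasing : {homo G : s t / s <= t}.
Proof.
move=> s t st; rewrite -lee_fin -!distr_funE le_measure// ?inE//.
by move=> x /=; rewrite !in_itv/= => /le_trans; apply.
Qed.

Lemma distr_fun_continuous : continuous G.
Proof.
case: rhoM => _ dG x.
by apply: differentiable_continuous; exact/derivable1_diffP.
Qed.

Lemma measurable_distr_fun : measurable_fun setT G.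
Proof. by apply: continuous_measurable_fun; exact: distr_fun_continuous. Qed.

Lemma model_support : exists2 B : R, 0 <= B & mu `[- B, B]%classic = 1%E.
Proof.
have [B [_ XB]] := compact_bounded cX.
pose C := `|B| + 1.
have C0 : 0 <= C by rewrite addr_ge0.
exists C => //; apply/eqP; rewrite eq_le probability_le1//=.
case: rhoM => <- _; rewrite /mu /marginalX /distribution /pushforward.
have mX : measurable (X : set (mR R)) by exact: compact_measurable.
apply: le_measure; rewrite ?inE.
- exact: measurableX.
- by rewrite -[X in measurable X]setTI; exact: measurable_fst.
move=> z /= [Xz _]; rewrite in_itv/=.
rewrite -ler_norml; apply: XB Xz.
by rewrite (le_lt_trans (ler_norm B))// ltrDl.
Qed.

Lemma distr_fun_low : exists a, forall t, t <= a -> G t = 0.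
Proof.
have [B B0 muB] := model_support; exists (- B - 1) => t tB.
apply/eqP; rewrite eq_le distr_fun_ge0 andbT -lee_fin -distr_funE.
have h : mu (~` `[- B, B]%classic) = 0%E.
  by rewrite probability_setC// [X in (1 - X)%E]muB subee.
rewrite -[X in (_ <= X)%E]h; apply: le_measure; rewrite ?inE//; first exact: measurableC.
by move=> x /=; rewrite !in_itv/= => xt /andP[Bx _]; lra.
Qed.

Lemma distr_fun_high : exists a, G a = 1.
Proof.
have [B B0 muB] := model_support; exists B.
apply/eqP; rewrite eq_le distr_fun_le1/= -lee_fin -distr_funE.
rewrite -muB; apply: le_measure; rewrite ?inE//.
by move=> x /=; rewrite !in_itv/= => /andP[].
Qed.

Lemma distr_fun_near t (e : R) : 0 < e ->
  exists2 d : R, 0 < d & forall s, `|t - s| <= d -> `|G t - G s| < e.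
Proof.
move=> e0; have /cvgrPdist_lt/(_ e e0) := @distr_fun_continuous t.
move=> /nbhs_ballP[d /= d0 hd].
exists (d / 2); first by rewrite divr_gt0.
move=> s ts; apply: hd; rewrite /ball/=.
by rewrite (le_lt_trans ts)// ltr_pdivrMr// ltr_pMr// ltr1n.
Qed.

(** Compactness of [X] makes [G] vanish far to the left and reach the value 1, so that even [u = 1]
    is covered. At [u = 0] the set is the whole line and [inf] is a default value. *)
Lemma quantile_has_inf u : 0 < u <= 1 -> has_inf [set t | u <= G t].
Proof.
move=> /andP[u0 u1]; have [a Ga] := distr_fun_low; have [c Gc] := distr_fun_high.
split; first by exists c; rewrite /= Gc.
by exists a => t /= ut; rewrite leNgt; apply/negP => /ltW/Ga h; rewrite h in ut; lra.
Qed.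

(** Equality is due to the continuity of [G]: a value above [u] would persist slightly to the left
    of [Q u], and a value below [u] slightly to its right, both against the infimum. *)
Lemma distr_fun_quantile u : 0 < u <= 1 -> G (Q u) = u.
Proof.
move=> u01; have hi := quantile_has_inf u01; apply/eqP; rewrite eq_le; apply/andP; split.
  rewrite leNgt; apply/negP => h.
  have h' : 0 < G (Q u) - u by rewrite subr_gt0.
  have [d d0 hd] := distr_fun_near (Q u) h'.
  have /hd h1 : `|Q u - (Q u - d)| <= d by rewrite opprB addrC subrK gtr0_norm.
  have : Q u <= Q u - d.
    apply: ge_inf; first by case: hi.
    change (u <= G (Q u - d)); by move: h1; rewrite ltr_norml => /andP[]; lra.
  by lra.
rewrite leNgt; apply/negP => h.
have h' : 0 < u - G (Q u) by rewrite subr_gt0.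
have [d d0 hd] := distr_fun_near (Q u) h'.
have [t /= ut tQ] := inf_adherent d0 hi.
have Qt : Q u <= t by apply: ge_inf => //; case: hi.
have : `|Q u - t| <= d.
  by rewrite distrC ger0_norm ?subr_ge0// lerBlDl ltW.
by move=> /hd; rewrite ltr_norml => /andP[]; lra.
Qed.

Lemma quantile_le u t : 0 < u <= 1 -> (Q u <= t) = (u <= G t).
Proof.
move=> u01; apply/idP/idP => [h|h].
  by rewrite -[X in X <= _](distr_fun_quantile u01) distr_fun_nondecreasing.
by apply: ge_inf => //; case: (quantile_has_inf u01).
Qed.

Lemma marginal_atomless c : mu [set c] = 0%E.
Proof.
apply/eqP; rewrite eq_le measure_ge0 andbT; apply/lee_addgt0Pr => e e0; rewrite add0e.
have [d d0 hd] := distr_fun_near c e0.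
apply: (@le_trans _ _ (mu `]c - d, c]%classic)).
  apply: le_measure; rewrite ?inE// => x /= ->.
  by rewrite in_itv/= lexx andbT ltrBlDr ltrDl.
have -> : mu `]c - d, c]%classic = (G c - G (c - d))%:E.
  pose A : set (mR R) := `]-oo, c - d]%classic; pose I : set (mR R) := `]c - d, c]%classic.
  have : mu (A `|` I) = (mu A + mu I)%E.
    rewrite measureU; [by []|exact: measurable_itv|exact: measurable_itv|].
    apply/seteqP; split => // x /= []; rewrite /A /I /= !in_itv/=.
    by move=> h /andP[]; rewrite ltNge h.
  rewrite (_ : A `|` I = `]-oo, c]%classic); last first.
    apply/seteqP; split => x; rewrite /A /I /= !in_itv/=.
      move=> [h|/andP[]//]; rewrite (le_trans h)// lerBlDr lerDl ltW//.
    by move=> xc; have [h|h] := leP x (c - d); [left|right; rewrite xc].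
  by rewrite /A !distr_funE EFinB -/I => ->; rewrite addeAC subee ?add0e.
rewrite lee_fin.
have /hd : `|c - (c - d)| <= d by rewrite opprB addrC subrK gtr0_norm.
by move=> h; rewrite (le_trans (ler_norm _))// ltW.
Qed.

(** [Q] is nondecreasing on []0, 1]] and takes default values of [inf] elsewhere. Extended by
    constants on both sides, it becomes a nondecreasing, hence measurable, function on the line. *)
Lemma quantile_measurable : exists2 Qc : R -> R,
  measurable_fun setT Qc & forall u, 0 < u <= 1 -> Qc u = Q u.
Proof.
have [a Ga] := distr_fun_low.
have Qa u : 0 < u <= 1 -> a <= Q u.
  move=> u01; rewrite leNgt; apply/negP => /ltW/Ga; rewrite distr_fun_quantile//.
  by move=> u0; rewrite u0 ltxx in u01.
exists (fun u => if u <= 0 then a else if u <= 1 then Q u else Q 1).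
  apply: nondecreasing_measurable => // u v uv /=.
  have h1 : 0 < (1 : R) <= 1 by rewrite ltr01 lexx.
  case: (leP u 0) => u0; case: (leP v 0) => v0 //; last 2 first.
  - by have := le_trans uv v0; rewrite leNgt u0.
  - case: (leP u 1) => u1; case: (leP v 1) => v1 //.
    + rewrite quantile_le ?u0 ?u1// distr_fun_quantile// ?uv// v0 v1//.
    + by rewrite quantile_le ?u0 ?u1// distr_fun_quantile.
    + by have := le_trans uv v1; rewrite leNgt u1.
  - by case: (leP v 1) => v1; apply: Qa => //; rewrite v0.
by move=> u /andP[u0 ->]; rewrite leNgt u0.
Qed.

(** Inverse transform sampling. The two measures are compared on the rays []x, +oo[], which generate
    the Borel sets and are stable under intersection: by [quantile_le], [x < Q u] means [G x < u], a
    set of Lebesgue measure [1 - G x] in []0, 1]]. *)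
Lemma quantile_pushforward (Qc : R -> R) (A : set (mR R)) :
  measurable_fun setT Qc -> (forall u, 0 < u <= 1 -> Qc u = Q u) -> measurable A ->
  mu A = leb (`]0, 1]%classic `&` Qc @^-1` A).
Proof.
move=> mQc QcE mA.
pose Qm : {mfun (mR R) >-> (mR R)} :=
  HB.pack (Qc : mR R -> mR R) (isMeasurableFun.Build _ _ (mR R) (mR R) (Qc : mR R -> mR R) mQc).
have mD : measurable (`]0, 1]%classic : set (mR R)) by exact: measurable_itv.
pose nu := pushforward (mrestr leb mD) Qm.
have -> : leb (`]0, 1]%classic `&` Qc @^-1` A) = nu A.
  by rewrite /nu /pushforward /mrestr setIC.
refine (@measure_unique _ R (mR R) (@RGenOInfty.G R) (fun k : nat => `](- k%:R)%R, +oo[%classic) _ _ _ _ mu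
  (pushforward (mrestr leb mD) Qm) _ _ A mA).
- exact: RGenOInfty.measurableE.
- move=> _ _ [x ->] [y ->]; exists (Num.max x y).
  by apply/seteqP; split => z /=; rewrite !in_itv/= !andbT gt_max => /andP.
- by move=> i; exists (- i%:R).
- apply/seteqP; split => // x _; exists (Num.truncn `|x|).+1 => //=.
  rewrite in_itv/= andbT ltrNl (le_lt_trans (ler_norm _))// normrN.
  exact: truncnS_gt.
- move=> _ [x ->].
  have muE : mu `]x, +oo[%classic = (1 - G x)%:E.
    rewrite (_ : `]x, +oo[%classic = ~` `]-oo, x]%classic); last by rewrite setCitvl.
    by rewrite probability_setC// distr_funE.
  apply: (eq_trans muE).
  have lebE : leb `]G x, 1]%classic = (1 - G x)%:E.
    rewrite lebesgue_measure_itv/= lte_fin; case: ltP => // h.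
    suff -> : G x = 1 by rewrite subrr.
    by apply/eqP; rewrite eq_le distr_fun_le1.
  rewrite -lebE; change (leb `]G x, 1]%classic = leb (Qc @^-1` `]x, +oo[%classic `&` `]0, 1]%classic)).
  congr (leb _); apply/seteqP; split => u /=; rewrite !in_itv/= andbT.
    move=> /andP[Gu u1]; have u01 : 0 < u <= 1 by rewrite (le_lt_trans (distr_fun_ge0 x)).
    by rewrite QcE// ltNge quantile_le// -ltNge.
  by move=> [h1 u01]; move: h1; rewrite QcE// ltNge quantile_le// -ltNge => ->; case/andP: u01.
- by move=> k; change (mu `](- k%:R)%R, +oo[%classic < +oo)%E; rewrite -ge0_fin_numE// fin_num_measure.
Unshelve. all: exact: mQc.
Qed.

End quantile.

(** * The regression function as a conditional expectation *)

Section regression.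
Context (R : realType) (X : set R) (M : R) (rho : probability (obs R) R).
Hypotheses (cX : compact X) (M0 : 0 < M) (rhoM : model X M rho).
Let mu := marginalX rho.
Let b := M / 2.
Let fstx : obs R -> mR R := fst.
(** The clipped response agrees with [z.2] almost everywhere and is bounded everywhere, which makes
    it integrable against any bounded function. *)
Local Notation yc := (fun z : obs R => Num.max (- b) (Num.min z.2 b)).

Let b0 : 0 < b. Proof. by rewrite divr_gt0. Qed.

Lemma response_bounded : {ae rho, forall z : obs R, `|z.2| <= b}.
Proof.
case: rhoM => rho1 _.
have mX : measurable (X : set (mR R)) by exact: compact_measurable.
have mXM : measurable (X `*` `[- (M / 2), M / 2]%classic : set (obs R)) by exact: measurableX.
exists (~` (X `*` `[- (M / 2), M / 2]%classic)); split.
- exact: measurableC.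
- by rewrite probability_setC// rho1 subee.
- move=> z /= hz [_ /=]; rewrite in_itv/= => h; apply: hz.
  by rewrite ler_norml.
Qed.

Lemma marginal_ae (S : R -> Prop) : {ae mu, forall x : mR R, S x} -> {ae rho, forall z : obs R, S z.1}.
Proof.
move=> [N [mN N0 SN]]; exists (fstx @^-1` N); split.
- by rewrite -[X in measurable X]setTI; exact: measurable_fst.
- exact: N0.
- by move=> z /= hz; exact: SN.
Qed.

Let mfst : measurable_fun setT fstx. Proof. exact: measurable_fst. Qed.

Let myc : measurable_fun setT (yc : obs R -> R).
Proof.
apply: measurable_maxr => //; apply: measurable_minr => //; exact: measurable_snd.
Qed.

Let ycb z : `|yc z| <= b.
Proof.
rewrite ler_norml le_max lexx/= ge_max ge_min lexx orbT andbT.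
by rewrite (le_trans _ (ltW b0))// oppr_le0 ltW.
Qed.

Let yc_ae : {ae rho, forall z : obs R, z.2 = yc z}.
Proof.
move: response_bounded; apply: filterS => z; rewrite ler_norml => /andP[h1 h2].
by rewrite (min_idPl h2) (max_idPr h1).
Qed.

Let yc_int A : measurable A -> rho.-integrable A (EFin \o (yc : obs R -> R)).
Proof.
move=> mA; apply: (@integrableS _ _ _ _ setT) => //.
by apply: (@ae_bounded_integrable _ _ _ _ _ b) => //; exact: aeW.
Qed.

Section version.
Variable f : R -> R.
Hypothesis hf : is_regression_function rho f.

Let fint A : measurable A -> mu.-integrable A (EFin \o f).
Proof. by move=> mA; apply: (integrableS measurableT mA _ hf.1). Qed.

Lemma measurable_regression : measurable_fun setT (f : mR R -> R).
Proof. by apply/measurable_EFinP; exact: (measurable_int _ hf.1). Qed.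

Lemma regression_Rintegral (A : set (mR R)) : measurable A ->
  \int[mu]_(x in A) f x = \int[rho]_(z in A `*` setT) yc z.
Proof.
move=> mA; rewrite /Rintegral hf.2//; congr fine.
have mAT : measurable (A `*` setT : set (obs R)) by exact: measurableX.
apply: ae_eq_integral => //.
- by apply/measurable_EFinP; apply: measurable_funTS; exact: measurable_snd.
- by apply/measurable_EFinP; exact: measurable_funTS.
- by move: yc_ae; apply: filterS => z h _; rewrite /= -h.
Qed.

Let marginalE (A : set (mR R)) : rho (A `*` setT) = mu A.
Proof.
rewrite /mu /marginalX /distribution /pushforward; congr (rho _).
by apply/seteqP; split => z //= [].
Qed.

(** On the set where [sg f > b], the integral of [sg f - b] is nonnegative, and at most 0 because
    the integral of [f] equals that of a response bounded by [b]. It vanishes, so the set is null.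
    The signs 1 and -1 give the two sides. *)
Lemma regression_side (sg : R) : `|sg| = 1 -> {ae mu, forall x : mR R, sg * f x <= b}.
Proof.
move=> sg1; pose A : set (mR R) := [set x | b < sg * f x].
have mf := measurable_regression.
have msf : measurable_fun setT (fun x : mR R => sg * f x) by exact: measurable_funM.
have mA : measurable A.
  rewrite (_ : A = (fun x : mR R => sg * f x) @^-1` `]b, +oo[%classic).
    by rewrite -[X in measurable X]setTI; apply: msf => //; exact: measurable_itv.
  by apply/seteqP; split => x /=; rewrite in_itv/= andbT.
have mAT : measurable (A `*` setT : set (obs R)) by exact: measurableX.
have sfint : mu.-integrable A (EFin \o (fun x => sg * f x)).
  by have := integrableZl mA sg (fint mA).
have bint : mu.-integrable A (EFin \o cst b).
  apply: (@integrableS _ _ _ _ setT) => //.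
  by apply: (@ae_bounded_integrable _ _ _ _ _ `|b|) => //; exact: aeW.
have bint' : rho.-integrable (A `*` setT) (EFin \o cst b).
  apply: (@integrableS _ _ _ _ setT) => //.
  by apply: (@ae_bounded_integrable _ _ _ _ _ `|b|) => //; exact: aeW.
have h0 : \int[mu]_(x in A) (sg * f x - b) = 0.
  apply/eqP; rewrite eq_le; apply/andP; split; last first.
    by apply: Rintegral_ge0 => x; rewrite /A /= subr_ge0 => /ltW.
  rewrite RintegralB// RintegralZl//; last exact: fint.
  have -> : \int[mu]_(_ in A) b = \int[rho]_(_ in A `*` setT) b.
    by rewrite !Rintegral_cst//; congr (_ * fine _); exact: (esym (marginalE A)).
  rewrite regression_Rintegral//.
  rewrite subr_le0 -RintegralZl//; last exact: yc_int.
  apply: le_Rintegral => //.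
  - by have := integrableZl mAT sg (yc_int mAT).
  - move=> z _; rewrite (le_trans (ler_norm _))// normrM sg1 mul1r.
    exact: ycb.
have sint : mu.-integrable A (EFin \o (fun x => sg * f x - b)).
  by have := integrableB mA sfint bint.
have : (\int[mu]_(x in A) `|(sg * f x - b)%:E| = 0)%E.
  transitivity (\int[mu]_(x in A) (sg * f x - b)%:E)%E.
    apply: eq_integral; move=> x; rewrite inE => /ltW h; rewrite gee0_abs// lee_fin subr_ge0//.
  by rewrite -[LHS]fineK ?integrable_fin_num// [X in X%:E]h0.
move=> /(ae_eq_integral_abs mu mA)-/(_ _)/= h.
have {}h := h (measurable_int _ sint).
move: h; apply: filterS => x /= h.
rewrite leNgt; apply/negP => Ax; have := h Ax => -[] /eqP.
by rewrite subr_eq0 => /eqP e; move: Ax; rewrite e ltxx.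
Qed.

Lemma regression_bounded : {ae mu, forall x : mR R, `|f x| <= b}.
Proof.
have h1 : `|1 : R| = 1 by rewrite normr1.
have h2 : `|-1 : R| = 1 by rewrite normrN normr1.
move: (regression_side h1) (regression_side h2).
apply: filterS2 => x; rewrite mul1r mulN1r => a c; rewrite ler_norml a andbT; lra.
Qed.

Local Notation D := (fun z : obs R => yc z - f z.1).

Let mD : measurable_fun setT (D : obs R -> R).
Proof.
apply: measurable_funB => //.
by apply: (measurableT_comp measurable_regression); exact: measurable_fst.
Qed.

Let Db : {ae rho, forall z : obs R, `|D z| <= 2 * b}.
Proof.
move: (marginal_ae regression_bounded); apply: filterS => z h.
by rewrite (le_trans (ler_normB _ _))// mulr_natl mulr2n lerD.
Qed.

Let Duint (u : mR R -> R) (K : R) : measurable_fun setT u -> (forall x, `|u x| <= K) ->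
  rho.-integrable setT (EFin \o (fun z : obs R => D z * u z.1)).
Proof.
move=> mu' uK; apply: (@ae_bounded_integrable _ _ _ _ _ (2 * b * K)).
  by apply: measurable_funM => //; apply: measurableT_comp.
by move: Db; apply: filterS => z h; rewrite normrM ler_pM.
Qed.

Let D_indic (A : set (mR R)) : measurable A -> \int[rho]_z (D z * \1_A z.1) = 0.
Proof.
move=> mA.
have mAT : measurable (A `*` setT : set (obs R)) by exact: measurableX.
have -> : \int[rho]_z (D z * \1_A z.1) = \int[rho]_(z in A `*` setT) D z.
  rewrite [RHS]Rintegral_mkcond; apply: eq_Rintegral => z _.
  rewrite patchE indicE; case: (boolP (z.1 \in A)) => h.
    by rewrite mulr1 mem_set//; split => //; move: h; rewrite inE.
  rewrite mulr0 memNset// => -[Az _]; by move: h; rewrite mem_set.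
have fi : rho.-integrable (A `*` setT) (EFin \o (fun z : obs R => f z.1)).
  apply: (@integrableS _ _ _ _ setT) => //.
  apply: (@ae_bounded_integrable _ _ _ _ _ b).
    by apply: (measurableT_comp measurable_regression); exact: measurable_fst.
  exact: marginal_ae regression_bounded.
rewrite RintegralB//; last exact: yc_int.
rewrite -regression_Rintegral//; apply/eqP; rewrite subr_eq0; apply/eqP.
rewrite /Rintegral; congr fine.
rewrite /mu /marginalX integral_pushforward//.
- rewrite (_ : fst @^-1` A = A `*` setT)//.
  by apply/seteqP; split => z //= [].
- by apply/measurable_EFinP; exact: measurable_regression.
- rewrite (_ : fst @^-1` A = A `*` setT)//.
  by apply/seteqP; split => z //= [].
Qed.

(** The residual [D] is orthogonal to indicators, hence to [n^-1 S m], a combination of them within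
    [1 / n] of [u]. As [|D| <= 2 b], the integral is at most [2 b / n] in absolute value; [n] is
    chosen so large that a nonzero value is contradicted. *)
Let D_nonneg (u : mR R -> R) (K : R) : measurable_fun setT u ->
  (forall x, 0 <= u x <= K) -> \int[rho]_z (D z * u z.1) = 0.
Proof.
move=> mu' uK.
have ub x : `|u x| <= K by have /andP[u0 uk] := uK x; rewrite ger0_norm.
apply/eqP; rewrite -normr_eq0 -[_ == 0]negbK; apply/negP => I0.
set I := \int[rho]_z _ in I0; have Ip : 0 < `|I| by rewrite lt_neqAle eq_sym I0/=.
pose n := (Num.truncn (2 * b / `|I|)).+1.
have n0 : 0 < n%:R :> R by rewrite ltr0n.
have nI : 2 * b / n%:R < `|I|.
  by rewrite ltr_pdivrMr// [X in _ < X]mulrC -ltr_pdivrMr// /n truncnS_gt.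
pose m := (Num.truncn (n%:R * K)).+1.
have nu x : 0 <= n%:R * u x <= m%:R.
  have /andP[u0 uk] := uK x; rewrite mulr_ge0//= (le_trans (ler_wpM2l (ltW n0) uk))//.
  by rewrite ltW// /m truncnS_gt.
pose A k : set (mR R) := [set x | k.+1%:R <= n%:R * u x].
have mA k : measurable (A k).
  rewrite (_ : A k = (fun x => n%:R * u x) @^-1` `[k.+1%:R, +oo[%classic).
    rewrite -[X in measurable X]setTI.
    apply: (measurable_funM (measurable_cst _) mu') => //; exact: measurable_itv.
  by apply/seteqP; split => x /=; rewrite in_itv/= andbT.
pose S k x : R := \sum_(0 <= i < k) \1_(A i) x.
have mS k : measurable_fun setT (S k : mR R -> R).
  by apply: measurable_sum => i; exact: measurable_indic.
have Sb k x : `|S k x| <= k%:R.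
  rewrite (le_trans (ler_norm_sum _ _ _))// -[X in X%:R](subn0 k) -sumr_const_nat.
  by apply: ler_sum => i _; rewrite indicE; case: (_ \in _); rewrite ?normr1 ?normr0.
have SE x : S m x = \sum_(0 <= k < m) (k.+1%:R <= n%:R * u x)%R%:R.
  apply: eq_bigr => i _; rewrite indicE; congr (nat_of_bool _)%:R.
  by apply/idP/idP; rewrite inE.
have S0 k : \int[rho]_z (D z * S k z.1) = 0.
  elim: k => [|k IH].
    transitivity (\int[rho]_z (cst 0 z : R)).
      by apply: eq_Rintegral => z _; rewrite /S big_geq// mulr0.
    by rewrite Rintegral_cst// mul0r.
  transitivity (\int[rho]_z (D z * S k z.1 + D z * \1_(A k) z.1)).
    by apply: eq_Rintegral => z _; rewrite /S big_nat_recr//= mulrDr.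
  rewrite RintegralD//.
  - by rewrite IH D_indic// addr0.
  - exact: (Duint (mS k) (Sb k)).
  - apply: (@Duint _ 1); first exact: measurable_indic.
    by move=> x; rewrite indicE; case: (_ \in _); rewrite ?normr1 ?normr0.
have mv : measurable_fun setT (fun x : mR R => n%:R^-1 * S m x) by exact: measurable_funM.
have mw : measurable_fun setT (fun x : mR R => u x - n%:R^-1 * S m x) by exact: measurable_funB.
have wb x : `|u x - n%:R^-1 * S m x| <= n%:R^-1.
  have /andP[h1 h2] := indicator_sum_approx (nu x).
  rewrite -(ler_pM2l n0) -[X in X * _](gtr0_norm n0) -normrM mulrBr !mulVKf ?gt_eqF//.
  by rewrite divff ?gt_eqF// SE ler_norml; apply/andP; split; lra.
have SI : I = \int[rho]_z (D z * (u z.1 - n%:R^-1 * S m z.1)).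
  transitivity (\int[rho]_z (D z * u z.1 - n%:R^-1 * (D z * S m z.1))); last first.
    by apply: eq_Rintegral => z _; ring.
  rewrite -/I.
  rewrite RintegralB//.
  - rewrite RintegralZl ?S0 ?mulr0 ?subr0//; exact: (Duint (mS m) (Sb m)).
  - exact: (Duint mu' ub).
  - by have := integrableZl measurableT n%:R^-1 (Duint (mS m) (Sb m)).
have : `|I| <= 2 * b / n%:R.
  rewrite SI (le_trans (le_normr_Rintegral _ _))//; first exact: (Duint mw wb).
  rewrite -lee_fin /Rintegral fineK.
    apply: ae_bounded_integral_le => //.
    - by rewrite divr_ge0 ?mulr_ge0// ltW.
    - apply: measurableT_comp => //; apply: measurable_funM => //.
      by apply: (measurableT_comp mw); exact: measurable_fst.
    - by move: Db; apply: filterS => z h; rewrite normrM ler_pM.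
  by apply: integrable_fin_num => //; exact: (integrable_norm (Duint mw wb)).
by rewrite leNgt nI.
Qed.

(** The defining property concerns indicators only. [D_nonneg] extends it to [u + K], which is
    nonnegative and bounded, and to the constant 1, and [u] is a combination of the two. *)
Lemma regression_conditional (u : mR R -> R) : measurable_fun setT u ->
  (exists K : R, forall x, `|u x| <= K) ->
  (\int[rho]_z (z.2 * u z.1)%:E = \int[rho]_z (f z.1 * u z.1)%:E)%E.
Proof.
move=> mu' [K uK].
have mu1 : measurable_fun setT (fun z : obs R => u z.1) by exact: measurableT_comp.
have mf1 : measurable_fun setT (fun z : obs R => f z.1).
  by apply: (measurableT_comp measurable_regression); exact: measurable_fst.
have fi : rho.-integrable setT (EFin \o (fun z : obs R => f z.1 * u z.1)).
  apply: (@ae_bounded_integrable _ _ _ _ _ (b * K)); first exact: measurable_funM.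
  by move: (marginal_ae regression_bounded); apply: filterS => z h; rewrite normrM ler_pM.
have yi : rho.-integrable setT (EFin \o (fun z : obs R => yc z * u z.1)).
  apply: (@ae_bounded_integrable _ _ _ _ _ (b * K)); first exact: measurable_funM.
  by apply: aeW => z; rewrite normrM ler_pM.
have -> : (\int[rho]_z (z.2 * u z.1)%:E = \int[rho]_z (yc z * u z.1)%:E)%E.
  apply: ae_eq_integral => //.
  - by apply/measurable_EFinP; apply: measurable_funM.
  - by apply/measurable_EFinP; apply: measurable_funM.
  - by move: yc_ae; apply: filterS => z h _; rewrite /= -h.
rewrite -[LHS]fineK ?integrable_fin_num// -[RHS]fineK ?integrable_fin_num//; congr EFin.
apply/eqP; rewrite -subr_eq0; apply/eqP.
change (\int[rho]_z (yc z * u z.1) - \int[rho]_z (f z.1 * u z.1) = 0).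
have mc1 : measurable_fun setT (cst 1 : mR R -> R) by [].
have muK : measurable_fun setT (fun x : mR R => u x + K) by exact: measurable_funD.
have K0 x : - K <= u x <= K by rewrite -ler_norml.
have uK2 x : 0 <= u x + K <= K + K by have /andP[h1 h2] := K0 x; apply/andP; split; lra.
have uK2' x : `|u x + K| <= K + K by have /andP[h h'] := uK2 x; rewrite ger0_norm.
have c1b (x : mR R) : `|cst 1 x : R| <= 1 by rewrite normr1.
rewrite -RintegralB//.
transitivity (\int[rho]_z (D z * (u z.1 + K) - K * (D z * cst 1 z.1))).
  by apply: eq_Rintegral => z _ /=; ring.
rewrite RintegralB//.
- rewrite RintegralZl//; last exact: (Duint mc1 c1b).
  rewrite (D_nonneg muK uK2) (D_nonneg mc1 (K := 1)) ?mulr0 ?subr0//.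
  by move=> x; rewrite ler01 lexx.
- exact: (Duint muK uK2').
- by have := integrableZl measurableT K (Duint mc1 c1b).
Qed.

End version.

Lemma regression_ae_unique f g : is_regression_function rho f ->
  is_regression_function rho g -> {ae mu, forall x : mR R, f x = g x}.
Proof.
move=> hf hg.
have : ae_eq mu setT (EFin \o f) (EFin \o g).
  apply: integral_ae_eq => //; first exact: hf.1.
  - exact: (measurable_int _ hg.1).
  - by move=> E _ mE; have := hf.2 E mE; have := hg.2 E mE => /= -> ->.
by apply: filterS => x /= /(_ I) [].
Qed.

End regression.

(** * Wavelet series in the Besov ball *)

Section geometric_sums.
Context (R : realType).
Implicit Types (t z : R).

Lemma geometric_tail t (a c : nat) : 0 <= t < 1 ->
  \sum_(a <= j < c) t ^+ j <= t ^+ a / (1 - t).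
Proof.
move=> /andP[t0 t1]; have t1' : 0 < 1 - t by rewrite subr_gt0.
have [ac|ca] := leqP a c; last by rewrite big_geq ?(ltnW ca)// divr_ge0 ?exprn_ge0// ltW.
rewrite -(subnKC ac); move: (c - a)%N => m {ac}; elim: m a => [|m IH] a.
  by rewrite addn0 big_geq// divr_ge0 ?exprn_ge0// ltW.
rewrite big_ltn ?addnS ?ltnS ?leq_addr// -addSn.
apply: (le_trans (lerD (lexx _) (IH a.+1))).
rewrite exprS le_eqVlt; apply/orP; left; apply/eqP; field.
by rewrite gt_eqF.
Qed.

(** The sum is truncated by value instead of index, so no integer cutoff level has to be chosen. The
    largest term kept is at most [z], and the others decrease geometrically below it. *)
Lemma geometric_low t z (a c : nat) : 1 < t -> 0 <= z ->
  \sum_(a <= j < c) (if t ^+ j <= z then t ^+ j else 0) <= t / (t - 1) * z.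
Proof.
move=> t1 z0; have t1' : 0 < t - 1 by rewrite subr_gt0.
have t0 : 0 < t by rewrite (lt_trans _ t1).
have p0 j : 0 <= t ^+ j by rewrite exprn_ge0// ltW.
have full m : \sum_(a <= j < m.+1) t ^+ j <= t / (t - 1) * t ^+ m.
  elim: m => [|m IH].
    case: a => [|a]; last by rewrite big_geq// !mulr_ge0// ?invr_ge0 ltW.
    by rewrite big_nat1 expr0 mulr1 ler_pdivlMr// mul1r gerBl.
  have [am|am] := leqP a m.+1; last by rewrite big_geq// !mulr_ge0// ?invr_ge0 ltW.
  rewrite big_nat_recr//= (le_trans (lerD IH (lexx _)))//.
  rewrite exprS le_eqVlt; apply/orP; left; apply/eqP; field.
  by rewrite gt_eqF.
have rhs0 : 0 <= t / (t - 1) * z by rewrite !mulr_ge0// ?invr_ge0 ltW.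
elim: c => [|c IH]; first by rewrite big_geq.
have [ac|ac] := leqP a c; last by rewrite big_geq.
case: (leP (t ^+ c) z) => tz; last by rewrite big_nat_recr//= (lt_geF tz) addr0.
apply: (@le_trans _ _ (\sum_(a <= j < c.+1) t ^+ j)).
  by apply: ler_sum => j _; case: ifP.
by rewrite (le_trans (full c))// ler_wpM2l// mulr_ge0// ?invr_ge0 ltW.
Qed.

Lemma geometric_high t z (a c : nat) : 0 <= t < 1 -> 0 <= z ->
  \sum_(a <= j < c) (if t ^+ j <= z then t ^+ j else 0) <= z / (1 - t).
Proof.
move=> /andP[t0 t1] z0; have t1' : 0 < 1 - t by rewrite subr_gt0.
have rhs0 : 0 <= z / (1 - t) by rewrite divr_ge0// ltW.
have [ac|ca] := leqP a c; last by rewrite big_geq ?(ltnW ca).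
rewrite -(subnKC ac); move: (c - a)%N => m {ac}; elim: m a => [|m IH] a.
  by rewrite addn0 big_geq.
case: (leP (t ^+ a) z) => az.
  apply: (@le_trans _ _ (\sum_(a <= j < a + m.+1) t ^+ j)).
    by apply: ler_sum => j _; case: ifP => //; rewrite exprn_ge0.
  rewrite (le_trans (geometric_tail _ _ _)) ?t0//.
  by rewrite ler_wpM2r// invr_ge0 ltW.
rewrite big_ltn ?addnS ?ltnS ?leq_addr// (lt_geF az) add0r -addSn.
exact: IH.
Qed.

End geometric_sums.

Section besov.
Context (R : realType) (W : wavelet_system R) (N B M s : R) (h : R -> R).
Hypotheses (WN : is_wavelet_basis W N) (B1 : 1 <= B) (WB : wav_bounds W B)
  (M0 : 0 < M) (s0 : 0 < s).
Notation leb := (@lebesgue_measure R).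
Let th : R := 2 `^ (- s).
Hypothesis coef : forall j k, (coarsest W <= j)%N -> (k < 2 ^ j)%N ->
  `|wcoef W h j k| <= M * th ^+ j / Num.sqrt 2 ^+ j.

Let th01 : 0 < th < 1.
Proof.
rewrite /th powR_gt0//= -[ltRHS](powRr0 (2 : R)) /powR.
rewrite pnatr_eq0/= ltr_expR mul0r nmulr_rlt0 ?oppr_lt0// ln_gt0//.
by rewrite ltr1n.
Qed.

Let lev j x := \sum_(0 <= k < 2 ^ j) wcoef W h j k * wav W j k x.

Let sq0 j : 0 < (Num.sqrt 2 : R) ^+ j. Proof. by rewrite exprn_gt0// sqrtr_gt0. Qed.

Let lev_le j x : (coarsest W <= j)%N -> `|lev j x| <= B ^+ 2 * M * th ^+ j.
Proof.
move=> jW; have := wav_sum_le B1 WB x (fun k => coef jW (k := k)).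
move=> /le_trans; apply; rewrite le_eqVlt; apply/orP; left; apply/eqP; field.
by rewrite gt_eqF.
Qed.

Let th_ge0 j : 0 <= th ^+ j. Proof. by case/andP: th01 => t0 _; rewrite exprn_ge0// ltW. Qed.

Let C := B ^+ 2 * M / (1 - th).

Let B20 : 0 < B ^+ 2. Proof. by rewrite exprn_gt0// (lt_le_trans ltr01 B1). Qed.
Let BM0 : 0 <= B ^+ 2 * M := mulr_ge0 (ltW B20) (ltW M0).
Let th1 : 0 < 1 - th. Proof. by case/andP: th01 => _ t1; rewrite subr_gt0. Qed.

Lemma wexpansion_diff J J' x : (coarsest W <= J)%N -> (J <= J')%N ->
  `|wexpansion W h J' x - wexpansion W h J x| <= C * th ^+ J.
Proof.
move=> WJ JJ'; rewrite /wexpansion (@big_cat_nat _ _ _ J)//= addrAC subrr add0r.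
rewrite (le_trans (ler_norm_sum _ _ _))//.
apply: (@le_trans _ _ (\sum_(J <= j < J') B ^+ 2 * M * th ^+ j)).
  by rewrite !big_nat; apply: ler_sum => j /andP[Jj _]; apply: lev_le; exact: leq_trans Jj.
rewrite -mulr_sumr /C [leRHS]mulrAC -[leRHS]mulrA ler_wpM2l//.
by case/andP: th01 => t0 t1; rewrite geometric_tail// ltW.
Qed.

(** A representative of [h] whose bounds hold at every point, whereas the coefficients determine [h]
    only up to a null set. *)
Definition wlimit x := limn (fun J => wexpansion W h J x).

Lemma wexpansion_cvg x : wexpansion W h J x @[J --> \oo] --> wlimit x.
Proof.
pose a j := if (coarsest W <= j)%N then lev j x else 0.
have wE : (fun J => wexpansion W h J x) = series a.
  apply/funext => J; rewrite /series/= /wexpansion.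
  elim: J => [|J IH]; first by rewrite !big_geq.
  rewrite [RHS]big_nat_recr//= -IH /a; case: ifPn => WJ; first by rewrite big_nat_recr.
  by rewrite addr0 !big_geq//; lia.
rewrite /wlimit wE; apply: normed_cvg.
apply: (@series_le_cvg _ _ (fun j => B ^+ 2 * M * th ^+ j)).
- by move=> j; exact: normr_ge0.
- by move=> j; exact: mulr_ge0.
- move=> j; rewrite /= /a; case: ifPn => WJ; first exact: lev_le.
  by rewrite normr0; exact: mulr_ge0.
- apply: (@is_cvg_geometric_series _ (B ^+ 2 * M) th).
  by case/andP: th01 => t0 t1; rewrite ger0_norm// ltW.
Qed.

Lemma wlimit_tail J x : (coarsest W <= J)%N -> `|wlimit x - wexpansion W h J x| <= C * th ^+ J.
Proof.
move=> WJ.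
have c : `|wexpansion W h J' x - wexpansion W h J x| @[J' --> \oo] --> `|wlimit x - wexpansion W h J x|.
  apply: cvg_norm; apply: cvgB; [exact: wexpansion_cvg|exact: cvg_cst].
rewrite -(cvg_lim _ c)//; apply: limr_le; first by apply/cvg_ex; eexists; exact: c.
by exists J => // J' /= JJ'; exact: wexpansion_diff.
Qed.

Let lev_diff j x y : (coarsest W <= j)%N ->
  `|lev j x - lev j y| <= 2 * B ^+ 2 * M * th ^+ j * Num.min 1 (2 ^+ j * `|x - y|).
Proof.
move=> jW.
have c0 : 0 <= 2 * B ^+ 2 * M * th ^+ j.
  by apply: mulr_ge0 => //; rewrite -mulrA; exact: mulr_ge0.
have h1 : `|lev j x - lev j y| <= 2 * B ^+ 2 * M * th ^+ j * 1.
  rewrite mulr1 (le_trans (ler_normB _ _))// (le_trans (lerD (lev_le x jW) (lev_le y jW)))//.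
  by rewrite le_eqVlt; apply/orP; left; apply/eqP; ring.
have h2 : `|lev j x - lev j y| <= 2 * B ^+ 2 * M * th ^+ j * (2 ^+ j * `|x - y|).
  have := wav_sum_lipschitz B1 WB x y (fun k => coef jW (k := k)).
  move=> /le_trans; apply; rewrite le_eqVlt; apply/orP; left; apply/eqP; field.
  by rewrite gt_eqF.
by rewrite minEle; case: ifPn.
Qed.

(* For [q] small this is a Hölder modulus of order [sg] read at scale [q]. *)
Lemma wlimit_modulus (sg q x y : R) : 0 < sg <= 1 -> sg < s -> 0 < q ->
  `|wlimit x - wlimit y| <=
  2 * B ^+ 2 * M / (1 - 2 `^ (sg - s)) * (q `^ sg * (1 + `|x - y| / q)).
Proof.
move=> /andP[sg0 sg1] sgs q0.
pose t : R := 2 `^ (sg - s); pose d := `|x - y|.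
have ln20 : 0 < ln 2 :> R by rewrite ln_gt0// ltr1n.
have t1 : t < 1.
  rewrite /t -[ltRHS](powRr0 (2 : R)) /powR pnatr_eq0/= ltr_expR mul0r nmulr_rlt0//.
  by rewrite subr_lt0.
have t0 : 0 < t by rewrite powR_gt0.
have d0 : 0 <= d / q by rewrite divr_ge0 ?normr_ge0 ?ltW.
have tE j : th ^+ j * (2 ^+ j * q) `^ sg = q `^ sg * t ^+ j.
  rewrite powRM ?exprn_ge0 ?ltW// -[2 ^+ j]powR_mulrn// -!powRrM /t /th.
  rewrite -!powR_mulrn ?powR_ge0// -!powRrM mulrA -powRD; last first.
    by apply/implyP => _; rewrite pnatr_eq0.
  by rewrite mulrC; congr (_ * 2 `^ _); ring.
(* At levels finer than [q], [1 <= (2^j q)^sg]; at coarser ones [2^j d = (2^j q) (d / q)] and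
   [2^j q <= (2^j q)^sg] as [sg <= 1]. Multiplied by [th^j], this becomes geometric of ratio
   [2^(sg - s) < 1]. *)
have minle j : Num.min 1 (2 ^+ j * d) <= (2 ^+ j * q) `^ sg * (1 + d / q).
  have p0 : 0 < 2 ^+ j * q by rewrite mulr_gt0// exprn_gt0.
  have [h1|h1] := leP 1 (2 ^+ j * q).
    rewrite (@le_trans _ _ 1)//; first by rewrite ge_min lexx.
    rewrite -[leLHS]mulr1 ler_pM//; last by rewrite lerDl.
    by rewrite -[leLHS](powRr0 (2 ^+ j * q)) ler_powR// ltW.
  rewrite (@le_trans _ _ (2 ^+ j * d))//; first by rewrite ge_min lexx orbT.
  have -> : 2 ^+ j * d = 2 ^+ j * q * (d / q) by field; rewrite gt_eqF.
  rewrite ler_pM ?(ltW p0)//; last by rewrite lerDr.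
  rewrite -[leLHS](powRr1 (ltW p0)); apply: ger_powR => //.
  by rewrite p0 ltW.
have c0 : 0 <= 2 * B ^+ 2 * M by rewrite -mulrA; exact: mulr_ge0.
have part J : `|wexpansion W h J x - wexpansion W h J y| <=
    2 * B ^+ 2 * M / (1 - t) * (q `^ sg * (1 + d / q)).
  rewrite /wexpansion -sumrB (le_trans (ler_norm_sum _ _ _))//.
  apply: (@le_trans _ _ (\sum_(coarsest W <= j < J) 2 * B ^+ 2 * M * (q `^ sg * (1 + d / q)) * t ^+ j)).
    rewrite !big_nat; apply: ler_sum => j /andP[Wj _].
    apply: (le_trans (lev_diff x y Wj)); rewrite -[leLHS]mulrA -[leRHS]mulrA ler_wpM2l//.
    rewrite (le_trans (ler_wpM2l (th_ge0 j) (minle j)))//.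
    by rewrite mulrA tE le_eqVlt; apply/orP; left; apply/eqP; ring.
  have q1 : 0 <= q `^ sg * (1 + d / q) by rewrite mulr_ge0 ?powR_ge0// addr_ge0.
  rewrite -mulr_sumr.
  have := geometric_tail (coarsest W) J (_ : 0 <= t < 1).
  rewrite (ltW t0) t1 => /(_ isT) g.
  have {}g : \sum_(coarsest W <= j < J) t ^+ j <= (1 - t)^-1.
    rewrite (le_trans g)// ler_piMl ?invr_ge0 ?subr_ge0 ?(ltW t1)//.
    by rewrite exprn_ile1 ?ltW.
  by rewrite [leRHS]mulrAC ler_wpM2l// mulr_ge0.
have c : `|wexpansion W h J x - wexpansion W h J y| @[J --> \oo] --> `|wlimit x - wlimit y|.
  by apply: cvg_norm; apply: cvgB; exact: wexpansion_cvg.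
rewrite -(cvg_lim _ c)//; apply: limr_le; first by apply/cvg_ex; eexists; exact: c.
by near=> J; exact: part.
Unshelve. all: by end_near. Qed.

Lemma wlimit_bounded x : `|wlimit x| <= C.
Proof.
have := wlimit_tail x (leqnn (coarsest W)).
rewrite /wexpansion big_geq// subr0 => /le_trans; apply.
have C0 : 0 <= C by apply: divr_ge0; [apply: mulr_ge0|]; exact: ltW.
rewrite ler_piMr// exprn_ile1//; case/andP: th01 => *; exact: ltW.
Qed.

Lemma measurable_wexpansion J : measurable_fun setT (wexpansion W h J).
Proof.
have wE0 m : (m <= coarsest W)%N -> wexpansion W h m = cst 0.
  by move=> mW; apply/funext => x; rewrite /wexpansion big_geq.
elim: J => [|J IH]; first by rewrite wE0.
have [WJ|WJ] := leqP (coarsest W) J; last by rewrite wE0.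
have -> : wexpansion W h J.+1 = (fun x => wexpansion W h J x +
    \sum_(0 <= k < 2 ^ J) if (k < 2 ^ J)%N then wcoef W h J k * wav W J k x else 0).
  apply/funext => x; rewrite /wexpansion big_nat_recr//=; congr (_ + _).
  by rewrite !big_nat; apply: eq_bigr => k /andP[_ ->].
apply: measurable_funD => //; apply: measurable_sum => k.
have [kj|kj] := ltnP k (2 ^ J); last exact: measurable_cst.
by apply: measurable_funM => //; exact: (measurable_wav B1 WB kj).
Qed.

Lemma measurable_wlimit : measurable_fun setT wlimit.
Proof.
apply: (measurable_fun_cvg measurable_wexpansion) => x _; exact: wexpansion_cvg.
Qed.

Section ae.
Hypothesis mh : measurable_fun (`[0%R, 1%R]%classic : set R) h.
Hypothesis h2 : (\int[leb]_(x in `[0%R, 1%R]) ((h x) ^+ 2)%:E < +oo)%E.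

Let D : set R := `[0%R, 1%R]%classic.
Let mD : measurable D. Proof. exact: measurable_itv. Qed.
Let lebD : leb D = 1%E.
Proof. by rewrite /D lebesgue_measure_itv/= lte_fin ltr01 oppr0 addr0. Qed.

(** The square integral of [h - wlimit] is at most twice that of [h - wexpansion W h J], which tends
    to 0 by completeness, plus [2 (C th^J)^2], which tends to 0 because the series converges
    uniformly. *)
Lemma wlimit_ae : {ae leb, forall x : measurableTypeR R, D x -> h x = wlimit x}.
Proof.
pose I := (\int[leb]_(x in D) ((h x - wlimit x) ^+ 2)%:E)%E.
pose IJ J := (\int[leb]_(x in D) ((h x - wexpansion W h J x) ^+ 2)%:E)%E.
have IJ0 : IJ J @[J --> \oo] --> 0%E by exact: (wb_complete WN mh h2).
have md (g : R -> R) : measurable_fun setT g -> measurable_fun D (fun x => ((h x - g x) ^+ 2)%:E).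
  move=> mg; apply/measurable_EFinP; apply: measurable_funX; apply: measurable_funB => //.
  exact: measurable_funTS.
have lc (c : R) : (\int[leb]_(_ in D) c%:E = c%:E)%E.
  by rewrite integral_cst// -[RHS]mule1; congr (_ * _)%E; exact: lebD.
have step J : (coarsest W <= J)%N -> (I <= 2%:E * IJ J + (2 * (C * th ^+ J) ^+ 2)%:E)%E.
  move=> WJ.
  apply: (@le_trans _ _ (\int[leb]_(x in D) (2%:E * ((h x - wexpansion W h J x) ^+ 2)%:E + (2 * (C * th ^+ J) ^+ 2)%:E))%E).
    apply: ge0_le_integral => //.
    - by move=> x _; rewrite lee_fin sqr_ge0.
    - by apply: md; exact: measurable_wlimit.
    - apply: emeasurable_funD => //; apply: measurable_funeM.
      by apply: md; exact: measurable_wexpansion.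
    - move=> x _; rewrite -EFinM -EFinD lee_fin.
      have := wlimit_tail x WJ; set u := wlimit x - _ => ut.
      have u2 : u ^+ 2 <= (C * th ^+ J) ^+ 2.
        rewrite -[u ^+ 2]real_normK ?num_real// ler_pXn2r ?nnegrE//.
        by rewrite (le_trans _ ut).
      have -> : h x - wlimit x = (h x - wexpansion W h J x) - u by rewrite /u; ring.
      have := sqr_ge0 ((h x - wexpansion W h J x) + u); lra.
  rewrite ge0_integralD//.
  - apply: leeD; last by rewrite [leLHS]lc.
    rewrite ge0_integralZl//.
    + by apply: md; exact: measurable_wexpansion.
    + by move=> x _; rewrite lee_fin sqr_ge0.
  - by move=> x _; rewrite mule_ge0// lee_fin sqr_ge0.
  - by apply: measurable_funeM; apply: md; exact: measurable_wexpansion.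
  - by move=> x _; rewrite lee_fin mulr_ge0// sqr_ge0.
have I0 : I = 0%E.
  apply/eqP; rewrite eq_le; apply/andP; split; last first.
    by apply: integral_ge0 => x _; rewrite lee_fin sqr_ge0.
  have lim0 : (2%:E * IJ J + (2 * (C * th ^+ J) ^+ 2)%:E)%E @[J --> \oo] --> (2%:E * 0 + (2 * (C * 0) ^+ 2)%:E)%E.
    apply: cvgeD => //.
      by apply: cvgeZl.
    apply: cvg_EFin; first by near=> J.
    apply: cvgM; first exact: cvg_cst.
    have thc : C * th ^+ J @[J --> \oo] --> C * 0.
      apply: cvgM; first exact: cvg_cst.
      by apply: cvg_expr; case/andP: th01 => t0 t1; rewrite ger0_norm// ltW.
    by rewrite expr2; under eq_fun do rewrite expr2; exact: cvgM.
  rewrite mule0 mulr0 expr0n/= mulr0 adde0 in lim0.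
  rewrite -(cvg_lim _ lim0)//; apply: lime_ge; first by apply/cvg_ex; eexists; exact: lim0.
  by exists (coarsest W) => // J /= WJ; exact: step.
have : (\int[leb]_(x in D) `|((h x - wlimit x) ^+ 2)%:E| = 0)%E.
  rewrite -I0; apply: eq_integral => x _.
  by rewrite gee0_abs// lee_fin sqr_ge0.
move=> /(ae_eq_integral_abs leb mD) => /(_ (md _ measurable_wlimit)).
apply: filterS => x /= hx Dx; have [] := hx Dx.
by move=> /eqP; rewrite sqrf_eq0 subr_eq0 => /eqP.
Unshelve. all: by end_near. Qed.

Lemma wcoef_wlimit j k : (k < 2 ^ j)%N ->
  wcoef W h j k = \int[leb]_(x in `[0, 1]) (wlimit x * wav W j k x).
Proof.
move=> kj; rewrite /wcoef /Rintegral; congr fine.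
have mw := measurable_wav B1 WB kj.
apply: ae_eq_integral => //.
- by apply/measurable_EFinP; apply: measurable_funM => //; exact: measurable_funTS.
- apply/measurable_EFinP; apply: measurable_funM => //; apply: measurable_funTS => //.
  exact: measurable_wlimit.
- by move: wlimit_ae; apply: filterS => x /= hx Dx; rewrite hx.
Qed.
End ae.

End besov.

(** * Rates, thresholding and bias *)

Section rates.
Context (R : realType).
Implicit Types (s q e : R) (n J : nat).

Lemma ln_nat_bounds n : (2 <= n)%N -> 2^-1 <= ln (n%:R : R) < n%:R.
Proof.
move=> n2; have n0 : 0 < n%:R :> R by rewrite ltr0n (leq_trans _ n2).
apply/andP; split.
  rewrite -[leLHS]expRK ler_ln ?posrE ?expR_gt0//.
  have h : expR (2^-1 : R) <= 2.
    have h : expR (- 2^-1 : R) >= 2^-1.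
      by rewrite (le_trans _ (expR_ge1Dx _))//; lra.
    by rewrite -[2^-1]opprK expRN -[leRHS]invrK lef_pV2 ?posrE ?expR_gt0// invr_gt0.
  by rewrite (le_trans h)// ler_nat.
rewrite -ltr_expR lnK ?posrE//.
have := expR_ge1Dx (n%:R : R); lra.
Qed.

Variables (s : R) (n J : nat).
Hypotheses (s2 : 2^-1 < s) (n2 : (2 <= n)%N)
  (Jlow : (n%:R / ln n%:R) `^ (1 + 2 * s)^-1 <= (2 : R) ^+ J)
  (Jhigh : (2 : R) ^+ J <= (n%:R / ln n%:R) `^ 2^-1).

(** All quantities are written as powers of [x > 1], so that comparing them amounts to comparing
    exponents; [q], for instance, is [x^(-1/2)]. *)
Let x : R := n%:R / ln n%:R.
Let q : R := Num.sqrt (ln n%:R / n%:R).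
Let e : R := rate s n.
Let th : R := 2 `^ (- s).

Let n0 : 0 < n%:R :> R. Proof. by rewrite ltr0n (leq_trans _ n2). Qed.
Let l0 : 0 < ln (n%:R : R).
Proof. by have /andP[h _] := ln_nat_bounds n2; rewrite (lt_le_trans _ h). Qed.
Let x1 : 1 < x.
Proof. by have /andP[_ h] := ln_nat_bounds n2; rewrite /x ltr_pdivlMr// mul1r. Qed.
Let x0 : 0 < x. Proof. exact: lt_trans x1. Qed.
Let s1 : 0 < 1 + 2 * s. Proof. by move: s2; lra. Qed.

Let qE : q = x `^ (- 2^-1).
Proof.
rewrite /q (_ : ln n%:R / n%:R = x^-1); last by rewrite /x invf_div.
by rewrite sqrtrV ?ltW// -powR12_sqrt ?ltW// powRN.
Qed.

Let xpow_gt0 a : 0 < x `^ a. Proof. exact: powR_gt0. Qed.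
Let xD a b : x `^ a * x `^ b = x `^ (a + b).
Proof. by rewrite powRD// (gt_eqF x0) implybT. Qed.
Let x_le a b : a <= b -> x `^ a <= x `^ b.
Proof. by move=> ab; rewrite ler_powR// ltW. Qed.

Lemma noise_gt0 : 0 < q. Proof. by rewrite qE. Qed.
Lemma rate_gt0 : 0 < e. Proof. exact: xpow_gt0. Qed.
Lemma noise_le1 : q <= 1.
Proof. by rewrite qE -[leRHS](powRr0 x) x_le// oppr_le0. Qed.
Lemma noise_sqr : n%:R * q ^+ 2 = ln n%:R.
Proof. by rewrite sqr_sqrtr ?divr_ge0 ?ltW// mulrCA divff ?gt_eqF// mulr1. Qed.
Lemma invn_le_noise : n%:R^-1 <= 2 * q ^+ 2.
Proof.
rewrite -(ler_pM2l n0) divff ?gt_eqF// mulrCA noise_sqr.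
by have /andP[h _] := ln_nat_bounds n2; lra.
Qed.
Lemma level_noise : 2 ^+ J * q <= 1.
Proof.
rewrite (le_trans (ler_wpM2r (ltW noise_gt0) Jhigh))// qE xD subrr powRr0//.
Qed.
Lemma level_le_size : (2 : R) ^+ J <= n%:R.
Proof.
have h : 0 < (2 : R) ^+ J by rewrite exprn_gt0.
have h1 := level_noise; have h2 := invn_le_noise; have q0 := noise_gt0.
have h3 : ((2 : R) ^+ J) ^+ 2 * q ^+ 2 <= 1.
  by rewrite -exprMn exprn_ile1// mulr_ge0// ltW.
have h4 : 1 <= 2 * n%:R * q ^+ 2 by rewrite -[leLHS](mulfV (lt0r_neq0 n0)) -mulrA mulrCA ler_wpM2l// ltW.
have nn : 2 * n%:R <= n%:R ^+ 2 :> R by rewrite expr2 ler_wpM2r ?(ltW n0)// ler_nat.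
have q2 : 0 < q ^+ 2 by rewrite exprn_gt0.
have h5 : ((2 : R) ^+ J) ^+ 2 <= n%:R ^+ 2.
  by rewrite (le_trans _ nn)// -(ler_pM2r q2) (le_trans h3).
by rewrite -(@ler_pXn2r _ 2)// ?nnegrE ltW.
Qed.

Let eqE : e / q = x `^ (2^-1 * (1 + 2 * s)^-1).
Proof.
rewrite /e /rate -/x qE -powRN opprK xD; congr (_ `^ _); field.
by rewrite gt_eqF// addrC; lra.
Qed.

Let sqrtE j : (Num.sqrt 2 : R) ^+ j = (2 ^+ j) `^ 2^-1.
Proof.
have s0 : 0 <= (Num.sqrt 2 : R) ^+ j by rewrite exprn_ge0// sqrtr_ge0.
by rewrite powR12_sqrt ?exprn_ge0// -(sqrt2X_sqr R j) sqrtr_sqr ger0_norm.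
Qed.

Let thE j : th ^+ j = (Num.sqrt 2 ^+ j) `^ (- (2 * s)).
Proof.
rewrite sqrtE /th -(powR_mulrn j (powR_ge0 2 (- s))) -(powR_mulrn j (ler0n R 2)) -!powRrM.
congr (_ `^ _).
by field.
Qed.

Lemma cutoff_le_level : e / q <= Num.sqrt 2 ^+ J.
Proof. by rewrite eqE (mulrC 2^-1) powRrM sqrtE ge0_ler_powR ?nnegrE ?powR_ge0 ?exprn_ge0. Qed.

(** The cutoff [2^(j/2) = e / q] is the balance point: there the noise [2^(j/2) q] and the size
    [2^(-js)] of a level both equal [e], and the latter decreases with [j]. *)
Lemma high_level_le j : e / q <= Num.sqrt 2 ^+ j -> th ^+ j <= e.
Proof.
have sq : 0 < (Num.sqrt 2 : R) ^+ j by rewrite exprn_gt0// sqrtr_gt0.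
move=> h; rewrite thE.
have -> : e = (e / q) `^ (- (2 * s)).
  rewrite eqE -powRrM /e /rate -/x; congr (_ `^ _); field.
  by rewrite gt_eqF// addrC; lra.
rewrite !powRN lef_pV2 ?posrE ?powR_gt0 ?divr_gt0 ?noise_gt0 ?rate_gt0//.
rewrite ge0_ler_powR ?nnegrE ?(ltW sq) ?divr_ge0 ?(ltW noise_gt0) ?(ltW rate_gt0)//.
by move: s2; lra.
Qed.

Lemma rateE : e = q `^ (2 * s / (1 + 2 * s)).
Proof.
rewrite qE -powRrM /e /rate -/x; congr (_ `^ _); field.
by rewrite gt_eqF// addrC; lra.
Qed.

(** The gap between [sg] and the exponent of the rate pays for the number of levels: since
    [2^J q <= 1], the excess power of [q] is at most [t^J] with [t < 1], and [(J + 1) t^J] is at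
    most the whole geometric series. *)
Lemma level_noise_pow (sg : R) : 2 * s / (1 + 2 * s) < sg ->
  J.+1%:R * q `^ sg <= (1 - 2 `^ (2 * s / (1 + 2 * s) - sg))^-1 * e.
Proof.
move=> hsg; set s' := 2 * s / (1 + 2 * s) in hsg *.
pose t : R := 2 `^ (s' - sg).
have ln20 : 0 < ln 2 :> R by rewrite ln_gt0// ltr1n.
have t1 : t < 1.
  rewrite /t -[ltRHS](powRr0 (2 : R)) /powR pnatr_eq0/= ltr_expR mul0r nmulr_rlt0//.
  by rewrite subr_lt0.
have t0 : 0 < t by rewrite powR_gt0.
have -> : q `^ sg = q `^ (sg - s') * e.
  by rewrite rateE -/s' -powRD ?subrK// (gt_eqF noise_gt0) implybT.
rewrite mulrA ler_wpM2r ?(ltW rate_gt0)//.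
have qt : q `^ (sg - s') <= t ^+ J.
  have -> : t ^+ J = (2 ^+ J)^-1 `^ (sg - s').
    rewrite /t -(powR_mulrn J (powR_ge0 2 (s' - sg))) -(powR_inv1 (exprn_ge0 J (ler0n R 2))).
    by rewrite -(powR_mulrn J (ler0n R 2)) -!powRrM; congr (_ `^ _); ring.
  have p0 : 0 < (2 : R) ^+ J by rewrite exprn_gt0.
  rewrite ge0_ler_powR ?nnegrE ?(ltW noise_gt0) ?invr_ge0 ?(ltW p0)//.
    by rewrite subr_ge0 ltW.
  by rewrite -(ler_pM2l p0) divff ?gt_eqF// level_noise.
rewrite (le_trans (ler_wpM2l (ler0n _ _) qt))//.
have := geometric_tail 0 J.+1 (_ : 0 <= t < 1); rewrite (ltW t0) t1 => /(_ isT).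
rewrite expr0 mul1r; apply: le_trans.
rewrite mulr_natl -[J.+1]subn0 -sumr_const_nat !big_nat subn0.
apply: ler_sum => j /andP[_ jJ]; rewrite ler_wiXn2l// ?ltW//.
Qed.

End rates.

(** * Deterministic error bounds: one thresholded coefficient, the bias, the estimator *)

Section threshold.
Context (R : realType).

(** [w] stands for [2^(j/2)], [z] for the cutoff, and [be], [bi], [xi] for a coefficient, its bias
    and its noise. Up to the cutoff, a kept estimate errs by [|bi + xi|] and a deleted one by at
    most [kq + |bi| + |xi|]. Beyond it, if [good], the estimate is deleted and the error is [|be|];
    otherwise the triangle inequality counts [Mt] twice. *)
Lemma threshold_term (w be bi xi kq Mt Pb ar z : R) (good : bool) :
  0 < w -> `|be| <= Mt / w -> `|bi| <= Pb / w -> `|xi| <= ar -> 0 <= kq ->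
  (good -> z < w -> `|be + bi + xi| < kq) ->
  w * `|(if kq <= `|be + bi + xi| then be + bi + xi else 0) - be| <= kq * (if w <= z then w else 0) +
    2 * (if w <= z then 0 else Mt) + Pb +
    ar * (if good then (if w <= z then w else 0) else w).
Proof.
move=> w0 hbe hbi hxi kq0; set bh := be + bi + xi => hgood.
set bt := (X in `|X - be|).
have Mt0 : 0 <= Mt by have := le_trans (normr_ge0 _) hbe; rewrite pmulr_lge0 ?invr_gt0.
have Pb0 : 0 <= Pb by have := le_trans (normr_ge0 _) hbi; rewrite pmulr_lge0 ?invr_gt0.
have ar0 : 0 <= ar := le_trans (normr_ge0 _) hxi.
have wbe : w * `|be| <= Mt by rewrite mulrC -ler_pdivlMr.
have wbi : w * `|bi| <= Pb by rewrite mulrC -ler_pdivlMr.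
have wxi : w * `|xi| <= ar * w by rewrite mulrC ler_wpM2r// ltW.
have arw : 0 <= ar * w by rewrite mulr_ge0// ltW.
have kqw : 0 <= kq * w by rewrite mulr_ge0// ltW.
have wbh : w * `|bh| <= Mt + Pb + ar * w.
  apply: (@le_trans _ _ (w * (`|be| + `|bi| + `|xi|))).
    by rewrite ler_wpM2l ?(ltW w0)// (le_trans (ler_normD _ _))// lerD2r ler_normD.
  by rewrite !mulrDr; lra.
have btbh : `|bt| <= `|bh| by rewrite /bt; case: ifP; rewrite ?normr0.
have wbt : w * `|bt - be| <= w * `|bh| + w * `|be|.
  rewrite -mulrDr ler_wpM2l ?(ltW w0)// (le_trans (ler_normB _ _))// lerD2r//.
have [wz|wz] := leP w z.
  have H : w * `|bt - be| <= kq * w + Pb + ar * w.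
    have bd : `|bt - be| <= kq + `|bi| + `|xi|.
      rewrite /bt; case: ifPn => [_|].
        have -> : bh - be = bi + xi by rewrite /bh; ring.
        by have := ler_normD bi xi; lra.
      rewrite -ltNge sub0r normrN => h.
      have -> : be = bh - bi - xi by rewrite /bh; ring.
      have := ler_normB (bh - bi) xi; have := ler_normB bh bi; lra.
    have := ler_wpM2l (ltW w0) bd; rewrite !mulrDr; lra.
  by case: (good); lra.
case: (boolP good) => g; last by lra.
have bt0 : bt = 0 by rewrite /bt leNgt hgood.
by rewrite bt0 sub0r normrN; lra.
Qed.

End threshold.

Section bias.
Context (R : realType) (W : wavelet_system R) (N B : R).
Hypotheses (WN : is_wavelet_basis W N) (B1 : 1 <= B) (WB : wav_bounds W B).
Notation leb := (@lebesgue_measure R).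

(** Replacing [G] by [F] inside [ht] costs the modulus at distance [dl], times a sum of [|wav|] that
    [rank_sum] turns into a grid sum of order [n 2^(-j/2)]. What remains is the error of a Riemann
    sum. In the application [p] is [q^sg]. *)
Lemma coef_bias (ht : R -> R) (H Bh p q dl : R) (j k J n : nat) (G x : 'I_n -> R) :
  measurable_fun setT ht -> 0 <= H -> 0 < q <= 1 -> q <= p -> 0 <= dl ->
  (forall u, `|ht u| <= Bh) ->
  (forall u v, `|ht u - ht v| <= H * (p * (1 + `|u - v| / q))) ->
  (0 < n)%N -> n%:R^-1 <= 2 * q ^+ 2 -> 2 ^+ J * q <= 1 -> 2 ^+ J <= n%:R :> R ->
  (coarsest W <= j <= J)%N -> (k < 2 ^ j)%N -> injective x ->
  let F i := n%:R^-1 * \sum_(i' < n) (x i' <= x i)%R%:R in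
  (forall i, `|F i - G i| <= dl) ->
  `|n%:R^-1 * \sum_(i < n) ht (G i) * wav W j k (F i) -
    \int[leb]_(u in `[0, 1]) (ht u * wav W j k u)| <=
  B * (`|N| + 2) * (4 * H + 2 * Bh) * p * (1 + dl / q) / Num.sqrt 2 ^+ j.
Proof.
move=> mht H0 /andP[q0 q1] qp dl0 htB htM n0 nq Jq Jn /andP[Wj jJ] kj xinj F FG.
have nR0 : 0 < n%:R :> R by rewrite ltr0n.
have p0 : 0 < p := lt_le_trans q0 qp.
have B0 : 0 <= B := le_trans ler01 B1.
have Bh0 : 0 <= Bh := le_trans (normr_ge0 _) (htB 0).
have w0 : 0 < (Num.sqrt 2 : R) ^+ j by rewrite exprn_gt0// sqrtr_gt0.
have t0 : 0 < (2 : R) ^+ j by rewrite exprn_gt0.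
have tJ : (2 : R) ^+ j <= 2 ^+ J by rewrite ler_eXn2l// ltr1n.
have jn : (2 : R) ^+ j <= n%:R := le_trans tJ Jn.
have [wb wl _] := WB.
pose r := 1 + dl / q.
have r1 : 1 <= r by rewrite /r lerDl divr_ge0// ltW.
pose Y := B * (`|N| + 2) / Num.sqrt 2 ^+ j.
have Y0 : 0 <= Y by rewrite /Y divr_ge0 ?(ltW w0)// mulr_ge0// addr_ge0.
have part1 : `|n%:R^-1 * \sum_(i < n) ht (G i) * wav W j k (F i) -
    n%:R^-1 * \sum_(i < n) ht (F i) * wav W j k (F i)| <= H * (p * r) * Y.
  rewrite -mulrBr -sumrB normrM ger0_norm ?invr_ge0 ?(ltW nR0)// mulrC ler_pdivrMr//.
  rewrite (le_trans (ler_norm_sum _ _ _))//.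
  apply: (@le_trans _ _ (\sum_(i < n) H * (p * r) * `|wav W j k (F i)|)).
    apply: ler_sum => i _; rewrite -mulrBl normrM ler_wpM2r//.
    rewrite (le_trans (htM _ _))// ler_wpM2l// ler_wpM2l ?(ltW p0)// lerD2l.
    by rewrite ler_wpM2r ?invr_ge0 ?(ltW q0)// distrC.
  rewrite -mulr_sumr -[leRHS]mulrA ler_wpM2l//; first by rewrite !mulr_ge0 ?(ltW p0)// (le_trans _ r1).
  rewrite (rank_sum (fun u => `|wav W j k u|) xinj).
  rewrite (le_trans (wav_grid_abs WN B1 WB Wj kj n0 jn))//.
  rewrite /Y mulrAC ler_wpM2r ?(ltW nR0)// ler_wpM2r ?invr_ge0 ?(ltW w0)//.
  by rewrite ler_wpM2l// lerD2l ler1n.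
have part2 : `|n%:R^-1 * \sum_(i < n) ht (F i) * wav W j k (F i) -
    \int[leb]_(u in `[0, 1]) (ht u * wav W j k u)| <= (3 * H + 2 * Bh) * p * Y.
  rewrite (rank_sum (fun u => ht u * wav W j k u) xinj) distrC.
  have [c hc] := wav_support WN Wj kj.
  (* Oscillation of the integrand over a cell: the modulus of [ht] at distance [1 / n], where
     [1 + (1 / n) / q <= 3], then the Lipschitz constant of the wavelet. *)
  pose E := H * (p * 3) * (B * Num.sqrt 2 ^+ j) +
            Bh * (B * Num.sqrt 2 ^+ j * 2 ^+ j * n%:R^-1).
  have E0 : 0 <= E.
    by rewrite /E addr_ge0// !mulr_ge0// ?invr_ge0 ?(ltW p0) ?(ltW w0) ?(ltW t0) ?(ltW nR0).
  have nV0 : 0 <= n%:R^-1 :> R by rewrite invr_ge0 ltW.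
  have nVq : n%:R^-1 / q <= 2 :> R.
    rewrite ler_pdivrMr// (le_trans nq)// expr2 mulrA ler_piMr// mulr_ge0// ltW//.
  have osc u v : 0 <= u <= 1 -> 0 <= v <= 1 -> `|u - v| <= n%:R^-1 ->
      `|ht u * wav W j k u - ht v * wav W j k v| <= E.
    move=> _ _ uv.
    have -> : ht u * wav W j k u - ht v * wav W j k v =
      (ht u - ht v) * wav W j k u + ht v * (wav W j k u - wav W j k v) by ring.
    rewrite (le_trans (ler_normD _ _))// !normrM lerD//.
      rewrite ler_pM ?wb// (le_trans (htM _ _))// ler_wpM2l// ler_wpM2l ?(ltW p0)//.
      have : `|u - v| / q <= n%:R^-1 / q by rewrite ler_wpM2r ?invr_ge0 ?(ltW q0).
      by move: nVq; lra.
    rewrite ler_pM// (le_trans (wl _ _ _ _ kj))// ler_wpM2l//.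
    by rewrite !mulr_ge0 ?(ltW w0) ?(ltW t0).
  have := @riemann_sum_le R (fun u => ht u * wav W j k u) n c (`|N| / 2 ^+ j) E
    (Bh * (B * Num.sqrt 2 ^+ j)) n0.
  move=> /(_ _ _ _ _ E0 osc) h; apply: (le_trans (h _ _ _ _)) => {h}.
  - by apply: measurable_funM => //; exact: (measurable_wav B1 WB kj).
  - by move=> u; rewrite normrM ler_pM// wb.
  - by move=> u u01; rewrite mulf_eq0 negb_or => /andP[_]; exact: hc.
  - by rewrite divr_ge0 ?(ltW t0).
  have nVt : n%:R^-1 <= (2 ^+ j)^-1 :> R by rewrite lef_pV2.
  apply: (@le_trans _ _ (E * ((`|N| + 2) / 2 ^+ j))).
    by rewrite ler_wpM2l// [leRHS]mulrDl lerD2l ler_wpM2l.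
  (* Here the restriction on the highest level enters: [2^J <= 1 / q] and [1 / n <= 2 q^2] give
     [2^j / n <= 2 q]. *)
  have tn : 2 ^+ j * n%:R^-1 <= 2 * p.
    apply: (@le_trans _ _ (2 ^+ J * (2 * q ^+ 2))).
      by rewrite ler_pM ?(ltW t0).
    have -> : 2 ^+ J * (2 * q ^+ 2) = (2 ^+ J * q) * (2 * q) by ring.
    rewrite (@le_trans _ _ (1 * (2 * q)))//; first by rewrite ler_wpM2r// mulr_ge0// ltW.
    by rewrite mul1r ler_wpM2l.
  have -> : (3 * H + 2 * Bh) * p * Y =
    (H * (p * 3) + Bh * (2 * p)) * (B * Num.sqrt 2 ^+ j) * ((`|N| + 2) / 2 ^+ j).
    rewrite /Y -sqrt2X_sqr; field; by rewrite gt_eqF.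
  rewrite ler_wpM2r ?divr_ge0 ?(ltW t0) ?addr_ge0//.
  have Bw : 0 <= B * Num.sqrt 2 ^+ j by rewrite mulr_ge0// ltW.
  rewrite /E mulrDl lerD2l.
  have -> : Bh * (B * Num.sqrt 2 ^+ j * 2 ^+ j * n%:R^-1) =
    Bh * (B * Num.sqrt 2 ^+ j) * (2 ^+ j * n%:R^-1) by ring.
  have -> : Bh * (2 * p) * (B * Num.sqrt 2 ^+ j) = Bh * (B * Num.sqrt 2 ^+ j) * (2 * p) by ring.
  by rewrite ler_wpM2l// mulr_ge0.
have -> : B * (`|N| + 2) * (4 * H + 2 * Bh) * p * (1 + dl / q) / Num.sqrt 2 ^+ j =
    (4 * H + 2 * Bh) * p * r * Y.
  by rewrite /Y /r; field; rewrite !gt_eqF.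
set a1 := n%:R^-1 * _ in part1 *; set a2 := n%:R^-1 * _ in part1 part2; set a3 := Rintegral _ _ _ in part2 *.
rewrite (_ : a1 - a3 = (a1 - a2) + (a2 - a3)); last by ring.
rewrite (le_trans (ler_normD _ _))// (le_trans (lerD part1 part2))//.
have -> : (4 * H + 2 * Bh) * p * r * Y = H * (p * r) * Y + (3 * H + 2 * Bh) * p * Y * r by ring.
rewrite lerD2l ler_peMr// !mulr_ge0 ?(ltW p0)// addr_ge0// mulr_ge0//.
Qed.

End bias.

Section estimator.
Context (R : realType) (W : wavelet_system R) (B : R).
Hypotheses (B1 : 1 <= B) (WB : wav_bounds W B).

Let C1 : R := Num.sqrt 2 / (Num.sqrt 2 - 1).

Let sqrt21 : 1 < Num.sqrt 2 :> R.
Proof. by rewrite -[ltLHS]sqrtr1 ltr_sqrt// ltr1n. Qed.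

Let C10 : 0 <= C1.
Proof. by rewrite divr_ge0 ?sqrtr_ge0// subr_ge0 ltW. Qed.

(** Summing [threshold_term] within and then over levels gives four sums: the threshold up to the
    cutoff, the coefficients beyond it, the bias and the noise. The first two are geometric and of
    order [e]. Outside [good], the noise costs [2^(J/2) r]: at most [g] if [r = rr], and at most
    [1 <= e / c0] if [r = q], for then the alternative on the bias leaves [c0 <= e]. *)
Lemma estimator_sup (th q e p Ce c0 Cb M kappa a r rr g dl : R) (J : nat)
    (be bi xi : nat -> nat -> R) (u : R) :
  0 < th < 1 -> 0 < q -> 0 < e -> 0 < p -> 0 <= M -> 0 <= Cb -> 0 <= a -> 0 < c0 ->
  0 <= Ce -> 0 <= rr -> 0 <= g ->
  (forall j, e / q <= Num.sqrt 2 ^+ j -> th ^+ j <= e) ->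
  e / q <= Num.sqrt 2 ^+ J -> 2 ^+ J * q <= 1 -> J.+1%:R * p <= Ce * e ->
  (Cb * (a + 3) * p < e) \/ c0 <= e ->
  M + a + 1 <= kappa -> r = Num.max q rr -> Num.sqrt 2 ^+ J * rr <= g ->
  0 <= dl <= (a + 2) * r ->
  (forall j k, (coarsest W <= j <= J)%N -> (k < 2 ^ j)%N ->
    [/\ `|be j k| <= M * th ^+ j / Num.sqrt 2 ^+ j,
        `|bi j k| <= Cb * p * (1 + dl / q) / Num.sqrt 2 ^+ j & `|xi j k| <= a * r]) ->
  `|\sum_(coarsest W <= j < J.+1) \sum_(0 <= k < 2 ^ j)
     ((if kappa * q <= `|be j k + bi j k + xi j k| then be j k + bi j k + xi j k else 0)
       - be j k) * wav W j k u| <=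
  B ^+ 2 * ((kappa * C1 + 2 * M / (1 - th) + Cb * Ce * (a + 3) + a * C1 + a * C1 / c0) * e +
    (Cb * Ce * (a + 2) + a * C1) * g).
Proof.
move=> /andP[th0 th1] q0 e0 p0 M0 Cb0 a0 c00 Ce0 rr0 g0 hth hJ hJq hJp hdich hkap hr hg /andP[dl0 hdl] hyp.
have w0 j : 0 < (Num.sqrt 2 : R) ^+ j by rewrite exprn_gt0// sqrtr_gt0.
have r0 : 0 < r by rewrite hr lt_max q0.
have qr : q <= r by rewrite hr le_max lexx.
have kap0 : 0 <= kappa by lra.
have kq0 : 0 <= kappa * q by rewrite mulr_ge0// ltW.
have eq0 : 0 < e / q by rewrite divr_gt0.
have qn : q != 0 by rewrite gt_eqF.
have s21n : Num.sqrt 2 - 1 != 0 :> R by rewrite gt_eqF// subr_gt0.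
have th0' j : 0 <= th ^+ j by rewrite exprn_ge0// ltW.
(* Ensures that every estimate above the cutoff is deleted: deviations are at scale [q], and the
   bias there stays below [q]. *)
pose good := (r == q) && (Cb * (a + 3) * p < e).
pose Pb := Cb * p * (1 + dl / q).
have Pb0 : 0 <= Pb.
  by rewrite /Pb !mulr_ge0 ?(ltW p0)// addr_ge0// divr_ge0// ltW.
pose S j := kappa * q * (if Num.sqrt 2 ^+ j <= e / q then Num.sqrt 2 ^+ j else 0) +
    2 * M * (if th ^+ j <= e then th ^+ j else 0) + Pb +
    a * r * (if good then (if Num.sqrt 2 ^+ j <= e / q then Num.sqrt 2 ^+ j else 0) else Num.sqrt 2 ^+ j).
have term j k : (coarsest W <= j <= J)%N -> (k < 2 ^ j)%N ->
  `|(if kappa * q <= `|be j k + bi j k + xi j k| then be j k + bi j k + xi j k else 0) - be j k| <=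
  S j / Num.sqrt 2 ^+ j.
  move=> jJ kj; have [h1 h2 h3] := hyp j k jJ kj.
  rewrite ler_pdivlMr// mulrC.
  have := @threshold_term R _ _ _ _ _ _ _ _ (e / q) good (w0 j) h1 h2 h3 kq0.
  move=> /(_ _)/le_trans; apply.
    move=> /andP[/eqP rq gd] high.
    (* The three shares of [kappa q]: [M q] for the coefficient, [q] for the bias, [a q] for the
       noise. The strict bound on the bias makes the total strict. *)
    have b1 : `|be j k| <= M * q.
      rewrite (le_trans h1)// -mulrA ler_wpM2l// ler_pdivrMr//.
      rewrite (le_trans (hth j (ltW high)))//.
      by rewrite mulrC -ler_pdivrMr// ltW.
    have b2 : `|bi j k| < q.
      apply: (le_lt_trans h2); rewrite ltr_pdivrMr//.
      have : 1 + dl / q <= a + 3.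
        have : dl / q <= a + 2 by rewrite ler_pdivrMr// -rq.
        by lra.
      move=> hh; apply: (@le_lt_trans _ _ (Cb * p * (a + 3))).
        by rewrite ler_wpM2l// mulr_ge0// ltW.
      have : e < q * Num.sqrt 2 ^+ j by rewrite mulrC -ltr_pdivrMr.
      by move: gd; lra.
    have b3 : `|xi j k| <= a * q by rewrite -rq.
    have := ler_normD (be j k + bi j k) (xi j k); have := ler_normD (be j k) (bi j k).
    have : (M + a + 1) * q <= kappa * q by rewrite ler_wpM2r// ltW.
    by lra.
  rewrite /S; rewrite lerD2r lerD2r lerD2l -mulrA ler_wpM2l//.
  case: (leP (Num.sqrt 2 ^+ j) (e / q)) => h.
    by case: ifP => _; rewrite mulr_ge0.
  by rewrite (hth j (ltW h)).
have S0 j : 0 <= S j.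
  rewrite /S; have wj := ltW (w0 j).
  have i1 : 0 <= (if Num.sqrt 2 ^+ j <= e / q then Num.sqrt 2 ^+ j else 0 : R) by case: ifP.
  have i2 : 0 <= (if th ^+ j <= e then th ^+ j else 0 : R) by case: ifP.
  have i3 : 0 <= (if good then (if Num.sqrt 2 ^+ j <= e / q then Num.sqrt 2 ^+ j else 0) else Num.sqrt 2 ^+ j : R).
    by case: ifP => _ //.
  rewrite addr_ge0//; last by rewrite mulr_ge0// mulr_ge0// ltW.
  rewrite addr_ge0//; rewrite addr_ge0//; first by rewrite mulr_ge0.
  by rewrite mulr_ge0// mulr_ge0.
rewrite (le_trans (ler_norm_sum _ _ _))//.
apply: (@le_trans _ _ (\sum_(coarsest W <= j < J.+1) B ^+ 2 * S j)).
  rewrite !big_nat; apply: ler_sum => j /andP[Wj jJ].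
  have jJ' : (coarsest W <= j <= J)%N by rewrite Wj.
  have := wav_sum_le B1 WB u (fun k => term j k jJ').
  by rewrite -mulrA divfK// gt_eqF.
rewrite -mulr_sumr ler_wpM2l ?sqr_ge0// /S !big_split/= -!mulr_sumr.
have low := geometric_low (coarsest W) J.+1 sqrt21 (ltW eq0).
have high := geometric_high (coarsest W) J.+1 (_ : 0 <= th < 1) (ltW e0).
rewrite (ltW th0) th1 in high; have {}high := high isT.
have all : \sum_(coarsest W <= j < J.+1) (Num.sqrt 2 : R) ^+ j <= C1 * Num.sqrt 2 ^+ J.
  have := geometric_low (coarsest W) J.+1 sqrt21 (ltW (w0 J)).
  apply: le_trans; rewrite !big_nat; apply: ler_sum => j /andP[_ jJ].
  by rewrite ler_weXn2l// ltW.
have T1 : kappa * q * \sum_(coarsest W <= j < J.+1) (if Num.sqrt 2 ^+ j <= e / q then Num.sqrt 2 ^+ j else 0) <= kappa * C1 * e.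
  rewrite (le_trans (ler_wpM2l kq0 low))// le_eqVlt; apply/orP; left; apply/eqP.
  by rewrite /C1; field; rewrite ?qn ?s21n.
have T2 : 2 * M * \sum_(coarsest W <= j < J.+1) (if th ^+ j <= e then th ^+ j else 0) <= 2 * M / (1 - th) * e.
  rewrite (le_trans (ler_wpM2l _ high)) ?mulr_ge0//.
  by rewrite le_eqVlt; apply/orP; left; apply/eqP; field; rewrite gt_eqF// subr_gt0.
(* As [e / q <= 2^(J/2)], enlarging the deviations from [q] to [rr] costs at most
   [2^(J/2) rr <= g]. *)
have rq_le : e * (r / q) <= e + g.
  have : e * (q / q) = e by rewrite divff ?gt_eqF// mulr1.
  have : e * (rr / q) <= g.
    by apply: le_trans hg; rewrite mulrCA mulrC ler_wpM2r.
  rewrite hr; case: (leP q rr) => _; clear -g0 e0; lra.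
have T3 : Cb * p * \sum_(coarsest W <= j < J.+1) (1 + dl / q) <= Cb * Ce * (a + 3) * e + Cb * Ce * (a + 2) * g.
  rewrite mulr_sumr sumr_const_nat -[leLHS]mulr_natl -/Pb.
  apply: (@le_trans _ _ (J.+1%:R * Pb)); first by rewrite ler_wpM2r// ler_nat leq_subr.
  have -> : J.+1%:R * Pb = Cb * (1 + dl / q) * (J.+1%:R * p) by rewrite /Pb; ring.
  have r1 : 0 <= 1 + dl / q by rewrite addr_ge0// divr_ge0// ltW.
  rewrite (le_trans (ler_wpM2l _ hJp)) ?mulr_ge0//.
  have : e * (1 + dl / q) <= e * (1 + (a + 2) * (r / q)).
    by rewrite ler_wpM2l ?(ltW e0)// lerD2l mulrA ler_wpM2r// invr_ge0 ltW.
  have : (a + 2) * (e * (r / q)) <= (a + 2) * (e + g) by rewrite ler_wpM2l// addr_ge0.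
  move=> h1 h2; have h3 : e * (1 + dl / q) <= (a + 3) * e + (a + 2) * g by lra.
  have := ler_wpM2l (mulr_ge0 Cb0 Ce0) h3; lra.
have T4 : a * r * \sum_(coarsest W <= j < J.+1) (if good then (if Num.sqrt 2 ^+ j <= e / q then Num.sqrt 2 ^+ j else 0) else Num.sqrt 2 ^+ j) <= a * C1 * e + a * C1 / c0 * e + a * C1 * g.
  have ar0 : 0 <= a * r by rewrite mulr_ge0// ltW.
  have aC : 0 <= a * C1 by rewrite mulr_ge0.
  have X1 : 0 <= a * C1 * e by rewrite mulr_ge0// ltW.
  have X2 : 0 <= a * C1 / c0 * e by rewrite mulr_ge0 ?(ltW e0)// divr_ge0// ltW.
  have X3 : 0 <= a * C1 * g by rewrite mulr_ge0.
  case: (boolP good) => [/andP[/eqP rq _]|ng].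
    rewrite (le_trans (ler_wpM2l ar0 low))// rq.
    have -> : a * q * (Num.sqrt 2 / (Num.sqrt 2 - 1) * (e / q)) = a * C1 * e.
      by rewrite /C1; field; rewrite ?qn ?s21n.
    by lra.
  rewrite (le_trans (ler_wpM2l ar0 all))//.
  have -> : a * r * (C1 * Num.sqrt 2 ^+ J) = a * C1 * (Num.sqrt 2 ^+ J * r) by ring.
  have [rq|rq] := leP q rr.
    have -> : r = rr by rewrite hr; exact/max_idPr.
    have := ler_wpM2l aC hg; lra.
  have rq' : r = q by rewrite hr; apply/max_idPl; exact: ltW.
  have ce : c0 <= e.
    by case: hdich => // hd; move: ng; rewrite /good rq' eqxx hd.
  have s1 : Num.sqrt 2 ^+ J * r <= c0^-1 * e.
    apply: (@le_trans _ _ 1); last by rewrite mulrC ler_pdivlMr// mul1r.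
    rewrite rq' (le_trans _ hJq)// ler_wpM2r ?(ltW q0)//.
    rewrite -sqrt2X_sqr expr2 ler_peMl ?(ltW (w0 J))//.
    by rewrite exprn_ege1// ltW.
  have := ler_wpM2l aC s1; lra.
move: T1 T2 T3 T4.
set t1 := _ * bigop _ _ _; set t2 := _ * bigop _ _ _; set t3 := _ * bigop _ _ _.
set t4 := _ * bigop _ _ _; lra.
Qed.

End estimator.

(* Once [K * q `^ (sg - s')] reaches 1, [q] is bounded below and so is the rate
   [q `^ s']; this is why no condition "n large" is needed. *)
Lemma good_or_large (R : realType) (q K s' sg : R) : 0 < q -> 0 < K -> 0 < s' -> s' < sg ->
  (K * q `^ sg < q `^ s') \/ (K^-1 `^ (s' / (sg - s')) <= q `^ s').
Proof.
move=> q0 K0 s0 ssg; have [h|h] := ltP (K * q `^ sg) (q `^ s'); [by left|right].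
have d0 : 0 < sg - s' by rewrite subr_gt0.
have h1 : K^-1 <= q `^ (sg - s').
  rewrite -(ler_pM2l K0) divff ?gt_eqF// -(ler_pM2r (powR_gt0 s' q0)) mul1r -mulrA -powRD ?subrK//.
  by rewrite (gt_eqF q0) implybT.
have -> : q `^ s' = (q `^ (sg - s')) `^ (s' / (sg - s')).
  by rewrite -powRrM; congr (_ `^ _); field; rewrite gt_eqF.
rewrite ge0_ler_powR ?nnegrE ?powR_ge0 ?invr_ge0 ?(ltW K0)//.
by rewrite divr_ge0// ltW.
Qed.

(** * Measurability and deviations *)

Section union_bound.
Context d (T : measurableType d) (R : realType) (P : probability T R).

Lemma bigsetU_le (n : nat) (A : nat -> set T) (e : R) :
  (forall i, (i < n)%N -> measurable (A i)) ->
  (forall i, (i < n)%N -> (P (A i) <= e%:E)%E) ->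
  (P (\big[setU/set0]_(i < n) A i) <= (n%:R * e)%:E)%E.
Proof.
move=> mA PA; apply: (le_trans (Boole_inequality P mA)).
apply: (@le_trans _ _ (\sum_(i < n) e%:E)%E).
  by apply: lee_sum => i _; exact: PA.
by rewrite sumEFin sumr_const card_ord mulr_natl.
Qed.

Lemma union_bound (A T0 : set T) (E : nat -> nat -> set T) (D : nat -> set T)
    (J n : nat) (e : R) : 0 <= e ->
  measurable A -> measurable T0 -> P T0 = 0%E ->
  (forall j k, (j < J.+1)%N -> (k < 2 ^ j)%N -> measurable (E j k) /\ (P (E j k) <= e%:E)%E) ->
  (forall l, (l < n)%N -> measurable (D l) /\ (P (D l) <= e%:E)%E) ->
  (forall z, ~ T0 z -> (forall j k, (j < J.+1)%N -> (k < 2 ^ j)%N -> ~ E j k z) ->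
     (forall l, (l < n)%N -> ~ D l z) -> ~ A z) ->
  (P A <= ((2 * 2 ^+ J + n%:R) * e)%:E)%E.
Proof.
move=> e0 mA mT PT hE hD hA.
pose Ej j := \big[setU/set0]_(k < 2 ^ j) E j k.
have mEj j : (j < J.+1)%N -> measurable (Ej j).
  by move=> jJ; apply: bigsetU_measurable => k _; exact: (hE j k jJ (ltn_ord k)).1.
pose U1 := \big[setU/set0]_(j < J.+1) Ej j.
pose U2 := \big[setU/set0]_(l < n) D l.
have mU1 : measurable U1 by apply: bigsetU_measurable => j _; exact: mEj.
have mU2 : measurable U2 by apply: bigsetU_measurable => l _; exact: (hD l (ltn_ord l)).1.
have PU2 : (P U2 <= (n%:R * e)%:E)%E.
  by apply: bigsetU_le => l ln; case: (hD l ln).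
have PU1 : (P U1 <= (2 * 2 ^+ J * e)%:E)%E.
  apply: (le_trans (Boole_inequality P mEj)).
  apply: (@le_trans _ _ (\sum_(j < J.+1) (2 ^+ j * e)%:E)%E).
    apply: lee_sum => j _; rewrite -natrX.
    by apply: bigsetU_le => k kj; case: (hE j k (ltn_ord j) kj).
  rewrite sumEFin lee_fin -mulr_suml ler_wpM2r//.
  elim: J {hE hA mEj U1 mU1} => [|J IH]; first by rewrite big_ord_recl big_ord0; lra.
  by rewrite big_ord_recr/= [leRHS](_ : _ = 2 * 2 ^+ J + 2 ^+ J.+1) ?lerD2r//; rewrite exprS; ring.
have AU : A `<=` T0 `|` (U1 `|` U2).
  move=> z Az; apply: contrapT => /not_orP[nT /not_orP[n1 n2]].
  apply: (hA z nT) Az.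
    move=> j k jJ kj Ez; apply: n1; rewrite /U1 -bigcup_mkord; exists j => //=.
    by rewrite /Ej -bigcup_mkord; exists k.
  by move=> l ln Dz; apply: n2; rewrite /U2 -bigcup_mkord; exists l.
apply: (@le_trans _ _ (P (T0 `|` (U1 `|` U2)))).
  apply: le_measure; rewrite ?inE//; apply: measurableU => //; exact: measurableU.
apply: (le_trans (measureU2 _ _ _)) => //; first exact: measurableU.
rewrite -[leRHS]add0e; apply: leeD; first by rewrite le_eqVlt; apply/orP; left; exact/eqP.
rewrite mulrDl EFinD; apply: (le_trans (measureU2 _ _ _)) => //.
exact: leeD.
Qed.

End union_bound.

Section ecdf.
Context (R : realType).

Lemma ecdfE n (z : n.-tuple (obs R)) (x : R) :
  ecdf z x = n%:R^-1 * \sum_(i < n) ((tnth z i).1 <= x)%R%:R.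
Proof.
rewrite /ecdf; congr (_ * _); apply: eq_bigr => i _; rewrite indicE; congr (nat_of_bool _)%:R.
by apply/idP/idP; rewrite inE/= in_itv.
Qed.

Lemma ecdf_nondecreasing n (z : n.-tuple (obs R)) : {homo ecdf z : x y / x <= y}.
Proof.
move=> x y xy; rewrite !ecdfE ler_wpM2l ?invr_ge0//; apply: ler_sum => i _.
by rewrite ler_nat; case: (boolP (_ <= x)) => // h; rewrite (le_trans h xy).
Qed.

Lemma ecdf_itv n (z : n.-tuple (obs R)) x : 0 <= ecdf z x <= 1.
Proof.
rewrite ecdfE; apply/andP; split; first by rewrite mulr_ge0 ?invr_ge0// sumr_ge0.
case: n z => [|n] z; first by rewrite invr0 mul0r.
rewrite mulrC ler_pdivrMr ?ltr0n// mul1r -[X in _ <= X%:R]card_ord -sumr_const.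
by apply: ler_sum => i _; rewrite lern1 leq_b1.
Qed.

Lemma measurable_indicator_le d (T : measurableType d) (f g : T -> R) :
  measurable_fun setT f -> measurable_fun setT g ->
  measurable_fun setT (fun t => (f t <= g t)%R%:R : R).
Proof.
move=> mf mg.
rewrite (_ : (fun _ => _) = (fun t => if f t <= g t then 1 else 0)); last first.
  by apply/funext => t; case: ifP.
by apply: measurable_fun_if => //; exact: measurable_fun_ler.
Qed.

Section joint_measurability.
Context d (T : measurableType d) (n : nat) (f : T -> n.-tuple (obs R)).
Hypothesis mf : measurable_fun setT f.

Lemma measurable_obs_fst i : measurable_fun setT (fun t => (tnth (f t) i).1 : R).
Proof.
apply: (@measurableT_comp _ _ _ _ _ _ (fst : obs R -> mR R)); first exact: measurable_fst.
exact: (measurableT_comp (measurable_tnth i) mf).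
Qed.

Lemma measurable_obs_snd i : measurable_fun setT (fun t => (tnth (f t) i).2 : R).
Proof.
apply: (@measurableT_comp _ _ _ _ _ _ (snd : obs R -> mR R)); first exact: measurable_snd.
exact: (measurableT_comp (measurable_tnth i) mf).
Qed.

(** The sample [f] may vary: a constant [f] gives measurability in the point, and the projections
    from pairs give joint measurability in the sample and the point. *)
Lemma measurable_ecdf (g : T -> R) : measurable_fun setT g ->
  measurable_fun setT (fun t => ecdf (f t) (g t)).
Proof.
move=> mg; under eq_fun do rewrite ecdfE.
apply: measurable_funM => //; apply: measurable_sum => i.
by apply: measurable_indicator_le => //; exact: measurable_obs_fst.
Qed.

Variables (W : wavelet_system R) (B : R).
Hypotheses (B1 : 1 <= B) (WB : wav_bounds W B).

Lemma measurable_beta_hat j k : (k < 2 ^ j)%N ->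
  measurable_fun setT (fun t => beta_hat W (f t) j k).
Proof.
move=> kj; rewrite /beta_hat; apply: measurable_funM => //.
apply: measurable_sum => i; apply: measurable_funM; first exact: measurable_obs_snd.
apply: (measurableT_comp (measurable_wav B1 WB kj)).
by apply: measurable_ecdf; exact: measurable_obs_fst.
Qed.

Lemma measurable_beta_tilde kappa j k : (k < 2 ^ j)%N ->
  measurable_fun setT (fun t => beta_tilde W kappa (f t) j k).
Proof.
move=> kj; rewrite /beta_tilde; apply: measurable_fun_if => //.
- apply: measurable_fun_ler => //; apply: measurableT_comp => //.
  exact: measurable_beta_hat.
- by apply: measurable_funTS; exact: measurable_beta_hat.
Qed.

Lemma measurable_f_hat kappa J (g : T -> R) : measurable_fun setT g ->
  measurable_fun setT (fun t => f_hat W kappa J (f t) (g t)).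
Proof.
move=> mg; rewrite /f_hat.
rewrite (_ : (fun _ => _) = (fun t => \sum_(coarsest W <= j < J.+1) \sum_(0 <= k < 2 ^ j)
    if (k < 2 ^ j)%N then beta_tilde W kappa (f t) j k * wav W j k (ecdf (f t) (g t)) else 0)).
  apply: measurable_sum => j; apply: measurable_sum => k.
  have [kj|kj] := ltnP k (2 ^ j); last exact: measurable_cst.
  apply: measurable_funM; first exact: measurable_beta_tilde.
  by apply: (measurableT_comp (measurable_wav B1 WB kj)); exact: measurable_ecdf.
apply/funext => t; apply: eq_bigr => j _; rewrite !big_nat.
by apply: eq_bigr => k /andP[_ ->].
Qed.
End joint_measurability.

Lemma measurable_loss_event (W : wavelet_system R) (B kappa eta : R) (J n : nat)
    (rho : probability (obs R) R) (f : R -> R) : 1 <= B -> wav_bounds W B ->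
  measurable_fun setT (f : mR R -> R) ->
  measurable [set z : n.-tuple (obs R) |
    (eta%:E < loss rho (fun x => f x - f_hat W kappa J z x)%R)%E].
Proof.
move=> B1 WB mf; pose mu := marginalX rho.
pose g (zx : n.-tuple (obs R) * mR R) := (`|(f zx.2 - f_hat W kappa J zx.1 zx.2)%:E| `^ 2)%E.
have mg : measurable_fun setT g.
  apply: (measurableT_comp (measurable_poweR _)); apply: measurableT_comp => //.
  apply/measurable_EFinP; apply: measurable_funB.
    by apply: (measurableT_comp mf); exact: measurable_snd.
  by apply: (measurable_f_hat _ B1 WB); [exact: measurable_fst|exact: measurable_snd].
have mI : measurable_fun setT (fun z => (\int[mu]_x g (z, x))%E).
  apply: (@measurable_fun_fubini_tonelli_F _ _ _ _ _ mu g) => //.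
  by move=> zx; exact: poweR_ge0.
have mL : measurable_fun setT (fun z : n.-tuple (obs R) => loss rho (fun x => f x - f_hat W kappa J z x)%R).
  rewrite /loss unlock.
  exact: (measurableT_comp (measurable_poweR _) mI).
by have := emeasurable_fun_o_infty measurableT mL eta%:E; rewrite setTI.
Qed.

Lemma loss_le (rho : probability (obs R) R) (g : R -> R) (e : R) : 0 <= e ->
  measurable_fun setT (g : mR R -> R) ->
  {ae marginalX rho, forall x : mR R, `|g x| <= e} -> (loss rho g <= e%:E)%E.
Proof.
move=> e0 mg ge; rewrite /loss unlock.
have h : (\int[marginalX rho]_x (`|(EFin \o g) x| `^ 2) <= (e ^+ 2)%:E)%E.
  have -> : (\int[marginalX rho]_x (`|(EFin \o g) x| `^ 2) =
      \int[marginalX rho]_x ((`|g x| `^ 2)%R)%:E)%E.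
    by apply: eq_integral.
  apply: ae_bounded_integral_le.
  - exact: sqr_ge0.
  - by apply: (measurableT_comp (measurable_powR _)); exact: measurableT_comp.
  - by move=> x; exact: powR_ge0.
  - move: ge; apply: filterS => x xe.
    by rewrite (powR_mulrn 2)// ler_pXn2r ?nnegrE.
have -> : e%:E = ((e ^+ 2)%:E `^ 2^-1)%E.
  by rewrite poweR_EFin powR12_sqrt ?sqr_ge0// sqrtr_sqr ger0_norm.
apply: gt0_ler_poweR => //.
- rewrite in_itv/= leey andbT; apply: integral_ge0 => x _ /=.
  by rewrite lee_fin powR_ge0.
- by rewrite in_itv/= leey andbT lee_fin sqr_ge0.
Qed.

End ecdf.

Section deviations.
Context (R : realType) (X : set R) (M : R) (rho : probability (obs R) R).
Hypotheses (cX : compact X) (rhoM : model X M rho).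
Let G := distr_fun rho.
Let Q := quantile rho.

(** Both functions are nondecreasing, so between consecutive grid quantiles they are squeezed
    between values of [G] that differ by [1 / n]. At the two ends the bounds 0 and 1 replace the
    quantiles. *)
Lemma ecdf_uniform n (z : n.-tuple (obs R)) (t : R) : (0 < n)%N -> 0 <= t ->
  (forall l, (0 < l < n)%N -> `|ecdf z (Q (l%:R / n%:R)) - l%:R / n%:R| <= t) ->
  forall x, `|ecdf z x - G x| <= t + n%:R^-1.
Proof.
move=> n0 t0 ht x; have nR0 : 0 < n%:R :> R by rewrite ltr0n.
have G0 := distr_fun_ge0 rho x; have G1 := distr_fun_le1 rho x.
pose l := Num.truncn (n%:R * G x).
have /andP[l1 l2] : l%:R <= n%:R * G x < l.+1%:R by apply: truncn_itv; rewrite mulr_ge0.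
have /andP[F0 F1] := ecdf_itv z x.
have nV : n%:R * n%:R^-1 = 1 :> R by rewrite divff ?gt_eqF.
have nV0 : 0 < n%:R^-1 :> R by rewrite invr_gt0.
have lE (m : nat) : n%:R * (m%:R / n%:R) = m%:R :> R by rewrite mulrCA nV mulr1.
have u01 (m : nat) : (0 < m < n)%N -> 0 < (m%:R / n%:R : R) <= 1.
  move=> /andP[m0 mn]; rewrite divr_gt0 ?ltr0n//= ler_pdivrMr// mul1r ler_nat ltnW//.
have below (m : nat) : (0 < m < n)%N -> m%:R <= n%:R * G x -> m%:R / n%:R - t <= ecdf z x.
  move=> mn mG; have := ht m mn; rewrite ler_norml => /andP[h _].
  have : ecdf z (Q (m%:R / n%:R)) <= ecdf z x.
    apply: ecdf_nondecreasing; rewrite (quantile_le cX rhoM)// ?u01//.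
    by rewrite ler_pdivrMr// mulrC.
  by lra.
have lo : n%:R * G x - 1 - n%:R * t <= n%:R * ecdf z x.
  have nt : 0 <= n%:R * t by rewrite mulr_ge0.
  have nF : 0 <= n%:R * ecdf z x by rewrite mulr_ge0.
  have [l0|l0] := posnP l; first by move: l2; rewrite l0; lra.
  have nG : n%:R * G x <= n%:R by rewrite ler_piMr.
  have [ln|ln] := ltnP l n.
    have := ler_wpM2l (ltW nR0) (below l _ l1); rewrite l0 ln => /(_ isT).
    by rewrite mulrBr lE; move: l2; rewrite -natr1; lra.
  (* Now [l >= n], hence [G x = 1]. The grid stops at [n - 1], and falling back on that quantile
     costs exactly the [1 / n] allowed; for [n = 1] the bound is trivial. *)
  have [n1|n1] := leqP n 1.
    have : n%:R <= 1 :> R by rewrite lern1.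
    by lra.
  have mn : (0 < n.-1 < n)%N by rewrite -subn1 subn_gt0 n1/= subn1 prednK.
  have n1E : n.-1%:R + 1 = n%:R :> R by rewrite natr1 prednK.
  have lnR : n%:R <= l%:R :> R by rewrite ler_nat.
  have := ler_wpM2l (ltW nR0) (below n.-1 mn _); rewrite mulrBr lE.
  by move=> /(_ _) h; have := h ltac:(lra); lra.
have hi : n%:R * ecdf z x <= n%:R * G x + 1 + n%:R * t.
  have nt : 0 <= n%:R * t by rewrite mulr_ge0.
  have nF : n%:R * ecdf z x <= n%:R by rewrite ler_piMr.
  have [ln|ln] := ltnP l.+1 n; last first.
    have : n%:R <= l.+1%:R :> R by rewrite ler_nat.
    by rewrite -natr1; lra.
  have := ht l.+1 ln; rewrite ler_norml => /andP[_ h].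
  have : ecdf z x <= ecdf z (Q (l.+1%:R / n%:R)).
    apply: ecdf_nondecreasing; rewrite ltW// ltNge (quantile_le cX rhoM) ?u01//.
    by rewrite -ltNge ltr_pdivlMr// mulrC.
  move=> h'; have h3 : ecdf z x <= t + l.+1%:R / n%:R.
    by move: h h'; set v := (_ / _); lra.
  have := ler_wpM2l (ltW nR0) h3; rewrite mulrDr lE -natr1; lra.
rewrite ler_norml; apply/andP; split.
  rewrite -(ler_pM2l nR0) mulrN mulrDr nV mulrBr; lra.
rewrite -(ler_pM2l nR0) [leRHS]mulrDr nV mulrBr; lra.
Qed.

(** A Hoeffding bound, as the case of trivial conditioning: [p] is constant, the conditional
    expectation is the constant [G c] and all weights are 1. *)
Lemma grid_tail n (c y : R) : (0 < n)%N -> 0 <= y ->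
  let D := [set z : n.-tuple (obs R) |
    (y < `|\sum_(i < n) (((tnth z i).1 <= c)%R%:R - G c)|)%R] in
  measurable D /\
  (iid_law rho n D <= (2 * expR (- (y ^+ 2 / (32 * n%:R))))%:E)%E.
Proof.
move=> n0 y0 D.
pose V (z : obs R) : R := (z.1 <= c)%R%:R.
have mV : measurable_fun setT V.
  by apply: measurable_indicator_le => //; exact: measurable_fst.
have V1 z : `|V z| <= 1 by rewrite /V ger0_norm// lern1 leq_b1.
have EV : (\int[rho]_z (V z)%:E = (G c)%:E)%E.
  rewrite -distr_funE /marginalX /distribution /pushforward.
  transitivity (\int[rho]_z (\1_((fst : obs R -> mR R) @^-1` `]-oo, c]%classic) z)%:E)%E.
    apply: eq_integral => z _; congr EFin; rewrite indicE /V; congr (nat_of_bool _)%:R.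
    by apply/idP/idP; rewrite inE/= in_itv.
  rewrite integral_indic ?setIT//.
  by rewrite -[X in measurable X]setTI; apply: measurable_fst => //; exact: measurable_itv.
have [] := @conditional_tail_abs _ (obs R) _ (mR R) R rho (cst 0) V (cst (G c)) 1
  (measurable_cst _) mV (measurable_cst _) (aeW _ V1) _ _ n (fun _ _ => 1) setT 1 n%:R y.
- by apply: aeW => z /=; rewrite ger0_norm ?distr_fun_ge0// distr_fun_le1.
- move=> u _ _ /=.
  transitivity ((u 0)%:E * \int[rho]_z (V z)%:E)%E.
    rewrite -integralZl//; last by apply: (@ae_bounded_integrable _ _ _ _ _ 1) => //; exact: aeW.
    by apply: eq_integral => z _; rewrite -EFinM mulrC.
  have cI (c0 : R) : (\int[rho]_z c0%:E = c0%:E)%E.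
    by rewrite integral_cst//; apply: etrans (mule1 _); congr (_ * _)%E; exact: probability_setT.
  by rewrite EV -EFinM mulrC; exact: (esym (cI _)).
- by move=> i; exact: measurable_cst.
- exact: measurableT.
- by move=> i t; rewrite normr1.
- by [].
- by rewrite ltr0n.
- by [].
- by move=> t _; rewrite (eq_bigr (fun=> 1)) ?sumr_const ?card_ord// => i _; rewrite expr1n.
rewrite (_ : [set z | _] = D) ?expr1n ?mulr1//.
apply/seteqP; split => z; rewrite /D/=.
  by move=> [_]; under eq_bigr do rewrite mul1r.
by move=> h; split => //; under eq_bigr do rewrite mul1r.
Qed.

Section wavelet_tail.
Variables (W : wavelet_system R) (N B : R).
Hypotheses (WN : is_wavelet_basis W N) (B1 : 1 <= B) (WB : wav_bounds W B).
Variable F : R -> R.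
Hypotheses (M0 : 0 < M) (mF : measurable_fun setT (F : mR R -> R))
  (Fb : {ae marginalX rho, forall x : mR R, `|F x| <= M / 2})
  (FE : forall u : mR R -> R, measurable_fun setT u ->
    (exists K : R, forall x, `|u x| <= K) ->
    (\int[rho]_z (z.2 * u z.1)%:E = \int[rho]_z (F z.1 * u z.1)%:E)%E).

(** The weights are functions of the [X_i] alone, and without ties [rank_sum] makes the sum of their
    squares a grid sum. [F] is any function with the conditional expectation property, to be
    instantiated by [ht] composed with [G]. *)
Lemma wavelet_tail n j k (y : R) : (0 < n)%N -> 2 ^+ j <= n%:R :> R ->
  (coarsest W <= j)%N -> (k < 2 ^ j)%N -> 0 <= y ->
  let E := [set z : n.-tuple (obs R) | injective (fun i => (tnth z i).1) /\
    (y < `|\sum_(i < n) wav W j k (ecdf z (tnth z i).1) *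
        ((tnth z i).2 - F (tnth z i).1)|)%R] in
  measurable E /\
  (iid_law rho n E <=
   (2 * expR (- (y ^+ 2 / (32 * (M / 2) ^+ 2 * (B ^+ 2 * (`|N| + 1) * n%:R)))))%:E)%E.
Proof.
move=> n0 jn Wj kj y0 E.
pose w (i : 'I_n) (t : n.-tuple (mR R)) : R :=
  wav W j k (n%:R^-1 * \sum_(i' < n) (tnth t i' <= tnth t i)%R%:R).
have B0 : 0 < B := lt_le_trans ltr01 B1.
have [] := @conditional_tail_abs _ (obs R) _ (mR R) R rho fst snd F (M / 2)
  measurable_fst measurable_snd mF (response_bounded cX rhoM) (marginal_ae Fb) FE n w
  [set t | injective (tnth t)] (B * Num.sqrt 2 ^+ j) (B ^+ 2 * (`|N| + 1) * n%:R) y.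
- move=> i; apply: (measurableT_comp (measurable_wav B1 WB kj)).
  apply: measurable_funM => //; apply: measurable_sum => i'.
  by apply: measurable_indicator_le; exact: measurable_tnth.
- exact: measurable_injective_tuple.
- by move=> i t; case: WB => wb _ _; exact: wb.
- by rewrite divr_gt0.
- by rewrite !mulr_gt0 ?ltr0n// ?exprn_gt0// ltr_wpDl.
- by [].
- move=> t ti; rewrite (rank_sum (fun u => wav W j k u ^+ 2) ti).
  exact: (wav_grid_sqr WN B1 WB).
have wE (z : n.-tuple (obs R)) i : w i (tmap fst z) = wav W j k (ecdf z (tnth z i).1).
  rewrite /w ecdfE; congr (wav _ _ _ (_ * _)).
  by apply: eq_bigr => i' _; rewrite !tnth_map.
have injE (z : n.-tuple (obs R)) : injective (tnth (tmap (fst : obs R -> mR R) z)) <->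
    injective (fun i => (tnth z i).1).
  by split=> h i i' hh; apply: h; move: hh; rewrite ?tnth_map.
rewrite (_ : [set z | _] = E)//.
apply/seteqP; split => z; rewrite /E/=.
  by move=> [/injE ? h]; split => //; move: h; under eq_bigr do rewrite wE.
by move=> [? h]; split; [exact/injE|under eq_bigr do rewrite wE].
Qed.

Lemma ties_null n : let T0 := [set z : n.-tuple (obs R) | ~ injective (fun i => (tnth z i).1)] in
  measurable T0 /\ iid_law rho n T0 = 0%E.
Proof.
have p0 c : rho [set z | (fst : obs R -> mR R) z = c] = 0%E by exact: (marginal_atomless rhoM c).
have injE (z : n.-tuple (obs R)) : injective (tnth (tmap (fst : obs R -> mR R) z)) <->
    injective (fun i => (tnth z i).1).
  by split=> h i i' hh; apply: h; move: hh; rewrite ?tnth_map.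
have <- : @tied _ (obs R) R fst n = [set z : n.-tuple (obs R) | ~ injective (fun i => (tnth z i).1)].
  by apply/seteqP; split => z h hh; apply: h; exact/injE.
split; first by apply: measurable_tied; exact: measurable_fst.
by apply: tied_null => //; exact: measurable_fst.
Qed.
End wavelet_tail.

End deviations.

(** * The regression function as a function of [G] *)

Section representation.
Context (R : realType) (X : set R) (M : R) (rho : probability (obs R) R).
Hypotheses (cX : compact X) (M0 : 0 < M) (rhoM : model X M rho).
Let mu := marginalX rho.
Let G := distr_fun rho.
Let Q := quantile rho.
Notation leb := (@lebesgue_measure R).

(** Null sets are carried by [quantile_pushforward]. The point 0 joins the exceptional set because
    [Q 0] is a default value. *)
Lemma quantile_ae (S : R -> Prop) : {ae mu, forall x : mR R, S x} ->
  {ae leb, forall u : mR R, `[0%R, 1%R]%classic u -> S (Q u)}.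
Proof.
move=> [A [mA A0 SA]]; have [Qc mQc QcE] := quantile_measurable cX rhoM.
exists ((`]0, 1]%classic `&` Qc @^-1` A) `|` [set 0]); split.
- apply: measurableU; last exact: measurable_set1.
  apply: measurableI; first exact: measurable_itv.
  by rewrite -[X in measurable X]setTI; exact: mQc.
- apply/eqP; rewrite eq_le measure_ge0 andbT.
  apply: (le_trans (measureU2 _ _ _)).
  + apply: measurableI; first exact: measurable_itv.
    by rewrite -[X in measurable X]setTI; exact: mQc.
  + exact: measurable_set1.
  rewrite -[leRHS]adde0; apply: leeD; last first.
    by rewrite le_eqVlt; apply/orP; left; apply/eqP; exact: lebesgue_measure_set1.
  rewrite le_eqVlt; apply/orP; left; apply/eqP.
  exact: etrans (esym (quantile_pushforward cX rhoM mQc QcE mA)) A0.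
move=> u /= hu; have [->|u0] := eqVneq u 0; [by right|left].
have : `[0%R, 1%R]%classic u /\ ~ S (Q u) by apply/not_implyP.
rewrite /= !in_itv/= => -[/andP[u0' u1] hS].
have u01 : 0 < u <= 1 by rewrite lt_neqAle eq_sym u0 u0' u1.
by split => //; apply: SA => /=; rewrite QcE.
Qed.

Lemma quantile_ae_inv (S : R -> Prop) : measurable [set x : mR R | ~ S x] ->
  {ae leb, forall u : mR R, `[0%R, 1%R]%classic u -> S (Q u)} ->
  {ae mu, forall x : mR R, S x}.
Proof.
move=> mS hS; have [Qc mQc QcE] := quantile_measurable cX rhoM.
exists [set x | ~ S x]; split => //.
apply: etrans (quantile_pushforward cX rhoM mQc QcE mS) _.
apply: measure_negligible.
  apply: measurableI; first exact: measurable_itv.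
  by rewrite -[X in measurable X]setTI; exact: mQc.
apply: negligibleS hS => u /= [u01 hu] h; apply: hu; move: u01; rewrite in_itv/= => /andP[u0 u1].
have u01 : 0 < u <= 1 by rewrite u0.
by rewrite QcE//; apply: h; rewrite /= in_itv/= (ltW u0).
Qed.

Variables (W : wavelet_system R) (N B s : R).
Hypotheses (WN : is_wavelet_basis W N) (B1 : 1 <= B) (WB : wav_bounds W B) (s0 : 0 < s).
Let th : R := 2 `^ (- s).

Lemma besov_coef (h : R -> R) j k : (besov_norm W s h <= M%:E)%E ->
  (coarsest W <= j)%N -> (k < 2 ^ j)%N ->
  `|wcoef W h j k| <= M * th ^+ j / Num.sqrt 2 ^+ j.
Proof.
move=> hM Wj kj.
have : ((2 `^ (j%:R * (s + 2^-1)) * `|wcoef W h j k|)%:E <= M%:E)%E.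
  by apply: le_trans hM; apply: ereal_sup_ubound; exists j, k.
rewrite lee_fin mulrDr powRD ?pnatr_eq0 ?implybT// dilate_expE.
have -> : 2 `^ (j%:R * s) = (th ^+ j)^-1.
  by rewrite /th -(powR_mulrn j (powR_ge0 2 (- s))) -powRrM -powRN; congr (_ `^ _); ring.
have w0 : 0 < (Num.sqrt 2 : R) ^+ j by rewrite exprn_gt0// sqrtr_gt0.
have t0 : 0 < th ^+ j by rewrite exprn_gt0// powR_gt0.
move=> hle; rewrite ler_pdivlMr// -[leRHS]mulrC -ler_pdivrMl//.
by apply: le_trans hle; rewrite le_eqVlt; apply/orP; left; apply/eqP; ring.
Qed.

Let C := B ^+ 2 * M / (1 - th).

(** [ht] is the limit of the wavelet series of [f2 \o Q], for the version [f2] given by [Mclass].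
    Since [G (Q u) = u], [f2] and [ht \o G] agree at [Q u] for almost every [u], hence almost
    everywhere for the law of [X]; uniqueness passes from [f2] to [f]. The bounds on [ht] hold
    everywhere, so they can be used at values of the empirical distribution function. *)
Lemma regression_representation (f : R -> R) : Mclass X M W s rho ->
  is_regression_function rho f ->
  exists ht : R -> R, let be j k := \int[leb]_(u in `[0, 1]) (ht u * wav W j k u) in
  [/\ measurable_fun setT ht /\ forall u, `|ht u| <= C,
    forall sg q u v : R, 0 < sg <= 1 -> sg < s -> 0 < q ->
      `|ht u - ht v| <= 2 * B ^+ 2 * M / (1 - 2 `^ (sg - s)) * (q `^ sg * (1 + `|u - v| / q)),
    forall j k, (coarsest W <= j)%N -> (k < 2 ^ j)%N ->
      `|be j k| <= M * th ^+ j / Num.sqrt 2 ^+ j,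
    forall J u, (coarsest W <= J)%N ->
      `|ht u - \sum_(coarsest W <= j < J) \sum_(0 <= k < 2 ^ j) be j k * wav W j k u| <= C * th ^+ J &
    {ae mu, forall x : mR R, f x = ht (G x)}].
Proof.
move=> [_ [f2 hf2 hB]] hf; pose h := f2 \o Q.
have coef j k : (coarsest W <= j)%N -> (k < 2 ^ j)%N ->
    `|wcoef W h j k| <= M * th ^+ j / Num.sqrt 2 ^+ j by move=> Wj kj; exact: besov_coef.
have mf2 : measurable_fun setT (f2 : mR R -> R) := measurable_regression hf2.
have [Qc mQc QcE] := quantile_measurable cX rhoM.
have mh : measurable_fun (`[0%R, 1%R]%classic : set R) h.
  apply/measurable_fun_itv_obnd_cbndP.
  apply: (@eq_measurable_fun _ _ _ _ _ (f2 \o Qc)).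
    by move=> u; rewrite inE/= in_itv/= => u01; rewrite /h /= QcE.
  by apply: measurable_funTS; exact: (measurableT_comp mf2 mQc).
have h2 : (\int[leb]_(x in `[0%R, 1%R]) ((h x) ^+ 2)%:E < +oo)%E.
  apply: (@le_lt_trans _ _ (\int[leb]_(x in `[0%R, 1%R]) (cst ((M / 2) ^+ 2)%:E x))%E); last first.
    rewrite integral_cst//.
    have l1 : leb `[0%R, 1%R]%classic = 1%E.
      by rewrite lebesgue_measure_itv/= lte_fin ltr01 oppr0 addr0.
    rewrite (_ : (_ * _)%E = ((M / 2) ^+ 2)%:E) ?ltry//.
    by apply: etrans (mule1 _); congr (_ * _)%E; exact: l1.
  apply: ae_ge0_le_integral => //.
  - by move=> x _; rewrite lee_fin sqr_ge0.
  - by apply/measurable_EFinP; exact: measurable_funX.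
  - by move=> x _; rewrite /= lee_fin sqr_ge0.
  - have := quantile_ae (regression_bounded cX M0 rhoM hf2).
    apply: filterS => u hu u01; rewrite /= lee_fin /h /= -real_normK ?num_real//.
    by rewrite ler_pXn2r ?nnegrE ?hu// divr_ge0// ltW.
have htE : {ae leb, forall x : mR R, `[0%R, 1%R]%classic x -> h x = wlimit W h x}.
  exact: (wlimit_ae WN B1 WB M0 s0 coef mh h2).
pose ht := wlimit W h.
have beE j k : (k < 2 ^ j)%N -> \int[leb]_(u in `[0, 1]) (ht u * wav W j k u) = wcoef W h j k.
  by move=> kj; rewrite (wcoef_wlimit WN B1 WB M0 s0 coef mh h2 kj).
have mht : measurable_fun setT ht := measurable_wlimit B1 WB M0 s0 coef.
have mhtG : measurable_fun setT (fun x : mR R => ht (G x)).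
  by apply: (measurableT_comp mht); exact: (measurable_distr_fun rhoM).
exists ht => be; split.
- by split => // u; exact: (wlimit_bounded B1 WB M0 s0 coef).
- by move=> sg q u v h1 h2' h3; exact: (wlimit_modulus B1 WB M0 s0 coef).
- by move=> j k Wj kj; rewrite /be beE//; exact: coef.
- move=> J u WJ; rewrite (eq_big_nat _ _ (F2 := fun j => \sum_(0 <= k < 2 ^ j) wcoef W h j k * wav W j k u)).
    exact: (wlimit_tail B1 WB M0 s0 coef).
  move=> j _; apply: eq_big_nat => k /andP[_ kj].
  by rewrite /be beE.
have f2E : {ae mu, forall x : mR R, f2 x = ht (G x)}.
  apply: quantile_ae_inv.
    have := @measurable_fun_eqr _ _ R setT _ _ mf2 mhtG.
    move=> /(_ measurableT [set false] I); rewrite setTI.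
    rewrite (_ : _ @^-1` _ = [set x | f2 x <> ht (G x)])//.
    by apply/seteqP; split => x /= => [/negbT/eqP|/eqP/negbTE].
  have q0 : {ae leb, forall u : mR R, u <> 0}.
    exists [set 0]; split; [exact: measurable_set1|by rewrite lebesgue_measure_set1|].
    by move=> u /= /contrapT.
  move: htE q0; apply: filterS2 => u hu u0 u01; move: (hu u01); rewrite /h /= => ->.
  rewrite /G (distr_fun_quantile cX rhoM)//; move: u01; rewrite /= in_itv/= => /andP[h0 ->].
  by rewrite andbT lt_neqAle h0 andbT eq_sym; exact/eqP.
move: f2E (regression_ae_unique hf hf2).
by apply: filterS2 => x /= <- ->.
Qed.

End representation.

(** * The error bound outside the exceptional events *)

Section good_event.
Context (R : realType) (X : set R) (M : R) (rho : probability (obs R) R).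
Hypotheses (cX : compact X) (M0 : 0 < M) (rhoM : model X M rho).
Let G := distr_fun rho.
Let Q := quantile rho.
Notation leb := (@lebesgue_measure R).
Variables (W : wavelet_system R) (N B s kappa a sg : R).
Hypotheses (WN : is_wavelet_basis W N) (B1 : 1 <= B) (WB : wav_bounds W B)
  (s2 : 2^-1 < s) (sg1 : 0 < sg <= 1) (sgs : sg < s) (sgl : 2 * s / (1 + 2 * s) < sg)
  (a0 : 0 <= a) (hkap : M + a + 1 <= kappa).

Let th : R := 2 `^ (- s).
Let s' : R := 2 * s / (1 + 2 * s).
Let C := B ^+ 2 * M / (1 - th).
Let H := 2 * B ^+ 2 * M / (1 - 2 `^ (sg - s)).
Let Cb := B * (`|N| + 2) * (4 * H + 2 * C).
Let Ce := (1 - 2 `^ (s' - sg))^-1.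
Let c0 := (Cb * (a + 3))^-1 `^ (s' / (sg - s')).
Let C1 : R := Num.sqrt 2 / (Num.sqrt 2 - 1).

(** The factor of the rate: the first summand comes from evaluating [ht] at the empirical
    distribution function instead of [G], [C] from the levels above [J], the rest from
    [estimator_sup]. [dev_const] likewise collects the terms in [g]. *)
Definition rate_const := H * Ce * (a + 3) + C +
  B ^+ 2 * (kappa * C1 + 2 * M / (1 - th) + Cb * Ce * (a + 3) + a * C1 + a * C1 / c0).
Definition dev_const := H * Ce * (a + 2) + B ^+ 2 * (Cb * Ce * (a + 2) + a * C1).

Let s0 : 0 < s. Proof. by move: s2; lra. Qed.

Let pow2_lt1 (t : R) : t < 0 -> 2 `^ t < 1 :> R.
Proof.
move=> t0; rewrite -[ltRHS](powRr0 (2 : R)) /powR pnatr_eq0/= ltr_expR mul0r nmulr_rlt0//.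
by rewrite ln_gt0// ltr1n.
Qed.

Let th01 : 0 < th < 1.
Proof. by rewrite powR_gt0//= pow2_lt1// oppr_lt0. Qed.

Let B20 : 0 < B ^+ 2. Proof. by rewrite exprn_gt0// (lt_le_trans ltr01 B1). Qed.

Let C0 : 0 < C.
Proof.
apply: divr_gt0; first exact: mulr_gt0.
by rewrite subr_gt0; case/andP: th01.
Qed.
Let H0 : 0 < H.
Proof.
apply: divr_gt0; first by apply: mulr_gt0 => //; exact: mulr_gt0.
by rewrite subr_gt0 pow2_lt1// subr_lt0.
Qed.
Let Ce0 : 0 < Ce.
Proof. by rewrite invr_gt0 subr_gt0 pow2_lt1// subr_lt0. Qed.
Let Cb0 : 0 < Cb.
Proof.
rewrite mulr_gt0//.
  by rewrite mulr_gt0 ?(lt_le_trans ltr01 B1)// ltr_wpDl.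
by apply: addr_gt0; exact: mulr_gt0.
Qed.
Let c00 : 0 < c0.
Proof. by rewrite powR_gt0// invr_gt0; apply: mulr_gt0 => //; rewrite ltr_wpDl. Qed.
Let C10 : 0 < C1.
Proof.
apply: divr_gt0; first by rewrite sqrtr_gt0.
by rewrite subr_gt0 -[ltLHS]sqrtr1 ltr_sqrt// ltr1n.
Qed.
Let s'0 : 0 < s'.
Proof. by rewrite divr_gt0//; move: s2; lra. Qed.

Lemma rate_const_ge0 : 0 <= rate_const.
Proof.
have th1 : 0 < 1 - th by rewrite subr_gt0; case/andP: th01.
have a3 : 0 <= a + 3 by rewrite addr_ge0.
have kap : 0 <= kappa by move: a0 hkap M0; lra.
rewrite /rate_const; apply: addr_ge0.
  by apply: addr_ge0; [apply: mulr_ge0 => //; apply: mulr_ge0; exact: ltW|exact: ltW].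
apply: mulr_ge0; first exact: ltW.
apply: addr_ge0; last by apply: divr_ge0; [apply: mulr_ge0 => //; exact: ltW|exact: ltW].
apply: addr_ge0; last by apply: mulr_ge0 => //; exact: ltW.
apply: addr_ge0; last by apply: mulr_ge0 => //; apply: mulr_ge0; exact: ltW.
apply: addr_ge0; first by apply: mulr_ge0 => //; exact: ltW.
by apply: divr_ge0; [apply: mulr_ge0 => //; exact: ltW|exact: ltW].
Qed.

Lemma dev_const_ge0 : 0 <= dev_const.
Proof.
have a3 : 0 <= a + 2 by rewrite addr_ge0.
rewrite /dev_const; apply: addr_ge0.
  by apply: mulr_ge0 => //; apply: mulr_ge0; exact: ltW.
apply: mulr_ge0; first exact: ltW.
apply: addr_ge0; last by apply: mulr_ge0 => //; exact: ltW.
by apply: mulr_ge0 => //; apply: mulr_ge0; exact: ltW.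
Qed.

Variables (n J : nat) (rr g : R).
Hypotheses (n2 : (2 <= n)%N)
  (Jlow : (n%:R / ln n%:R) `^ (1 + 2 * s)^-1 <= (2 : R) ^+ J)
  (Jhigh : (2 : R) ^+ J <= (n%:R / ln n%:R) `^ 2^-1)
  (rr0 : 0 <= rr) (hg : Num.sqrt 2 ^+ J * rr <= g).
Let q : R := Num.sqrt (ln n%:R / n%:R).
Let e : R := rate s n.
Let r := Num.max q rr.

Variable ht : R -> R.
Let be j k := \int[leb]_(u in `[0, 1]) (ht u * wav W j k u).
Hypotheses (mht : measurable_fun setT ht) (htb : forall u, `|ht u| <= C)
  (htm : forall sg q u v : R, 0 < sg <= 1 -> sg < s -> 0 < q ->
      `|ht u - ht v| <= 2 * B ^+ 2 * M / (1 - 2 `^ (sg - s)) * (q `^ sg * (1 + `|u - v| / q)))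
  (htc : forall j k, (coarsest W <= j)%N -> (k < 2 ^ j)%N ->
      `|be j k| <= M * th ^+ j / Num.sqrt 2 ^+ j)
  (htt : forall J u, (coarsest W <= J)%N ->
      `|ht u - \sum_(coarsest W <= j < J) \sum_(0 <= k < 2 ^ j) be j k * wav W j k u| <= C * th ^+ J).

Lemma tail_at_level u :
  `|ht u - \sum_(coarsest W <= j < J.+1) \sum_(0 <= k < 2 ^ j) be j k * wav W j k u| <= C * e.
Proof.
have the : th ^+ J <= e by apply: (high_level_le s2 n2); exact: cutoff_le_level.
have t0 : 0 <= th by case/andP: th01 => /ltW.
have t1 : th <= 1 by case/andP: th01 => _ /ltW.
have [WJ|WJ] := leqP (coarsest W) J.+1.
  apply: (le_trans (htt u WJ)); rewrite ler_wpM2l ?(ltW C0)// (le_trans _ the)//.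
  by rewrite ler_wiXn2l.
(* If [J.+1] is below the coarsest level, the sum is empty, and the tail bound at the coarsest level
   is even smaller because [th <= 1]. *)
rewrite big_geq 1?ltnW// subr0.
have := htt u (leqnn (coarsest W)); rewrite big_geq// subr0 => /le_trans; apply.
rewrite ler_wpM2l ?(ltW C0)// (le_trans _ the)// ler_wiXn2l//.
by rewrite ltnW// ltnW.
Qed.

(** Purely deterministic. [f_hat] is a wavelet series at the point [ecdf z x], so the error splits
    into moving [ht] from [G x] to this point, truncating its series there, and thresholding its
    coefficients. *)
Lemma good_event (z : n.-tuple (obs R)) (x : R) :
  injective (fun i => (tnth z i).1) ->
  (forall j k, (coarsest W <= j <= J)%N -> (k < 2 ^ j)%N ->
    `|\sum_(i < n) wav W j k (ecdf z (tnth z i).1) *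
        ((tnth z i).2 - ht (G (tnth z i).1))| <= n%:R * (a * r)) ->
  (forall l, (0 < l < n)%N ->
    `|\sum_(i < n) (((tnth z i).1 <= Q (l%:R / n%:R))%R%:R - G (Q (l%:R / n%:R)))| <= n%:R * (a * r)) ->
  `|ht (G x) - f_hat W kappa J z x| <= rate_const * e + dev_const * g.
Proof.
move=> zinj hE hD.
have n0 : (0 < n)%N by exact: leq_trans n2.
have nR0 : 0 < n%:R :> R by rewrite ltr0n.
have q0 : 0 < q := noise_gt0 R n2.
have q1 : q <= 1 := noise_le1 R n2.
have e0 : 0 < e := rate_gt0 s n2.
have nq : n%:R^-1 <= 2 * q ^+ 2 := invn_le_noise R n2.
have r0 : 0 < r by rewrite lt_max q0.
have qr : q <= r by rewrite le_max lexx.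
have g0 : 0 <= g by apply: le_trans hg; rewrite mulr_ge0// exprn_ge0// sqrtr_ge0.
have ar0 : 0 <= a * r by rewrite mulr_ge0// ltW.
pose p := q `^ sg.
have p0 : 0 < p by exact: powR_gt0.
have qp : q <= p by case/andP: sg1 => _ h1; apply: ger1_powR => //; rewrite q0.
(* [a r] at the grid quantiles plus [1 / n] between them; [1 / n <= 2 q^2 <= 2 r] yields the factor
   [a + 2]. *)
pose dl := a * r + n%:R^-1.
have nVr : n%:R^-1 <= 2 * r.
  rewrite (le_trans nq)// ler_wpM2l// (le_trans _ qr)// expr2 ler_piMl// ltW//.
have dl0 : 0 <= dl by rewrite addr_ge0// invr_ge0.
have dlr : dl <= (a + 2) * r by rewrite /dl mulrDl lerD2l.
have unif t : `|ecdf z t - G t| <= dl.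
  apply: (ecdf_uniform cX rhoM n0 ar0) => l ln.
  have u01 : 0 < (l%:R / n%:R : R) <= 1.
    case/andP: ln => l0 ln; rewrite divr_gt0 ?ltr0n//= ler_pdivrMr// mul1r ler_nat.
    exact: ltnW.
  have := hD l ln; rewrite sumrB sumr_const card_ord -/Q.
  rewrite /G (distr_fun_quantile cX rhoM u01) -[X in _ - X]mulr_natl => h.
  rewrite ecdfE -(ler_pM2l nR0) -[X in X * _](gtr0_norm nR0) -normrM mulrBr mulVKf ?gt_eqF//.
pose xi j k := n%:R^-1 * \sum_(i < n) wav W j k (ecdf z (tnth z i).1) *
        ((tnth z i).2 - ht (G (tnth z i).1)).
pose bi j k := n%:R^-1 * \sum_(i < n) ht (G (tnth z i).1) * wav W j k (ecdf z (tnth z i).1) - be j k.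
have bhE j k : beta_hat W z j k = be j k + bi j k + xi j k.
  rewrite /beta_hat /bi /xi addrCA subrr addr0 -mulrDr -big_split/=; congr (_ * _).
  by apply: eq_bigr => i _; ring.
have J2 : 2 ^+ J * q <= 1 := level_noise n2 Jhigh.
have Jn : (2 : R) ^+ J <= n%:R := level_le_size n2 Jhigh.
have Jp : J.+1%:R * p <= Ce * e := level_noise_pow s2 n2 Jhigh sgl.
have mod u v : `|ht u - ht v| <= H * (p * (1 + `|u - v| / q)) by exact: htm.
have hyp j k : (coarsest W <= j <= J)%N -> (k < 2 ^ j)%N ->
    [/\ `|be j k| <= M * th ^+ j / Num.sqrt 2 ^+ j,
        `|bi j k| <= Cb * p * (1 + dl / q) / Num.sqrt 2 ^+ j & `|xi j k| <= a * r].
  move=> jJ kj; have /andP[Wj jJ'] := jJ; split; first exact: htc.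
    have := @coef_bias R W N B WN B1 WB ht H C p q dl j k J n (fun i => G (tnth z i).1)
      (fun i => (tnth z i).1) mht (ltW H0).
    rewrite q0 q1 => /(_ isT qp dl0 htb mod n0 nq J2 Jn jJ kj zinj) h.
    rewrite /bi /Cb; under eq_bigr do rewrite ecdfE.
    by apply: h => i; rewrite -ecdfE.
  rewrite /xi normrM ger0_norm ?invr_ge0 ?(ltW nR0)// ler_pdivrMl//; exact: hE.
have hdich : (Cb * (a + 3) * p < e) \/ c0 <= e.
  rewrite /e (rateE s2 n2); apply: good_or_large => //.
  by apply: mulr_gt0 => //; rewrite ltr_wpDl.
have eJ : e / q <= Num.sqrt 2 ^+ J := cutoff_le_level s2 n2 Jlow.
have est := @estimator_sup R W B B1 WB th q e p Ce c0 Cb M kappa a r rr g dl J be bi xi (ecdf z x) th01 q0 e0 p0 (ltW M0) (ltW Cb0) a0 c00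
  (ltW Ce0) rr0 g0 (high_level_le s2 n2) eJ J2 Jp hdich hkap (erefl r) hg.
have dlr2 : 0 <= dl <= (a + 2) * r by rewrite dl0.
have {}est := est dlr2 hyp; rewrite -/C1 in est.
have T1 : `|ht (G x) - ht (ecdf z x)| <= H * Ce * (a + 3) * e + H * Ce * (a + 2) * g.
  apply: (le_trans (mod _ _)); rewrite distrC.
  have rq_le : e * (r / q) <= e + g.
    have : e * (q / q) = e by rewrite divff ?gt_eqF// mulr1.
    have : e * (rr / q) <= g.
      by apply: le_trans hg; rewrite mulrCA mulrC ler_wpM2r.
    rewrite /r; case: (leP q rr) => _; move: g0 e0; lra.
  have pe : p <= Ce * e by rewrite (le_trans _ Jp)// ler_peMl ?(ltW p0)// ler1n.
  have d1 : 1 + `|ecdf z x - G x| / q <= 1 + (a + 2) * (r / q).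
    by rewrite lerD2l mulrA ler_wpM2r ?invr_ge0 ?(ltW q0)// (le_trans (unif x)).
  have d0 : 0 <= 1 + `|ecdf z x - G x| / q by rewrite addr_ge0// divr_ge0// ltW.
  have h1 : p * (1 + `|ecdf z x - G x| / q) <= Ce * e * (1 + (a + 2) * (r / q)).
    by rewrite ler_pM// ltW.
  have a2 : 0 <= a + 2 by rewrite addr_ge0.
  have h2 : e * (1 + (a + 2) * (r / q)) <= (a + 3) * e + (a + 2) * g.
    have := ler_wpM2l a2 rq_le; lra.
  have h3 : p * (1 + `|ecdf z x - G x| / q) <= Ce * ((a + 3) * e + (a + 2) * g).
    by apply: (le_trans h1); rewrite -mulrA ler_wpM2l// ltW.
  apply: (le_trans (ler_wpM2l (ltW H0) h3)).
  by rewrite le_eqVlt; apply/orP; left; apply/eqP; ring.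
have T2 := tail_at_level (ecdf z x).
have fE : f_hat W kappa J z x =
    \sum_(coarsest W <= j < J.+1) \sum_(0 <= k < 2 ^ j) be j k * wav W j k (ecdf z x) +
    \sum_(coarsest W <= j < J.+1) \sum_(0 <= k < 2 ^ j)
     ((if kappa * q <= `|be j k + bi j k + xi j k| then be j k + bi j k + xi j k else 0)
       - be j k) * wav W j k (ecdf z x).
  rewrite -big_split/=; apply: eq_bigr => j _; rewrite -big_split/=; apply: eq_bigr => k _.
  by rewrite /beta_tilde bhE /threshold -/q -mulrDl; congr (_ * _); rewrite [RHS]addrC subrK.
rewrite fE; set S1 := \sum_(_ <= j < _) _ in T2 *; set S2 := \sum_(_ <= j < _) _ in est *.
rewrite (_ : ht (G x) - (S1 + S2) = (ht (G x) - ht (ecdf z x)) + (ht (ecdf z x) - S1) - S2); last by ring.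
rewrite (le_trans (ler_normB _ _))// (le_trans (lerD (ler_normD _ _) (lexx _)))//.
rewrite (le_trans (lerD (lerD T1 T2) est))// /rate_const /dev_const.
by rewrite le_eqVlt; apply/orP; left; apply/eqP; ring.
Qed.

End good_event.

(** * Choice of the constants and conclusion *)

Theorem theorem2 (R : realType) (X : set R) (M : R)
  (W : wavelet_system R) (N : R) :
  compact X -> 0 < M -> is_wavelet_basis W N ->
  exists2 kappa0 : R, 0 < kappa0 & forall kappa : R, kappa0 <= kappa ->
  forall s : R, 2^-1 < s -> vanishing_moments W s ->
  exists gamma T D : R, [/\ 0 < gamma, 0 < T, 0 < D &
    forall (n J : nat) (eta : R), (2 <= n)%N ->
      (n%:R / ln n%:R) `^ (1 + 2 * s)^-1 <= 2 ^+ J ->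
      (2 : R) ^+ J <= (n%:R / ln n%:R) `^ 2^-1 ->
      forall (rho : probability (measurableTypeR R * measurableTypeR R)%type R)
        (f_rho : R -> R),
      Mclass X M W s rho -> is_regression_function rho f_rho ->
      let prob := iid_law rho n
        [set z | (eta%:E < loss rho (fun x => f_rho x - f_hat W kappa J z x)%R)%E] in
      (D * rate s n <= eta ->
        (prob <= (T * expR (- (gamma *
          Num.max (n%:R * 2 ^- J * J%:R^-1 * eta ^+ 2) (ln n%:R))))%:E)%E) /\
      (eta <= D * rate s n -> (prob <= T%:E)%E)].
Proof.
move=> cX M0 WN; have [B B1 WB] := wav_boundsP WN.
have B0 : 0 < B := lt_le_trans ltr01 B1.
pose b := M / 2; have b0 : 0 < b by rewrite divr_gt0.
pose S0 := B ^+ 2 * (`|N| + 1).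
have S01 : 1 <= S0.
  by rewrite /S0 -[leLHS]mulr1 ler_pM// ?exprn_ege1// lerDr.
have S00 : 0 < S0 := lt_le_trans ltr01 S01.
(* Large enough for both kinds of tails, at deviation [n a r], to be at most [2 exp(-2 n r^2)]: this
   requires [a^2 >= 64] for the grid events and [a^2 >= 64 b^2 S0] for the wavelet ones. *)
pose a := 8 * (1 + b * S0).
have bS : 0 < b * S0 by exact: mulr_gt0.
have a0 : 0 <= a by rewrite /a; lra.
have a64 : 64 <= a ^+ 2.
  have -> : a ^+ 2 = 64 + 64 * (2 * (b * S0) + (b * S0) ^+ 2) by rewrite /a; ring.
  by have := sqr_ge0 (b * S0); lra.
have a64b : 64 * (b ^+ 2 * S0) <= a ^+ 2.
  have -> : a ^+ 2 = 64 + 64 * (2 * (b * S0)) + 64 * (b ^+ 2 * S0 ^+ 2) by rewrite /a; ring.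
  have : b ^+ 2 * S0 <= b ^+ 2 * S0 ^+ 2 by rewrite ler_wpM2l ?sqr_ge0// expr2 ler_peMl// ltW.
  by lra.
exists (M + a + 1); first by lra.
move=> kappa hk s hs _.
pose s' := 2 * s / (1 + 2 * s).
have d0 : 0 < 1 + 2 * s by lra.
have s'0 : 0 < s' by rewrite divr_gt0//; lra.
(* [s' < s] amounts to [s (2 s - 1) > 0], that is to [s > 1/2]. It leaves room for [sg], taken as
   the midpoint. *)
have s'1 : s' < Num.min s 1.
  rewrite lt_min; apply/andP; split; rewrite ltr_pdivrMr//; last by lra.
  have : 0 < s * (2 * s - 1) by rewrite mulr_gt0//; lra.
  by lra.
pose sg := (s' + Num.min s 1) / 2.
have sgl : s' < sg by rewrite /sg; lra.
have sgm : sg < Num.min s 1 by rewrite /sg; lra.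
have /andP[sgs sg1] : (sg < s) && (sg < 1) by rewrite -lt_min.
have sg01 : 0 < sg <= 1 by rewrite (lt_trans s'0 sgl) ltW.
pose L1 := @rate_const R M N B s kappa a sg.
pose L2 := @dev_const R M N B s a sg.
have L10 : 0 <= L1 by exact: (@rate_const_ge0 R M M0 N B s kappa a sg).
have L20 : 0 <= L2 by exact: (@dev_const_ge0 R M M0 N B s a sg).
(* With [g = c eta], the term [L2 g] is at most [eta / 2]. *)
pose c := (2 * (L2 + 1))^-1.
have L2p : 0 < 2 * (L2 + 1) by lra.
have c0 : 0 < c by rewrite invr_gt0.
have cL : L2 * c <= 2^-1.
  by rewrite /c ler_pdivrMr//; lra.
have c1 : c <= 1 by rewrite /c invf_le1//; lra.
(* [c^2] is the ratio of [n rr^2] to the required exponent, 6 is 2 for two-sided tails times 3 for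
   at most [3 n] events, and [D >= 2 L1] bounds the term [L1 * rate s n] by [eta / 2]. *)
exists (c ^+ 2), 6, (2 * L1 + 1); split; [exact: exprn_gt0|by []|lra|].
move=> n J eta n2 Jlow Jhigh rho f Mf hf /=.
have rhoM : model X M rho := Mf.1.
have mf := measurable_regression hf.
set A := (X in iid_law rho n X).
have mA : measurable A by exact: (@measurable_loss_event R W B kappa eta J n rho f B1 WB mf).
split=> [hD|_]; last first.
  by rewrite (le_trans (probability_le1 _ mA))// lee_fin ler1n.
have n0 : (0 < n)%N by exact: leq_trans n2.
have nR0 : 0 < n%:R :> R by rewrite ltr0n.
have e0 : 0 < rate s n := rate_gt0 s n2.
have eta0 : 0 < eta by apply: lt_le_trans hD; rewrite mulr_gt0//; lra.
have s0 : 0 < s by lra.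
have [ht [[mht htb] htm htc htt htE]] := regression_representation cX M0 rhoM WN B1 WB s0 Mf hf.
pose q : R := Num.sqrt (ln n%:R / n%:R).
have q0 : 0 < q := noise_gt0 R n2.
have v0 : 0 <= (2 : R) ^- J * J%:R^-1 by rewrite mulr_ge0 ?invr_ge0 ?exprn_ge0.
(* Deviations up to [r = max(q, rr)] are tolerated: [n * rr ^+ 2] is the required
   exponent, and the small factor [c] lets [eta] absorb the error due to [rr]. *)
pose rr := c * Num.sqrt (2 ^- J * J%:R^-1) * eta.
have rr0 : 0 <= rr by rewrite !mulr_ge0 ?sqrtr_ge0 ?(ltW c0) ?(ltW eta0).
pose g := c * eta.
have hg : Num.sqrt 2 ^+ J * rr <= g.
  (* The square of the left side is [1 / J], which for [J = 0] is 0, the inverse of 0 being 0. *)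
  have h1 : Num.sqrt 2 ^+ J * Num.sqrt (2 ^- J * J%:R^-1) <= 1 :> R.
    rewrite -(@ler_pXn2r _ 2)// ?nnegrE ?mulr_ge0 ?exprn_ge0 ?sqrtr_ge0//.
    rewrite exprMn sqrt2X_sqr sqr_sqrtr// mulrA divff ?mul1r ?gt_eqF ?exprn_gt0// expr1n.
    by case: (J) => [|m]; rewrite ?invr0// invf_le1 ?ltr0n// ler1n.
  rewrite /rr /g [leLHS](_ : _ = c * eta * (Num.sqrt 2 ^+ J * Num.sqrt (2 ^- J * J%:R^-1))); last by ring.
  by rewrite ler_piMr// mulr_ge0// ltW.
pose r := Num.max q rr.
have qr : q <= r by rewrite le_max lexx.
have r0 : 0 < r := lt_le_trans q0 qr.
have mFG : measurable_fun setT ((fun x => ht (distr_fun rho x)) : mR R -> R).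
  by apply: (measurableT_comp mht); exact: (measurable_distr_fun rhoM).
have FGb : {ae marginalX rho, forall x : mR R, `|ht (distr_fun rho x)| <= M / 2}.
  have := regression_bounded cX M0 rhoM hf.
  by move: htE; apply: filterS2 => x <-.
have FGE u : measurable_fun setT (u : mR R -> R) -> (exists K : R, forall x, `|u x| <= K) ->
    (\int[rho]_z (z.2 * u z.1)%:E = \int[rho]_z (ht (distr_fun rho z.1) * u z.1)%:E)%E.
  move=> mu uK; rewrite (regression_conditional cX M0 rhoM hf mu uK).
  have mu1 : measurable_fun setT (fun z : obs R => u z.1).
    by apply: (measurableT_comp mu); exact: measurable_fst.
  apply: ae_eq_integral => //.
  - apply/measurable_EFinP; apply: measurable_funM => //.
    by apply: (measurableT_comp mf); exact: measurable_fst.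
  - apply/measurable_EFinP; apply: measurable_funM => //.
    by apply: (measurableT_comp mFG); exact: measurable_fst.
  - by move: (marginal_ae htE); apply: filterS => z /= -> _.
have [mT T00] := ties_null rhoM n.
pose y := n%:R * (a * r).
have y0 : 0 <= y by apply: mulr_ge0 => //; apply: mulr_ge0 => //; exact: ltW.
have yE : y ^+ 2 = n%:R ^+ 2 * r ^+ 2 * a ^+ 2 by rewrite /y; ring.
have nr0 : 0 <= n%:R ^+ 2 * r ^+ 2 by rewrite mulr_ge0 ?sqr_ge0.
(* Twice the exponent finally wanted: one half pays for the number of events, because
   [n r^2 >= ln n]. *)
pose eps := 2 * expR (- (2 * (n%:R * r ^+ 2))).
have eps0 : 0 <= eps by rewrite mulr_ge0// expR_ge0.
have exp_le d : 0 < d -> 64 * d <= a ^+ 2 ->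
    2 * expR (- (y ^+ 2 / (32 * d * n%:R))) <= eps.
  move=> dp hd; rewrite /eps ler_wpM2l// ler_expR lerN2 ler_pdivlMr; last first.
    by rewrite mulr_gt0// mulr_gt0.
  rewrite yE [leLHS](_ : _ = n%:R ^+ 2 * r ^+ 2 * (64 * d)); last by ring.
  by rewrite ler_wpM2l.
(* Empty below the coarsest level, as [union_bound] runs over all levels from 0. *)
pose E j k := [set z : n.-tuple (obs R) | (coarsest W <= j)%N /\
  (injective (fun i => (tnth z i).1) /\
    (y < `|\sum_(i < n) wav W j k (ecdf z (tnth z i).1) *
        ((tnth z i).2 - ht (distr_fun rho (tnth z i).1))|)%R)].
pose D l := [set z : n.-tuple (obs R) |
    (y < `|\sum_(i < n) (((tnth z i).1 <= quantile rho (l%:R / n%:R))%R%:R -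
       distr_fun rho (quantile rho (l%:R / n%:R)))|)%R].
have Jn : (2 : R) ^+ J <= n%:R := level_le_size n2 Jhigh.
have hE j k : (j < J.+1)%N -> (k < 2 ^ j)%N ->
    measurable (E j k) /\ (iid_law rho n (E j k) <= eps%:E)%E.
  move=> jJ kj; have [Wj|Wj] := leqP (coarsest W) j; last first.
    have -> : E j k = set0 by apply/seteqP; split => // z [] /=; rewrite leqNgt Wj.
    by rewrite measure0 lee_fin.
  have jn : (2 : R) ^+ j <= n%:R.
    by apply: le_trans Jn; rewrite ler_weXn2l// ler1n.
  have [h1 h2] := wavelet_tail cX rhoM WN B1 WB M0 mFG FGb FGE n0 jn Wj kj y0.
  have EE : E j k = [set z : n.-tuple (obs R) | injective (fun i => (tnth z i).1) /\
      (y < `|\sum_(i < n) wav W j k (ecdf z (tnth z i).1) *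
        ((tnth z i).2 - ht (distr_fun rho (tnth z i).1))|)%R].
    by apply/seteqP; split => z //= [].
  rewrite EE; split; first exact: h1.
  apply: (le_trans h2); rewrite lee_fin.
  rewrite (_ : 32 * (M / 2) ^+ 2 * (B ^+ 2 * (`|N| + 1) * n%:R) = 32 * (b ^+ 2 * S0) * n%:R).
    by apply: exp_le => //; apply: mulr_gt0 => //; exact: exprn_gt0.
  by rewrite /b /S0; ring.
have hDl l : (l < n)%N -> measurable (D l) /\ (iid_law rho n (D l) <= eps%:E)%E.
  move=> ln; have [h1 h2] := @grid_tail R rho n (quantile rho (l%:R / n%:R)) y n0 y0.
  split; first exact: h1.
  apply: (le_trans h2); rewrite lee_fin -[32]mulr1; apply: exp_le => //.
  by rewrite mulr1.
have ub : (iid_law rho n A <= ((2 * 2 ^+ J + n%:R) * eps)%:E)%E.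
  apply: (union_bound eps0 mA mT T00 hE hDl) => z /= zT zE zD.
  have zinj : injective (fun i => (tnth z i).1) by exact: contrapT.
  apply/negP; rewrite -leNgt; apply: loss_le.
  - exact: ltW.
  - apply: measurable_funB => //.
    by apply: (measurable_f_hat _ B1 WB) => //; exact: measurable_cst.
  move: htE; apply: filterS => x ->.
  have := @good_event R X M rho cX M0 rhoM W N B s kappa a sg WN B1 WB hs sg01 sgs sgl a0 hk
    n J rr g n2 Jlow Jhigh rr0 hg ht mht htb htm htc htt z x zinj.
  move=> /(_ _ _)/le_trans; apply.
  - move=> j k /andP[Wj jJ] kj; rewrite leNgt; apply/negP => hh.
    by apply: (zE j k); rewrite ?ltnS.
  - move=> l /andP[_ ln]; rewrite leNgt; apply/negP => hh.
    exact: (zD l ln).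
  rewrite -/L1 -/L2 /g.
  have := ler_wpM2r (ltW eta0) cL.
  by clear -hD e0; lra.
apply: (le_trans ub); rewrite lee_fin.
have nr_q : ln n%:R <= n%:R * r ^+ 2.
  rewrite -(noise_sqr R n2) ler_wpM2l// ler_pXn2r ?nnegrE ?(ltW q0) ?(ltW r0)//.
have nr_rr : n%:R * rr ^+ 2 <= n%:R * r ^+ 2.
  by rewrite ler_wpM2l// ler_pXn2r ?nnegrE ?(ltW r0)// le_max lexx orbT.
apply: (@le_trans _ _ (6 * expR (- (n%:R * r ^+ 2)))).
  apply: (@le_trans _ _ (3 * n%:R * eps)).
    apply: ler_wpM2r => //; clear -Jn; lra.
  rewrite /eps [leLHS](_ : _ = 6 * (n%:R * expR (- (2 * (n%:R * r ^+ 2))))); last by ring.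
  rewrite ler_wpM2l//.
  have -> : - (2 * (n%:R * r ^+ 2)) = - (n%:R * r ^+ 2) + - (n%:R * r ^+ 2) by ring.
  rewrite expRD mulrA ler_piMl ?expR_ge0//.
  rewrite expRN ler_pdivrMr ?expR_gt0// mul1r.
  by rewrite -[leLHS]lnK ?posrE// ler_expR.
rewrite ler_wpM2l// ler_expR lerN2.
have c2 : c ^+ 2 <= 1 by rewrite exprn_ile1// ltW.
have c20 : 0 <= c ^+ 2 by exact: sqr_ge0.
(* [n r^2] dominates both candidates for the maximum: [n q^2 = ln n], where [c <= 1] discards [c^2],
   and [n rr^2], which contains [c^2] by construction. *)
have [h|h] := leP (n%:R * 2 ^- J * J%:R^-1 * eta ^+ 2) (ln n%:R).
  apply: le_trans nr_q; rewrite ler_piMl// ltW//.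
  by have /andP[h' _] := ln_nat_bounds R n2; rewrite (lt_le_trans _ h').
apply: le_trans nr_rr; rewrite /rr !exprMn sqr_sqrtr//.
by rewrite le_eqVlt; apply/orP; left; apply/eqP; ring.
Qed.
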